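(* Let $\Gamma$ be a ribbon graph whose underlying graph $G=(V,E,r)$ is connected and planar, and let $\Gamma^\flat_E$ be its blowup with the canonical perfect matching. Then: (a) $\langle\Gamma^\flat_E\rangle_2(1,-1)=2^{|V|}$ if $\Gamma$ is Eulerian, and $\langle\Gamma^\flat_E\rangle_2(1,-1)=0$ otherwise. (b) $\langle\Gamma^\flat_E\rangle_1(1)=\#\{3\text{-edge colorings of }\Gamma\}$ when $\Gamma$ is trivalent. (c) $\Gamma$ is 4-face colorable if and only if $$\big(Q_4^{+}(\Gamma^\flat_E)-Q_4^{-}(\Gamma^\flat_E)\big)\big|_{q=1}>0.$$ In particular, the $q$-graded homological condition $Q_4^{+}(\Gamma^\flat_E)>_{\mathrm{cw}}Q_4^{-}(\Gamma^\flat_E)$ implies that $\Gamma$ is 4-face colorable. Thus proving this coefficientwise positivity condition for every connected planar ribbon graph $\Gamma$ would imply the four color theorem. (d) Given a nonnegative integer $n$ with $n\in2\mathbb{Z}$ or $n\in3\mathbb{Z}$, one has $\langle\Gamma^\flat_E\rangle_n(x)\ge\chi(\Gamma^*,n')$, where $\chi(\Gamma^*,n')$ is the chromatic polynomial, evaluated at $n'$, of the geometric dual $\Gamma^*$ of $\Gamma$, and $(x,n')$ is any of the following pairs: for $n>0$ even, $x=(q,b)=(1,1)$ and $n'=3n$, or $x=(q,b)=(1,-1)$ and $n'=n$; for $n$ odd, $x=q=1$ and $n'=3n$; for $n=0$, $x=(1,-1)$ and $n'=0$.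
   Context: **Ribbon graphs.** Graphs are finite undirected multigraphs $G=(V,E,r)$ with vertex set $V$, nonempty edge set $E$, and $r$ assigning to each edge its unordered pair of endpoints. A ribbon graph $\Gamma$ (always oriented here) is a graph $G$, its underlying graph, embedded in an oriented surface with boundary that deformation retracts onto $G$; equivalently, $G$ with a cyclic order of the half-edges at each vertex. It is represented by a ribbon diagram: a drawing of $G$ in the plane with vertices as dots and edges as curves that may cross, inducing the given cyclic orders. A perfect matching graph $\Gamma_M$ is a ribbon graph with a perfect matching $M$ of its underlying graph (each vertex is incident to exactly one edge of $M$). $\Gamma$ is trivalent if all vertices of $G$ have degree three, and Eulerian if all vertex degrees are even. A 3-edge coloring is a proper coloring of the edges with 3 colors. The faces of $\Gamma$ are the complementary regions of $G$ in the closed surface obtained by attaching discs to the boundary of the surface of $\Gamma$; $\Gamma$ is 4-face colorable if its faces can be colored with 4 colors so that the two sides of every edge have different colors. The geometric dual $\Gamma^*$ has one vertex per face and one edge for each edge of $G$, joining the faces on its two sides. **Blowup.** The blowup $\Gamma^\flat$ is the trivalent ribbon graph obtained by replacing every vertex of degree $d$ by a small circle carrying $d$ vertices, one at the end of each of the $d$ incident half-edges, in their cyclic order. The edges of $G$ form the canonical perfect matching of $\Gamma^\flat$, giving $\Gamma^\flat_E$. **Smoothings, states, $n$-bracket.** Draw a matching edge $e$ of a trivalent perfect matching graph vertically, with the two other half-edges at its top vertex going up-left and up-right, and the two other half-edges at its bottom vertex going down-left and down-right. The 0-smoothing deletes $e$ and its endpoints and joins up-left with down-left and up-right with down-right; the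 1-smoothing joins up-left with down-right and up-right with down-left. For $n\ge1$ the $n$-bracket is determined by $\langle\Gamma_M\rangle_n=\langle\text{0-smoothing at }e\rangle_n-\langle\text{1-smoothing at }e\rangle_n$ for every matching edge $e$, multiplicativity under disjoint union, and the value of a circle (possibly drawn with crossings) $$\langle\text{circle}\rangle_n=\begin{cases}2(2+2q^2+\dots+2q^{n-2}+qb+q^3b+\dots+q^{n-1}b)&n\text{ even},\\3(1+q+\dots+q^{n-1})&n\text{ odd},\end{cases}$$ where $q^n=1$ and (for $n$ even) $b^2=1$; its value is written $\langle\cdot\rangle_n(q,b)$ for $n$ even and $\langle\cdot\rangle_n(q)$ for $n$ odd. By convention $\langle\Gamma^\flat_E\rangle_0(1,-1)=0$. If $M=\{e_1,\dots,e_\ell\}$ and $\alpha\in\{0,1\}^\ell$, the state $\Gamma_\alpha$ is the collection of circles obtained by applying the $\alpha_i$-smoothing at each $e_i$; $k_\alpha$ is its number of circles, $|\alpha|=\sum\alpha_i$. **Möbius homology for even $n$.** Let $R=\mathbb{Z}[\frac1{3n}]$ and $V=R[x,y]/(x^n,y^3-xy)$ (not to be confused with the vertex set), with basis $x^iy^j$ ($0\le i\le n-1$, $0\le j\le2$), graded by $\mathbb{Z}/n\mathbb{Z}\times\mathbb{Z}/2\mathbb{Z}$ with $x^iy^j$ in degree $(2i+j,j)$. Let $\mu_V$ be multiplication, $m_V(v)=v\cdot x^{(n-2)/2}y^2$, and $$\Delta_V(v)=-\tfrac1{3n}\sum_{i+j=n,\ i,j>0}(vx^i)\otimes x^j+\tfrac1{3n}\sum_{i+j=n-1}\big((vx^iy^2)\otimes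 x^j+(vx^iy)\otimes x^jy+(vx^i)\otimes x^jy^2\big).$$ Put $C^{i}(\Gamma_M)=\bigoplus_{|\alpha|=i}V^{\otimes k_\alpha}$, with tensor factors indexed by the circles of $\Gamma_\alpha$. If $\alpha'$ arises from $\alpha$ by changing one entry 0 to 1, $\partial_{\alpha\alpha'}$ is $\mu_V$ if two circles merge, $\Delta_V$ if one circle splits into two, $m_V$ if one circle is changed into one circle, on the affected factors, and the identity on the others. The differential is $\partial^i(v)=\sum_{\alpha'}(-1)^{f_{\alpha\alpha'}}\partial_{\alpha\alpha'}(v)$ for $v\in V^{\otimes k_\alpha}$, where $f_{\alpha\alpha'}$ is the number of entries 1 to the left of the changed entry; it preserves the $\mathbb{Z}/n\mathbb{Z}\times\mathbb{Z}/2\mathbb{Z}$-grading. $MH_n^{i,(a,\epsilon)}(\Gamma_M;R)$ denotes the homology in homological degree $i$ and internal degree $(a,\epsilon)$. **Positive and negative parts.** $Q_n^{+}(\Gamma_M)=\sum q^a\,\mathrm{rank}\,MH_n^{i,(a,\epsilon)}(\Gamma_M;R)$, summed over all $i,a,\epsilon$ with $i+\epsilon\equiv0\bmod2$, and $Q_n^{-}(\Gamma_M)$ is the same sum over $i+\epsilon\equiv1\bmod2$; both lie in $\mathbb{Z}[q]/(q^n-1)$. For $f,g\in\mathbb{Z}[q]/(q^4-1)$, $f>_{\mathrm{cw}}g$ means that, writing $f-g=c_0+c_1q+c_2q^2+c_3q^3$, all $c_i$ are nonnegative and at least one is positive.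
   Formalization: Parts (b)–(d) assume Γ itself is planar as a ribbon graph (genus 0), not only that G is planar. Otherwise they fail: the theta graph with equal cyclic orders (torus) has bracket −6, not 6, in (b) and −24 < 0 in (d); one vertex with loops in order abab violates (c). *)

(* Defs.v *)
(* MathComp; boolp supplies classical choice. *)
From HB Require Import structures.
From mathcomp Require Import all_boot all_order fingroup perm all_algebra.
From mathcomp Require Import boolp.
Set Implicit Arguments.
Unset Strict Implicit.
Unset Printing Implicit Defensive.
Import Order.TTheory GRing.Theory Num.Theory.

(* The ends of an edge e are the half-edges (e, false) and (e, true).  The
   resulting orientation of e is only a naming of its two ends. *)
Record graph := Graph {
  vertex : finType;
  edge : finType;
  endpt : edge * bool -> vertex;
  edge_gt0 : 0 < #|{: edge}| }.

Definition half (G : graph) : finType := (edge G * bool)%type.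

Definition flip (G : graph) (h : half G) : half G := (h.1, ~~ h.2).

(* A loop contributes two to the degree. *)
Definition degree (G : graph) (v : vertex G) : nat :=
  #|[set h : half G | endpt h == v]|.

Definition trivalent (G : graph) : Prop := forall v : vertex G, degree v = 3.

Definition eulerian (G : graph) : Prop :=
  forall v : vertex G, ~~ odd (degree v).

Definition adj_off (G : graph) (A : {set edge G}) : rel (vertex G) :=
  fun v w => [exists h : half G,
    [&& h.1 \notin A, endpt h == v & endpt (flip h) == w]].

Definition connected_graph (G : graph) : Prop :=
  forall v w : vertex G, connect (adj_off set0) v w.

Definition bridgeless (G : graph) : Prop :=
  forall h : half G, connect (adj_off [set h.1]) (endpt h) (endpt (flip h)).

Definition loopless (G : graph) : Prop :=
  forall h : half G, endpt h != endpt (flip h).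

Definition vertex_coloring (G : graph) (k : nat)
    (c : {ffun vertex G -> 'I_k}) : bool :=
  [forall h : half G, c (endpt h) != c (endpt (flip h))].

(* Properness is tested on half-edges: a graph with a loop has no proper edge
   coloring. *)
Definition edge_coloring (G : graph) (k : nat)
    (c : {ffun edge G -> 'I_k}) : bool :=
  [forall h : half G, forall h' : half G,
    (h != h') && (endpt h == endpt h') ==> (c h.1 != c h'.1)].

Definition edge_colorings (G : graph) (k : nat) : nat :=
  #|[set c : {ffun edge G -> 'I_k} | edge_coloring c]|.

Definition vertex_colorings (G : graph) (k : nat) : nat :=
  #|[set c : {ffun vertex G -> 'I_k} | vertex_coloring c]|.

Section ChromaticPolynomial.
Local Open Scope ring_scope.
Variable G : graph.

Let adjA (A : {set edge G}) := adj_off (~: A).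

Let adjA_sym A : connect_sym (adjA A).
Proof.
apply: sym_connect_sym => v w; apply/existsP/existsP => -[h /and3P[hA hv hw]];
  by exists (flip h); rewrite /flip /= negbK -surjective_pairing; apply/and3P.
Qed.

Let mono (k : nat) (c : {ffun vertex G -> 'I_k}) (e : edge G) :=
  c (endpt (e, false)) == c (endpt (e, true)).

Let card_mono (A : {set edge G}) k :
  #|[set c : {ffun vertex G -> 'I_k} | [forall e in A, mono c e]]|
  = (k ^ #|[set v | roots (adjA A) v]|)%N.
Proof.
set S := [set v | _].
pose T : finType := {v | v \in S}.
have rS v : fingraph.root (adjA A) v \in S by rewrite inE roots_root.
pose ext (g : {ffun T -> 'I_k}) : {ffun vertex G -> 'I_k} :=
  [ffun v => g (exist (fun v => v \in S) _ (rS v))].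
have ext_inj : injective ext.
  move=> g1 g2 /ffunP eqg; apply/ffunP => -[v vS].
  have := eqg v; rewrite !ffunE.
  suff -> : exist (fun v => v \in S) _ (rS v) = exist _ v vS by [].
  by apply: val_inj => /=; move: vS; rewrite inE => /eqP.
have -> : [set c | [forall e in A, mono c e]] = ext @: setT.
  apply/setP => c; rewrite !inE; apply/forall_inP/imsetP => [cA | [g _ ->] e eA].
    exists [ffun t => c (val t)]; first by rewrite inE.
    apply/ffunP => v; rewrite !ffunE /=.
    have /connectP[p pP ->] := connect_root (adjA A) v.
    elim: p v pP => //= w p IHp v /andP[/existsP[[e b] /and3P[]]] /=.
    rewrite inE negbK => /cA /eqP eA /eqP <- /eqP <- /IHp <-.
    by rewrite /flip /=; case: b.
  rewrite /mono !ffunE; apply/eqP; congr (g _); apply: val_inj => /=.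
  apply/(fingraph.rootP (@adjA_sym A))/connect1/existsP; exists (e, false).
  by rewrite /= inE negbK eA !eqxx.
rewrite card_imset // cardsT card_ffun card_ord; congr (_ ^ _)%N.
by rewrite card_sig; apply: eq_card => v; rewrite !inE.
Qed.

Lemma chromatic_poly_exists :
  {p : {poly int} | forall k, p.[k%:R] = (vertex_colorings G k)%:R}.
Proof.
exists (\sum_(A : {set edge G})
          (-1) ^+ #|A| * 'X^#|[set v | roots (adjA A) v]|) => k.
have cardE (P : pred {ffun vertex G -> 'I_k}) :
    #|[set c | P c]|%:R = \sum_c (P c)%:R :> int.
  rewrite -natr_sum -sum1_card big_mkcond /=; congr (_%:R).
  by apply: eq_bigr => c _; rewrite inE; case: (P c).
rewrite horner_sum [RHS]cardE.
transitivity (\sum_(A : {set edge G}) \sum_(c : {ffun vertex G -> 'I_k})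
    (-1) ^+ #|A| * [forall e in A, mono c e]%:R :> int).
  apply: eq_bigr => A _; rewrite -big_distrr /= -cardE card_mono.
  by rewrite hornerM hornerXn natrX -(rmorphN1 (@polyC int)) -rmorphXn hornerC.
rewrite exchange_big; apply: eq_bigr => c _ /=.
have cE : vertex_coloring c = [forall e, ~~ mono c e].
  apply/forallP/forallP => cP e; first exact: (cP (e, false)).
  by case: e => e [] /=; have := cP e; rewrite /mono /flip /= // eq_sym.
transitivity (\prod_(e : edge G) (- (mono c e)%:R + 1) : int); last first.
  rewrite cE; case: forallP => [cP | /forallP].
    by rewrite big1 // => e _; rewrite (negPf (cP e)) oppr0 add0r.
  rewrite negb_forall => /existsP[e /negbNE ce].
  by rewrite (bigD1 e) //= ce addNr mul0r.
rewrite bigA_distr; apply: eq_bigr => A _; rewrite -big_mkcond /=.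
under [RHS]eq_bigr do rewrite -mulN1r.
rewrite big_split /= prodr_const; congr (_ * _).
case: forall_inP => [cA | /forall_inP].
  by rewrite big1 // => e /cA ->.
rewrite negb_forall_in => /existsP[e /andP[eA ce]].
by rewrite (bigD1 e) //= (negPf ce) mul0r.
Qed.

(* The polynomial whose value at each natural number k is the number of proper
   vertex colorings with k colors. *)
Definition chromatic_poly : {poly int} := sval chromatic_poly_exists.

Lemma chromatic_polyE k : chromatic_poly.[k%:R] = (vertex_colorings G k)%:R.
Proof. exact: svalP chromatic_poly_exists k. Qed.

End ChromaticPolynomial.

(* The cycles of the permutation [rot] are the cyclic orders of the half-edges
   at the vertices. *)
Record rotation (G : graph) := Rotation {
  rot :> {perm half G};
  rotP : forall h k : half G, (endpt h == endpt k) = (k \in porbit rot h) }.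

Record ribbon := Ribbon {
  ugraph :> graph;
  rotn : rotation ugraph }.

Section Faces.
Variable Gamma : ribbon.
Local Notation half := (half Gamma).

(* The boundary component running along a given side of h passes to the other
   end of h and leaves along the next half-edge in the cyclic order there; the
   other side of the same edge is followed by [flip h]. *)
Definition face_next (h : half) : half := rotn Gamma (flip h).

Definition face (h : half) : {set half} := [set k | fconnect face_next h k].

Definition faces : {set {set half}} := [set face h | h : half].

Lemma face_in h : face h \in faces.
Proof. exact: imset_f. Qed.

Definition face_colorable (k : nat) : Prop :=
  exists c : {set half} -> 'I_k, forall h, c (face h) != c (face (flip h)).

Definition dual : graph :=
  @Graph {F : {set half} | F \in faces} (edge Gamma)
    (fun h => exist (fun F => F \in faces) (face h) (face_in h))
    (edge_gt0 Gamma).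

(* Euler's formula: for connected [Gamma], the closed surface obtained by
   attaching discs to the boundary is a sphere. *)
Definition planar_ribbon : Prop :=
  #|{: vertex Gamma}| + #|faces| = #|{: edge Gamma}| + 2.

End Faces.

(* For connected graphs: some choice of cyclic orders embeds G in the sphere.
   A ribbon graph on a planar graph need not be planar as a ribbon graph. *)
Definition planar_graph (G : graph) : Prop :=
  exists s : rotation G, planar_ribbon (Ribbon s).

(* The connected case of the theorem; colorings can be chosen on each connected
   component separately. *)
Definition four_color_theorem : Prop :=
  forall G : graph, connected_graph G -> planar_graph G -> loopless G ->
  exists c : {ffun vertex G -> 'I_4}, vertex_coloring c.

Definition perfect_matching (G : graph) (M : {set edge G}) : Prop :=
  forall v : vertex G, #|[set h : half G | (h.1 \in M) && (endpt h == v)]| = 1.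

Record pmgraph := PMGraph {
  pm_ribbon :> ribbon;
  matching : {set edge pm_ribbon};
  pm_trivalent : trivalent pm_ribbon;
  pm_perfect : perfect_matching matching }.

Section Blowup.
Variable Gamma : ribbon.
Local Notation E := (edge Gamma).
Local Notation H := (half Gamma).
Local Notation s := (rot (rotn Gamma)).

(* One vertex per half-edge h, placed at the end of h on the small circle; the
   edges are those of [Gamma] and, for each h, the arc from h to the next
   half-edge in the cyclic order.  (A vertex without half-edges would give a bare
   circle; a connected graph has none, since it has an edge.) *)
Definition blowup_endpt (k : (E + H) * bool) : H :=
  match k with
  | (inl e, b) => (e, b)
  | (inr h, false) => h
  | (inr h, true) => s h
  end.

Lemma blowup_edge_gt0 : 0 < #|{: E + H}|.
Proof. by rewrite card_sum addn_gt0 edge_gt0. Qed.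

Definition blowup_graph : graph := Graph blowup_endpt blowup_edge_gt0.

(* Counterclockwise at h: outwards, along the arc to the next half-edge, along
   the arc to the previous one. *)
Definition blowup_next (k : half blowup_graph) : half blowup_graph :=
  match k with
  | (inl e, b) => (inr (e, b), false)
  | (inr h, false) => (inr (s^-1%g h), true)
  | (inr h, true) => (inl (s h).1, (s h).2)
  end.

Lemma blowup_next_inj : injective blowup_next.
Proof.
have K : cancel blowup_next (fun k => match k with
  | (inl e, b) => (inr (s^-1%g (e, b)), true)
  | (inr h, false) => (inl h.1, h.2)
  | (inr h, true) => (inr (s h), false)
  end).
  case=> [[e b|h []]] //=; rewrite ?permKV //.
  by rewrite -surjective_pairing permK.
exact: can_inj K.
Qed.

Definition blowup_perm : {perm half blowup_graph} := perm blowup_next_inj.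

Lemma blowup_rotP (h k : half blowup_graph) :
  (endpt h == endpt k) = (k \in porbit blowup_perm h).
Proof.
have step (x : half blowup_graph) : endpt (blowup_perm x) = endpt x.
  by rewrite permE; case: x => [[e b|x []]] /=;
    rewrite ?permKV // -surjective_pairing.
apply/eqP/porbitP => [eq_hk | [i ->]]; last first.
  by elim: i => [|i IHi]; rewrite ?perm1 // expgSr permM step.
have to_out x : exists i, (blowup_perm ^+ i)%g x
    = (inl (blowup_endpt x).1, (blowup_endpt x).2).
  case: x => [[e b|x []]] /=; first by exists 0; rewrite perm1.
    by exists 1; rewrite expg1 permE.
  by exists 2; rewrite expgS expg1 permM !permE /= permKV.
have from_out x : exists i, (blowup_perm ^+ i)%g
    (inl (blowup_endpt x).1, (blowup_endpt x).2) = x.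
  case: x => [[e b|x []]] /=; first by exists 0; rewrite perm1.
    exists 2; rewrite expgS expg1 permM !permE /= -surjective_pairing.
    by rewrite permK.
  by exists 1; rewrite expg1 permE /= -surjective_pairing.
have [i hi] := to_out h; have [j kj] := from_out k.
exists (i + j); rewrite expgD permM hi; move: eq_hk => /= ->.
by rewrite kj.
Qed.

Definition blowup_ribbon : ribbon := Ribbon (Rotation blowup_rotP).

Definition blowup_matching : {set edge blowup_ribbon} := [set inl e | e : E].

Lemma blowup_fiber (v : H) : [set h : half blowup_ribbon | endpt h == v]
  = [set (inl v.1, v.2); (inr v, false); (inr (s^-1%g v), true)].
Proof.
apply/setP => -[[e b|h []]]; rewrite !inE /= !xpair_eqE /=;
  rewrite ?andbF ?andbT ?orbF ?orFb.
- by rewrite {1}[v]surjective_pairing xpair_eqE.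
- by rewrite -(inj_eq (@perm_inj _ s^-1%g)) permK.
- by [].
Qed.

Lemma blowup_trivalent : trivalent blowup_ribbon.
Proof.
move=> v; rewrite /degree blowup_fiber setUC cardsU1 cards2 !inE.
by rewrite !xpair_eqE andbF.
Qed.

Lemma blowup_perfect : perfect_matching blowup_matching.
Proof.
move=> v; rewrite -(cards1 ((inl v.1, v.2) : half blowup_ribbon)).
have -> // : [set h : half blowup_ribbon |
    (h.1 \in blowup_matching) && (endpt h == v)] = [set (inl v.1, v.2)].
apply/setP => k; have /setP/(_ k) := blowup_fiber v; rewrite !inE => ->.
case: k => [[e|h] b] /=; last by apply/negbTE/andP => -[/imsetP[]].
by rewrite imset_f // !xpair_eqE /= !orbF.
Qed.

Definition blowup : pmgraph := PMGraph blowup_trivalent blowup_perfect.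

End Blowup.

Section States.
Variable P : pmgraph.
Local Notation E := (edge P).
Local Notation H := (half P).
Local Notation s := (rot (rotn P)).

(* Let the matching edge e be vertical.  Counterclockwise, the half-edges at
   its upper end t are t, up-right = s t, up-left = s (s t), and those at its
   lower end u are u, down-left = s u, down-right = s (s u).  For e \in al the
   1-smoothing is applied, otherwise the 0-smoothing. *)
Definition smoothing (al : {set E}) (e : E) : rel H := fun h k =>
  [exists b : bool, let t := (e, b) in let u := (e, ~~ b) in
    if e \in al
    then (h == s t) && (k == s u) || (h == s (s t)) && (k == s (s u))
    else (h == s t) && (k == s (s u)) || (h == s (s t)) && (k == s u)].

Definition state_rel (al : {set E}) : rel H := fun h k =>
  (h.1 \notin matching P) && (k == flip h)
  || [exists e in matching P, smoothing al e h k].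

(* A circle of the state is given by the set of half-edges it runs through. *)
Definition circle (al : {set E}) (h : H) : {set H} :=
  [set k | connect (state_rel al) h k].

Definition circles (al : {set E}) : {set {set H}} :=
  [set circle al h | h : H & h.1 \notin matching P].

Local Open Scope ring_scope.

(* The value, when a circle has value c, of the diagram in which the matching
   edges listed in es are not yet smoothed and the others are smoothed
   according to al. *)
Fixpoint skein (R : nzRingType) (c : R) (es : seq E) (al : {set E}) : R :=
  match es with
  | [::] => c ^+ #|circles al|
  | e :: es' => skein c es' al - skein c es' (e |: al)
  end.

Definition circle_even (R : nzRingType) (n : nat) (q b : R) : R :=
  2 * \sum_(j < n./2) (2 * q ^+ j.*2 + q ^+ j.*2.+1 * b).

Definition circle_odd (R : nzRingType) (n : nat) (q : R) : R :=
  3 * \sum_(j < n) q ^+ j.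

(* Meant for n even and q ^+ n = b ^+ 2 = 1; the value for n = 0 is a
   convention. *)
Definition bracket_even (R : nzRingType) (n : nat) (q b : R) : R :=
  if n == 0%N then 0 else skein (circle_even n q b) (enum (matching P)) set0.

(* Meant for n odd and q ^+ n = 1. *)
Definition bracket_odd (R : nzRingType) (n : nat) (q : R) : R :=
  skein (circle_odd n q) (enum (matching P)) set0.

End States.

Section Localization.
Local Open Scope ring_scope.
Variable N : nat.

(* Z[1/N], for N > 0. *)
Definition zinv_pred : pred rat :=
  fun r => `[< exists k : nat, r * N%:R ^+ k \is a Num.int >].

Lemma zinv_subring : subring_closed zinv_pred.
Proof.
split=> [|r r' /asboolP[k rk] /asboolP[k' rk']|
          r r' /asboolP[k rk] /asboolP[k' rk']]; apply/asboolP.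
- by exists 0%N; rewrite expr0 mulr1 rpred1.
- exists (k + k')%N; rewrite mulrBl.
  rewrite {1}exprD mulrA [(k + k')%N]addnC exprD mulrA.
  by rewrite rpredB // rpredM // rpredX // rpred_nat.
- by exists (k + k')%N; rewrite exprD mulrACA rpredM.
Qed.

HB.instance Definition _ := GRing.isSubringClosed.Build rat zinv_pred zinv_subring.

Record zinv := Zinv { zinv_val : rat; _ : zinv_val \in zinv_pred }.

HB.instance Definition _ := [isSub for zinv_val].
HB.instance Definition _ := [Choice of zinv by <:].
HB.instance Definition _ := [SubChoice_isSubComNzRing of zinv by <:].

Lemma zinv_invP : N%:R^-1 \in zinv_pred.
Proof.
apply/asboolP; exists 1%N; rewrite expr1.
by case: N => [|m]; rewrite ?mulr0 ?rpred0 // mulVf ?rpred1 // pnatr_eq0.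
Qed.

Definition zinv_inv : zinv := Zinv zinv_invP.

End Localization.

Section Algebra.
Local Open Scope ring_scope.
Variable n : nat.

Definition coefR : comNzRingType := zinv (3 * n).

(* R[x,y]/(x^n, y^3 - xy), as (R[x]/(x^n))[y]/(y^3 - xy). *)
Definition truncR : comNzRingType := {poly %/ ('X^n : {poly coefR})}.
Definition algV : comNzRingType :=
  {poly %/ ('X^3 - qpolyX ('X^n : {poly coefR}) *: 'X : {poly truncR})}.

Definition yV : algV := qpolyX _.
Definition xV : algV := qpolyC _ (qpolyX _).

Definition lab : finType := ('I_n * 'I_3)%type.
Definition monV (l : lab) : algV := xV ^+ l.1 * yV ^+ l.2.

(* The coordinate of v on the basis element [monV l]. *)
Definition coordV (v : algV) (l : lab) : coefR :=
  ((v : {poly truncR})`_(l.2) : {poly coefR})`_(l.1).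

(* The linear map induced by the bilinear map T, applied to Delta(v). *)
Definition comulV (T : algV -> algV -> coefR) (v : algV) : coefR :=
  - (zinv_inv (3 * n) * \sum_(1 <= i < n) T (v * xV ^+ i) (xV ^+ (n - i)))
  + zinv_inv (3 * n) * \sum_(0 <= i < n) let j := (n - 1 - i)%N in
      (T (v * xV ^+ i * yV ^+ 2) (xV ^+ j)
       + T (v * xV ^+ i * yV) (xV ^+ j * yV)
       + T (v * xV ^+ i) (xV ^+ j * yV ^+ 2)).

Definition mobV (v : algV) : algV := v * xV ^+ (n - 2)./2 * yV ^+ 2.

End Algebra.

Section Homology.
Local Open Scope ring_scope.
Variables (P : pmgraph) (n : nat).
Local Notation E := (edge P).
Local Notation H := (half P).
Local Notation s := (rot (rotn P)).
Local Notation R := (coefR n).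
Local Notation V := (algV n).
Local Notation M := (matching P).

(* A pair (al, b) stands for the basis element of the tensor power of V over
   the circles of the state al whose factor at C is monV l for b C = Some l. *)
Definition estate : finType :=
  ({set E} * {ffun {set H} -> option (lab n)})%type.

Definition valid (x : estate) : bool :=
  (x.1 \subset M) && [forall C, isSome (x.2 C) == (C \in circles x.1)].

Definition factor (b : {ffun {set H} -> option (lab n)}) (C : {set H}) : V :=
  if b C is Some l then monV l else 1.

(* The coefficient of (al, b) in the pure tensor with factor v C at C. *)
Definition pure (v : {set H} -> V) (x : estate) : R :=
  \prod_(C in circles x.1) if x.2 C is Some l then coordV (v C) l else 0.

(* For e in M outside x.1: the coefficient of y in the image of x under the map
   attached to switching the smoothing at e from 0 to 1.  The circles affected
   are those through the two half-edges other than (e, false) at its end. *)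
Definition edge_map (e : E) (x y : estate) : R :=
  let h := s (e, false) in let k := s h in
  let A := circle x.1 h in let B := circle x.1 k in
  let A' := circle y.1 h in let B' := circle y.1 k in
  let f := factor x.2 in
  if A != B then
    pure (fun C => if C == A' then f A * f B else f C) y
  else if A' != B' then
    comulV (fun p q =>
      pure (fun C => if C == A' then p else if C == B' then q else f C) y) (f A)
  else
    pure (fun C => if C == A' then mobV (f A) else f C) y.

(* The matching edges are ordered as in the enumeration of [edge P]. *)
Definition edge_sign (e : E) (al : {set E}) : R :=
  (-1) ^+ #|[set e' in al | (enum_rank e' < enum_rank e)%N]|.

Definition diff_coef (x y : estate) : R :=
  \sum_(e in M :\: x.1 | y.1 == e |: x.1) edge_sign e x.1 * edge_map e x y.

Local Notation chain := {ffun estate -> R}.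

Definition diff (z : chain) : chain :=
  [ffun y => if valid y then \sum_(x | valid x) z x * diff_coef x y else 0].

Definition qdeg (x : estate) : nat :=
  (\sum_(C in circles x.1) if x.2 C is Some l then 2 * l.1 + l.2 else 0)%N.

Definition bdeg (x : estate) : nat :=
  (\sum_(C in circles x.1) if x.2 C is Some l then val l.2 else 0)%N.

(* The degree (a, eps) part of C^i; eps is true for the class of 1 mod 2. *)
Definition in_degree (i : nat) (a : 'I_n) (eps : bool) (z : chain) : Prop :=
  forall x, z x != 0 ->
    [/\ valid x, #|x.1| = i, qdeg x = a %[mod n] & odd (bdeg x) = eps].

Definition cocycle (i : nat) (a : 'I_n) (eps : bool) (z : chain) : Prop :=
  in_degree i a eps z /\ diff z = 0.

Definition coboundary (i : nat) (a : 'I_n) (eps : bool) (z : chain) : Prop :=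
  if i is i'.+1 then exists2 w, in_degree i' a eps w & z = diff w else z = 0.

(* The quotient module of cocycles by coboundaries contains k elements that are
   linearly independent over R. *)
Definition free_classes (i : nat) (a : 'I_n) (eps : bool) (k : nat) : Prop :=
  exists z : 'I_k -> chain, (forall j, cocycle i a eps (z j)) /\
    forall c : 'I_k -> R,
      coboundary i a eps [ffun x => \sum_j c j * z j x] -> forall j, c j = 0.

(* The rank of the degree (a, eps) part of the homology in degree i; it is
   bounded by the rank of the cochain module. *)
Definition MH_rank (i : nat) (a : 'I_n) (eps : bool) : nat :=
  (\max_(k < #|{: estate}|.+1 | `[< free_classes i a eps k >]) k)%N.

(* Q^+ for sgn = false and Q^- for sgn = true; elements of Z[q]/(q^n - 1) are
   represented by polynomials of degree less than n. *)
Definition Q_part (sgn : bool) : {poly int} :=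
  \sum_(a < n) \sum_(i < #|M|.+1) \sum_(eps : bool | odd i (+) eps == sgn)
    (MH_rank i a eps)%:R *: 'X^a.

End Homology.

Definition Q_plus (n : nat) (P : pmgraph) : {poly int} := Q_part P n false.
Definition Q_minus (n : nat) (P : pmgraph) : {poly int} := Q_part P n true.

Definition cw_gt (n : nat) (f g : {poly int}) : Prop :=
  (forall i : 'I_n, (0 <= (f - g)`_i)%R) /\ exists i : 'I_n, (0 < (f - g)`_i)%R.

(* Main.v *)
(** Expanding the skein relation over all states and counting N^(number of
    circles) as colorings of the circles, the value of the blowup with circle
    value N becomes a signed count of admissible colorings: the arcs of the small
    circles get N colors, the two arcs at a half-edge differ, and both ends of an
    edge see the same two colors, either on matching sides or crossed; the sign
    is the parity of the number of crossed edges.  For N = 2 that number is even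
    because the signs of the two colors cancel at every vertex.  If the ribbon
    graph is planar it is even for every N: by Euler's formula the curves of one
    color bound a set of faces, and the curves of another color change their side
    only at crossings.  Uncrossed colorings are face colorings; for four colors
    the difference of the colors at an edge is a nowhere-zero flow with values in
    Z/2 x Z/2, hence comes from a face coloring.

    For (c), the alternating sum of the ranks is the Euler characteristic of the
    cochain groups, which is the bracket with circle value 4, provided the
    differential squares to zero.  In terms of the trace form of V, the matrix
    entry of an edge map is a product of traces, one for each piece of the
    cobordism, a piece with p incoming and r outgoing circles carrying the power
    3 - p - r of th = x^((n-2)/2) y^2.  Since the handle element is th^2, composing
    two edge maps gives 4 - p - r on a connected piece, whatever the order. *)

(* The exponents of th count crosscaps. Changing one smoothing is a cobordism of Euler
   characteristic -1; with p incoming and r outgoing circles it has 3 - p - r crosscaps: none for a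
   merge or a split, one when a single circle stays single. Two changes have Euler characteristic
   -2, which gives 4 - p - r on a connected piece, and the relation between handle element and th^2
   lets a handle count as two crosscaps. So a composite depends only on its initial and final
   circles. The one topological fact needed about states is that a change never leads from two
   circles to two ([merge_or_split]); without it these truncated subtractions would be wrong. Ranks
   are defined by linear independence over Z[1/(3n)], which is not a field. As a subring of Q it
   allows denominators to be cleared, so the ranks are computed with rational matrices. A circle
   contributes n(1 - 1 + 1) = n to the Euler characteristic, from the powers 1, y, y^2; hence the
   value 4 for n = 4. Euler's formula is used through linear algebra over F_2: the incidence
   matrices of the graph and of its dual have complementary ranks. *)
Require Import Defs.
From HB Require Import structures.
From mathcomp Require Import all_boot all_order all_algebra fingroup perm.
From mathcomp Require Import boolp zify ring.
Import Defs.
Set Implicit Arguments.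
Unset Strict Implicit.
Unset Printing Implicit Defensive.
Import Order.TTheory GRing.Theory Num.Theory.
Local Open Scope ring_scope.

(** * The algebra V *)

Section QuotientPolynomials.
Variables (A : comNzRingType) (h : {poly A}) (m : nat).
Hypotheses (size_h : size h = m.+1) (h_monic : h \is monic) (m_gt0 : (0 < m)%N).

Let mk_h : mk_monic h = h.
Proof. by rewrite /mk_monic size_h ltnS m_gt0 h_monic. Qed.

Lemma qpoly_coef_mulC c (v : {poly %/ h}) i : (qpolyC h c * v)`_i = c * v`_i.
Proof.
rewrite poly_of_qpolyM Pdiv.CommonRing.rmodp_small ?mul_polyC ?coefZ //.
by rewrite (leq_ltn_trans (size_scale_leq _ _)) // size_mk_monic.
Qed.

Lemma in_qpolyC c : in_qpoly h c%:P = qpolyC h c.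
Proof.
apply: val_inj; apply: in_qpoly_small; rewrite size_polyC.
by apply: leq_ltn_trans (size_mk_monic_gt1 h); case: eqP.
Qed.

Lemma in_qpoly_val (v : {poly %/ h}) : in_qpoly h v = v.
Proof. by apply: val_inj; apply: in_qpoly_small; apply: size_mk_monic. Qed.

Lemma qpoly_expand (v : {poly %/ h}) :
  v = \sum_(i < m) qpolyC h v`_i * qpolyX h ^+ i.
Proof.
have sv : (size (v : {poly A}) <= m)%N.
  have := size_mk_monic v; move: (size (v : {poly A})) => k.
  by rewrite mk_h size_h.
have {1}<- : in_qpoly h (\poly_(i < m) v`_i) = v.
  rewrite -[RHS]in_qpoly_val; congr in_qpoly; apply/polyP => i.
  by rewrite coef_poly; case: ltnP => // le_mi;
    rewrite nth_default // (leq_trans sv).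
rewrite poly_def rmorph_sum; apply: eq_bigr => i _.
by rewrite -mul_polyC rmorphM /= in_qpolyC rmorphXn.
Qed.

Lemma qpoly_coefXn i j : (i < m)%N -> (qpolyX h ^+ i)`_j = (j == i)%:R.
Proof.
move=> lt_im; suff -> : qpolyX h ^+ i = 'X^i :> {poly A} by rewrite coefXn.
rewrite /qpolyX -rmorphXn; apply: in_qpoly_small.
by rewrite size_polyXn mk_h size_h.
Qed.

Lemma in_qpoly_self : in_qpoly h h = 0.
Proof. by apply: val_inj; rewrite /= mk_h Pdiv.RingMonic.rmodpp. Qed.

End QuotientPolynomials.

(** The three powers of y at a fixed power of x in the handle sum. Here c is the correction term of
    [dualV]; its product with b is 0, either trivially or because x^n = 0. *)
Lemma handle_summand (A : comNzRingType) (z a b c y : A) : c * b = 0 ->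
  z * (a * y ^+ 2 - c) * b + (z * (a * y) * (b * y) + z * a * (b * y ^+ 2))
  = 3%:R * z * (a * b * y ^+ 2).
Proof.
move=> cb0; have -> : z * (a * y ^+ 2 - c) * b
  = z * a * b * y ^+ 2 - z * (c * b) by ring.
by rewrite cb0; ring.
Qed.

Section MobiusAlgebra.
Variable n : nat.
Hypothesis n_gt0 : (0 < n)%N.

Local Notation R := (coefR n).
Local Notation V := (algV n).
Local Notation x := (xV n).
Local Notation y := (yV n).
Local Notation hx := ('X^n : {poly R}).
Local Notation hy := ('X^3 - qpolyX hx *: 'X : {poly truncR n}).

Let size_hx : size hx = n.+1. Proof. exact: size_polyXn. Qed.
Let hx_monic : hx \is monic. Proof. exact: monicXn. Qed.

Let size_lt : (size (- (qpolyX hx *: 'X) : {poly truncR n})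
  < size ('X^3 : {poly truncR n}))%N.
Proof.
rewrite size_polyN size_polyXn.
by rewrite (leq_ltn_trans (size_scale_leq _ _)) // size_polyX.
Qed.

Let size_hy : size hy = 4.
Proof. by rewrite size_polyDl ?size_lt // size_polyXn. Qed.

Let hy_monic : hy \is monic.
Proof. by rewrite monicE lead_coefDl // lead_coefXn eqxx. Qed.

(** V is a tower of two quotient rings; scalars from R act on it by multiplication with their image
    under this embedding. *)
Definition scalV (c : R) : V := qpolyC _ (qpolyC _ c).

HB.instance Definition _ := GRing.RMorphism.copy scalV
  (qpolyC hy \o qpolyC hx).

Lemma coordV_is_zmod_morphism l : zmod_morphism (fun v : V => coordV v l).
Proof. by move=> u v; rewrite /coordV !coefB. Qed.

Lemma coordV_scal c (v : V) l : coordV (scalV c * v) l = c * coordV v l.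
Proof. by rewrite /coordV !qpoly_coef_mulC. Qed.

Lemma xV_n : x ^+ n = 0.
Proof.
rewrite /xV -rmorphXn /= /qpolyX -(rmorphXn (in_qpoly hx)) /=.
by rewrite (in_qpoly_self size_hx hx_monic n_gt0) rmorph0.
Qed.

Lemma yV_3 : y ^+ 3 = x * y.
Proof.
have /eqP := in_qpoly_self size_hy hy_monic isT.
rewrite rmorphB subr_eq0 rmorphXn => /eqP ->.
have <- : in_qpoly hy ((qpolyX hx)%:P * 'X) = x * y.
  by rewrite rmorphM; congr (_ * _); apply: in_qpolyC.
by rewrite mul_polyC.
Qed.

Lemma coordV_mon (i : 'I_n) (j : 'I_3) l :
  coordV (x ^+ i * y ^+ j) l = (l == (i, j))%:R.
Proof.
case: l => k m; rewrite /coordV -rmorphXn /= qpoly_coef_mulC.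
rewrite (qpoly_coefXn size_hy hy_monic) // xpair_eqE.
have -> : (m == j :> nat) = (m == j) by [].
case: eqP => _; last by rewrite mulr0 coef0 andbF.
by rewrite mulr1 andbT (qpoly_coefXn size_hx hx_monic).
Qed.

Lemma coordV_expand (v : V) : v = \sum_l scalV (coordV v l) * monV l.
Proof.
rewrite {1}(qpoly_expand size_hy hy_monic isT v).
under eq_bigr => j _ do
  rewrite {1}(qpoly_expand size_hx hx_monic n_gt0 (v`_j)) rmorph_sum mulr_suml.
rewrite exchange_big pair_bigA /=; apply: eq_bigr => -[i j] _ /=.
by rewrite rmorphM /= rmorphXn mulrA.
Qed.

Local Notation zi := (zinv_inv (3 * n)).

Lemma mulzi : (3 * n)%:R * zi = 1 :> R.
Proof.
apply: val_inj; rewrite rmorphM rmorph_nat rmorph1 /= divff //.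
by rewrite pnatr_eq0 muln_eq0 -lt0n.
Qed.

Let top : 'I_n := Ordinal (etrans (ltn_predL n) n_gt0).

(** The Frobenius form belonging to Delta_V; the factor 3n undoes the 1/(3n) there. *)
Definition traceV (v : V) : R := (3 * n)%:R * coordV v (top, ord_max).

Lemma traceV_is_zmod_morphism : zmod_morphism traceV.
Proof. by move=> u v; rewrite /traceV coordV_is_zmod_morphism mulrBr. Qed.

HB.instance Definition _ :=
  GRing.isZmodMorphism.Build V R traceV traceV_is_zmod_morphism.

Lemma traceV_scal c v : traceV (scalV c * v) = c * traceV v.
Proof. by rewrite /traceV coordV_scal mulrCA. Qed.

(** Reducing by y^3 = xy keeps both the weight 2a + b and the positivity of the power of y, so the
    top monomial x^(n-1) y^2 is reached exactly from weight 2n with b > 0. For b = 0 the monomial of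
    weight 2n is x^n = 0. *)
Lemma traceV_mon a b :
  traceV (x ^+ a * y ^+ b) = (3 * n)%:R * ((0 < b) && (2 * a + b == 2 *
    n))%N%:R.
Proof.
have [k] := ubnP b; elim: k a b => // k IHk a b /ltnSE le_bk.
have [lt_b3|le_3b] := ltnP b 3; last first.
  have -> : x ^+ a * y ^+ b = x ^+ a.+1 * y ^+ (b - 2).
    have -> : b = ((b - 3) + 3)%N by rewrite subnK.
    rewrite exprD yV_3 exprSr [in (_ - 2)%N]addnC -addnBAC //.
    by rewrite (exprD _ 1) expr1; ring.
  rewrite IHk; last lia.
  by congr (_ * _%:R); lia.
have [lt_an|le_na] := ltnP a n; last first.
  rewrite -(subnK le_na) exprD xV_n mulr0 mul0r raddf0.
  have -> : (0 < b)%N && (2 * (a - n + n) + b == 2 * n)%N = false by lia.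
  by rewrite mulr0.
rewrite /traceV (coordV_mon (Ordinal lt_an) (Ordinal lt_b3)).
congr (_ * _%:R); rewrite xpair_eqE -!val_eqE /=; lia.
Qed.

(* The factors paired with [monV l] in the formula for Delta(1). *)
Definition dualV (l : lab n) : V :=
  scalV zi * (x ^+ (n.-1 - l.1) * y ^+ (2 - l.2)
    - (if (0 < l.1)%N && (l.2 == ord0) then x ^+ (n - l.1) else 0)).

Lemma coordV_sum I (r : seq I) (F : I -> V) l :
  coordV (\sum_(i <- r) F i) l = \sum_(i <- r) coordV (F i) l.
Proof. by rewrite /coordV poly_of_qpoly_sum coef_sum poly_of_qpoly_sum coef_sum.
  Qed.

(** This is duality of [dualV] and [monV] under the trace. For l = (k, m) the leading term of
    [dualV l] pairs with x^i y^j only if 2i + j = 2k + m. Besides (k, m) itself this allows (k-1, 2)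
    when m = 0, which the correction term cancels, and (k+1, 0) when m = 2, where the product is
    free of y and has trace 0. *)
Lemma coordV_trace v l : coordV v l = traceV (v * dualV l).
Proof.
rewrite [v in RHS]coordV_expand mulr_suml raddf_sum /=.
rewrite {1}(coordV_expand v) coordV_sum; apply: eq_bigr => -[i j] _.
rewrite -mulrA traceV_scal coordV_scal; congr (_ * _).
rewrite coordV_mon /dualV mulrCA traceV_scal mulrBr raddfB /=.
rewrite /monV /= mulrACA -!exprD traceV_mon.
case: l => k m /=; rewrite xpair_eqE.
have -> : traceV (x ^+ i * y ^+ j *
    (if (0 < k)%N && (m == ord0) then x ^+ (n - k) else 0)) =
  (3 * n)%:R * ([&& 0 < k, m == ord0, 0 < j & 2 * (i + (n - k)) + j == 2 *
    n])%N%:R.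
  case: ifP => [/andP[-> ->]|]; first by rewrite mulrAC -exprD traceV_mon.
  by rewrite mulr0 raddf0; case: (0 < k)%N; case: (m == ord0);
    rewrite //= mulr0.
rewrite -mulrBr mulrA [zi * _]mulrC mulzi mul1r.
case: k => k ltk; case: m => m ltm; case: i => i lti; case: j => j ltj.
rewrite -!val_eqE /=.
set b1 := _ && _; set b2 := _ && _; set b3 := _ && _.
suff : (b1 + b3 = b2)%N by move=> <-; rewrite natrD addrK.
rewrite {}/b1 {}/b2 {}/b3; clear - n_gt0 ltk ltm lti ltj; lia.
Qed.

Lemma sum_trace_dual u v : \sum_l traceV (u * dualV l) * traceV (monV l * v) =
  traceV (u * v).
Proof.
rewrite [u in RHS]coordV_expand mulr_suml raddf_sum; apply: eq_bigr => l _ /=.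
by rewrite -mulrA traceV_scal coordV_trace.
Qed.

Lemma eq_comulV T T' (v : V) : (forall p q, T p q = T' p q) -> comulV T v =
  comulV T' v.
Proof.
move=> eqT; rewrite /comulV.
by congr (- (_ * _) + _ * _); apply: eq_bigr => i _ /=; rewrite !eqT.
Qed.

(** Delta_V(v) is the sum of v [dualV l] tensor [monV l], the comultiplication of the trace form.
    The constant c stands for the circles that a split leaves alone. *)
Lemma comulV_trace u v w c :
  comulV (fun p q => traceV (p * u) * traceV (q * w) * c) v = traceV (v * u *
    w) * c.
Proof.
rewrite -sum_trace_dual /comulV.
rewrite (eq_bigr (fun l : lab n => (fun k m =>
  traceV (v * u * dualV (k, m)) * traceV (monV (k, m) * w)) l.1 l.2));
    last by case.
rewrite -(pair_bigA _ (fun k m =>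
  traceV (v * u * dualV (k, m)) * traceV (monV (k, m) * w))) /=.
pose P a b := traceV (v * u * a) * traceV (b * w).
pose F1 k := zi * (P (x ^+ (n.-1 - k) * y ^+ 2) (x ^+ k)
    + P (x ^+ (n.-1 - k) * y) (x ^+ k * y)
    + P (x ^+ (n.-1 - k)) (x ^+ k * y ^+ 2)).
pose F2 k := if (0 < k)%N then zi * P (x ^+ (n - k)) (x ^+ k) else 0.
have -> : \sum_(k < n) \sum_(m < 3)
    traceV (v * u * dualV (k, m)) * traceV (monV (k, m) * w) =
  \sum_(0 <= k < n) F1 k - \sum_(0 <= k < n) F2 k.
  rewrite !big_mkord -sumrB; apply: eq_bigr => k _; rewrite /F1 /F2.
  rewrite !big_ord_recl big_ord0 /dualV /monV /= /bump /= addr0 andbT !andbF.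
  rewrite !subn0 !subnn !subr0 !expr0 !mulr1 !add1n !expr1.
  rewrite !(mulrCA _ (scalV _)) !traceV_scal /P.
  case: ifP => _; rewrite ?subr0 ?mulrBr ?raddfB /= ?mulrBl; ring.
rewrite [\sum_(0 <= k < n) F2 k]big_ltn //= [F2 0%N]/F2 add0r.
(* [dualV] is indexed by the exponent in the second tensor factor, [comulV] by the one in the first;
   hence both sums are reversed. *)
rewrite [\sum_(0 <= k < n) F1 k]big_nat_rev [\sum_(1 <=
  k < n) F2 k]big_nat_rev /=.
rewrite ?add0n ?add1n.
rewrite mulrBl addrC !mulr_sumr !mulr_suml; congr (_ - _).
  apply: eq_big_nat => i /andP[_ ltin]; rewrite /F1.
  have -> : (n.-1 - (n - i.+1))%N = i by clear - ltin; lia.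
  have -> : (n - 1 - i)%N = (n - i.+1)%N by clear - ltin; lia.
  have E a b : traceV (v * x ^+ i * a * u) * traceV (b * w) = P (x ^+ i * a) b.
    by rewrite /P; congr (traceV _ * _); ring.
  have E1 b : traceV (v * x ^+ i * u) * traceV (b * w) = P (x ^+ i) b.
    by rewrite /P; congr (traceV _ * _); ring.
  set X := x ^+ (n - i.+1).
  by rewrite (E (y ^+ 2) X) (E y (X * y)) (E1 (X * y ^+ 2)) -!mulrDl mulrA.
apply: eq_big_nat => i /andP[i0 ltin]; rewrite subSS /F2 subn_gt0 ltin.
have -> : (n - (n - i))%N = i by clear - ltin; lia.
have -> : v * x ^+ i * u = v * u * x ^+ i by ring.
by rewrite mulrA.
Qed.

Definition mobElt : V := x ^+ (n - 2)./2 * y ^+ 2.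

Lemma mobV_E v : mobV v = v * mobElt.
Proof. by rewrite /mobV /mobElt mulrA. Qed.

(** Each of the n powers of x contributes 3/(3n) times x^(n-1) y^2. For even n the halved exponent
    in [mobElt] is exact, and y^4 = x y^2 gives its square the same value. *)
Lemma sum_dual_mon : ~~ odd n -> \sum_l dualV l * monV l = mobElt ^+ 2.
Proof.
move=> n_even.
rewrite (eq_bigr (fun l : lab n => (fun k m => dualV (k, m) * monV (k,
  m)) l.1 l.2)); last by case.
rewrite -(pair_bigA _ (fun k m => dualV (k, m) * monV (k, m))) /=.
have -> : mobElt ^+ 2 = x ^+ n.-1 * y ^+ 2.
  rewrite /mobElt exprMn -!exprM.
  have -> : y ^+ (2 * 2) = x * y ^+ 2 by rewrite (exprS y 3) yV_3 mulrCA.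
  rewrite mulrA -exprSr.
  by congr (x ^+ _ * _); clear - n_even n_gt0; lia.
transitivity (\sum_(k < n) scalV (3%:R * zi) * (x ^+ n.-1 * y ^+ 2)).
  apply: eq_bigr => -[k ltk] _.
  rewrite !big_ord_recl big_ord0 /dualV /monV /= /bump /= addr0 andbT !andbF.
  rewrite !subn0 !subnn !subr0 !expr0 !mulr1 !add1n !expr1.
  have <- : x ^+ (n.-1 - k) * x ^+ k = x ^+ n.-1 by rewrite -exprD subnK //;
    clear - ltk; lia.
  rewrite rmorphM rmorph_nat /=.
  have e0 : (if (0 < k)%N then x ^+ (n - k) else 0) * x ^+ k = 0.
    case: ifP; last by rewrite mul0r.
    by rewrite -exprD subnK ?xV_n // ltnW.
  exact: handle_summand.
rewrite sumr_const card_ord -mulrnAl -rmorphMn /=.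
by rewrite -mulrnAl -mulrnA mulzi rmorph1 mul1r.
Qed.

End MobiusAlgebra.

(** * Homogeneous elements of V *)

Section Homogeneity.
Variable n : nat.
Local Notation V := (algV n).
Local Notation x := (xV n).
Local Notation y := (yV n).

(** The weight 2a + b is kept as a natural number, which y^3 = xy respects, because the trace
    detects weight 2n exactly. Reduction mod n enters only with [mobElt], whose weight is n. *)
Inductive homV : nat -> V -> Prop :=
| homV_mon a b : homV (2 * a + b) (x ^+ a * y ^+ b)
| homV_0 d : homV d 0
| homV_D d u v : homV d u -> homV d v -> homV d (u + v)
| homV_scal d c v : homV d v -> homV d (scalV c * v).

Lemma homV_N d v : homV d v -> homV d (- v).
Proof. by move=> hv; rewrite -mulN1r -(rmorphN1 (@scalV n));
  apply: homV_scal. Qed.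

Lemma homV_M d d' u v : homV d u -> homV d' v -> homV (d + d') (u * v).
Proof.
move=> hu; elim: hu d' v => {d u}.
- move=> a b d' v; elim=> {d' v}.
  + move=> a' b'; rewrite mulrACA -!exprD.
    have -> : (2 * a + b + (2 * a' + b') = 2 * (a + a') + (b + b'))%N by lia.
    exact: homV_mon.
  + by move=> d; rewrite mulr0; apply: homV_0.
  + by move=> d u v _ IHu _ IHv; rewrite mulrDr; apply: homV_D.
  + by move=> d c v _ IHv; rewrite mulrCA; apply: homV_scal.
- by move=> d d' v _; rewrite mul0r; apply: homV_0.
- by move=> d u v _ IHu _ IHv d' w hw; rewrite mulrDl; apply: homV_D; auto.
- by move=> d c v _ IHv d' w hw; rewrite -mulrA; apply: homV_scal; auto.
Qed.

Lemma homV_prod I (r : seq I) (P : pred I) (d : I -> nat) (F : I -> V) :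
  (forall i, P i -> homV (d i) (F i)) ->
  homV (\sum_(i <- r | P i) d i) (\prod_(i <- r | P i) F i).
Proof.
move=> hF; elim/big_ind2: _ => //; last by move=> *; apply: homV_M.
by have := homV_mon 0 0; rewrite !expr0 mulr1.
Qed.

Lemma homV_exp d v k : homV d v -> homV (k * d) (v ^+ k).
Proof.
move=> hv; elim: k => [|k IHk]; first by have := homV_mon 0 0;
  rewrite !expr0 mulr1.
by rewrite exprS mulSn; apply: homV_M.
Qed.

Lemma homV_monV (l : lab n) : homV (2 * l.1 + l.2) (monV l).
Proof. exact: homV_mon. Qed.

Lemma homV_dual (l : lab n) : homV (2 * n - (2 * l.1 + l.2)) (dualV l).
Proof.
case: l => -[k ltk] [m ltm] /=; apply: homV_scal; rewrite /=; apply: homV_D.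
  have -> : (2 * n - (2 * k + m) = 2 * (n.-1 - k) + (2 - m))%N by lia.
  exact: homV_mon.
apply: homV_N; case: ifP => [/andP[k0 /eqP[m0]]|_]; last exact: homV_0.
have -> : (2 * n - (2 * k + m) = 2 * (n - k) + 0)%N by rewrite m0; lia.
by rewrite -[x ^+ _]mulr1 -(expr0 y); apply: homV_mon.
Qed.

Lemma homV_mobElt : (1 < n)%N -> ~~ odd n -> homV n (mobElt n).
Proof.
move=> n_gt1 n_even; have {1}-> : n = (2 * (n - 2)./2 + 2)%N by lia.
exact: homV_mon.
Qed.

Lemma homV_trace (n_gt0 : (0 < n)%N) d v : homV d v -> traceV n_gt0 v != 0 ->
  d = (2 * n)%N.
Proof.
move=> hv; elim: hv => {d v}.
- move=> a b; rewrite traceV_mon; have [//|_] := eqVneq (2 * a + b)%N (2 * n)%N.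
  by rewrite andbF mulr0 eqxx.
- by move=> d; rewrite raddf0 eqxx.
- move=> d u v _ IHu _ IHv; rewrite raddfD /=.
  by have [->|/IHu //] := eqVneq (traceV n_gt0 u) 0; rewrite add0r.
- move=> d c v _ IHv; rewrite traceV_scal => nz; apply: IHv.
  by apply: contraNneq nz => ->; rewrite mulr0.
Qed.

End Homogeneity.

(** * Circles of a state *)

Lemma even_card_involution (T : finType) (f : T -> T) (A : {set T}) :
  {in A, forall x, [/\ f x \in A, f (f x) = x & f x != x]} -> ~~ odd #|A|.
Proof.
have [k] := ubnP #|A|; elim: k A => // k IHk A /ltnSE le_k fA.
have [->|/set0Pn[x xA]] := eqVneq A set0; first by rewrite cards0.
have [fxA ffx fx] := fA x xA.
have fxAx : f x \in A :\ x by rewrite !inE fx.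
have cA : #|A| = #|A :\ x :\ f x|.+2.
  by rewrite (cardsD1 x) xA (cardsD1 (f x)) fxAx.
rewrite cA /= negbK; apply: IHk => [|y]; first by rewrite cA in le_k;
  apply: ltnW.
rewrite !inE => /and3P[y1 y2 yA]; have [fyA ffy fy] := fA y yA; split=> //.
rewrite fyA andbT; apply/andP; split.
  by apply: contra y2 => /eqP e; rewrite -ffy e ffx.
by apply: contra y1 => /eqP <-; rewrite ffy.
Qed.

Lemma endpt_rot (G : ribbon) (h : half G) : endpt (rotn G h) = endpt h.
Proof. by apply/esym/eqP; rewrite (rotP (rotn G));
  have := mem_porbit (rotn G) 1 h; rewrite expg1. Qed.

Lemma flipK (G : graph) : involutive (@flip G).
Proof. by move=> [e b]; rewrite /flip /= negbK. Qed.

Lemma flip_neq (G : graph) (h : half G) : flip h != h.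
Proof. by case: h => e []; rewrite /flip /= xpair_eqE andbF. Qed.

Section Trivalent.
Variable Gamma : ribbon.
Local Notation H := (half Gamma).
Local Notation s := (rotn Gamma).
Hypothesis tri : trivalent Gamma.

Lemma porbit_fiber (h : H) : porbit s h = [set k | endpt k == endpt h].
Proof. by apply/setP => k; rewrite inE eq_sym (rotP s). Qed.

Lemma card_porbit_rot (h : H) : #|porbit s h| = 3.
Proof. by rewrite porbit_fiber -[RHS](tri (endpt h)). Qed.

Lemma trivalent_rot3 (h : H) : s (s (s h)) = h.
Proof. by have := iter_porbit s h; rewrite card_porbit_rot. Qed.

Lemma trivalent_uniq (h : H) : uniq [:: h; s h; s (s h)].
Proof. by have := uniq_traject_porbit s h; rewrite card_porbit_rot. Qed.

Lemma trivalent_rot_neq (h : H) : s h != h.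
Proof. by have := trivalent_uniq h;
  rewrite /= !inE negb_or eq_sym => /and3P[/andP[]]. Qed.

Lemma trivalent_fiber (h k : H) :
  (endpt k == endpt h) = [|| k == h, k == s h | k == s (s h)].
Proof.
by rewrite eq_sym (rotP s) porbit_traject card_porbit_rot /= !inE.
Qed.

End Trivalent.

Section States.
Variable P : pmgraph.
Local Notation E := (edge P).
Local Notation H := (half P).
Local Notation s := (rotn P).
Local Notation M := (matching P).

Let tri := @pm_trivalent P.
Let rot3 := trivalent_rot3 tri.
Let uniq_rot := trivalent_uniq tri.
Let rot_neq := trivalent_rot_neq tri.
Let mem_fiber := trivalent_fiber tri.

Lemma matching_orbit (h : H) :
  ((h.1 \in M) + ((s h).1 \in M) + ((s (s h)).1 \in M) = 1)%N.
Proof.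
have /= := @pm_perfect P (endpt h); rewrite -sum1dep_card => <-.
rewrite [RHS](eq_bigl (fun k => (k \in [:: h; s h; s (s h)]) && (k.1 \in M))).
  rewrite [RHS]big_mkcondr /= -big_uniq ?uniq_rot //=
    !big_cons big_nil addn0 addnA.
  by case: (h.1 \in M); case: ((s h).1 \in M); case: ((s (s h)).1 \in M).
by move=> k; rewrite !inE andbC mem_fiber.
Qed.

(* Meaningful only for h outside the matching. *)
Definition match_half (h : H) : H := if (s h).1 \in M then s h else s (s h).

(** The half-edge to which the smoothing joins h across the matching edge. The test [(s h).1 \in M]
    tells on which side of the matching half-edge h lies, and the exclusive or swaps the two targets
    for the 1-smoothing. *)
Definition partner (al : {set E}) (h : H) : H :=
  let u := flip (match_half h) in
  if ((s h).1 \in M) (+) (u.1 \in al) then s u else s (s u).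

Definition arcs : {set H} := [set h | h.1 \notin M].

Lemma arc_rot (t : H) : t.1 \in M ->
  [/\ s t \in arcs, s (s t) \in arcs, match_half (s t) =
    t & match_half (s (s t)) = t].
Proof.
move=> tM; have := matching_orbit t; rewrite !inE /match_half rot3 tM.
by case: ((s t).1 \in M); case: ((s (s t)).1 \in M).
Qed.

Lemma match_halfP (h : H) : h \in arcs ->
  (match_half h).1 \in M /\ (h = s (match_half h) \/ h = s (s (match_half h))).
Proof.
rewrite inE => hM; have := matching_orbit h;
  rewrite /match_half (negPf hM) add0n.
have [shM _|shM] := boolP ((s h).1 \in M); first by split=> //; right;
  rewrite rot3.
by have [sshM _|] := boolP ((s (s h)).1 \in M); first split=> //; first by left;
  rewrite rot3.
Qed.

Lemma partner_rot al (t : H) : t.1 \in M ->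
  partner al (s t) = (if t.1 \in al then s (flip t) else s (s (flip t))) /\
  partner al (s (s t)) = (if t.1 \in al then s (s (flip t)) else s (flip t)).
Proof.
move=> tM; have [_ a2 m1 m2] := arc_rot tM; rewrite inE in a2.
rewrite /partner m1 m2 rot3 tM (negPf a2) -[(flip t).1]/(t.1) addFb addTb.
by case: (t.1 \in al).
Qed.

Lemma flip_arcs (h : H) : (flip h \in arcs) = (h \in arcs).
Proof. by rewrite !inE. Qed.

Lemma smoothingE al e h k : e \in M ->
  smoothing al e h k = [&& h \in arcs, (match_half h).1 == e & k ==
    partner al h].
Proof.
move=> eM; apply/existsP/and3P => [[b] /=|[hA /eqP me /eqP ->]].
  have [a1 a2 m1 m2] := @arc_rot (e, b) eM;
    have [p1 p2] := @partner_rot al (e, b) eM.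
  by move=> /=; case: ifP p1 p2 => /= eal p1 p2 /orP[] /andP[/eqP -> /eqP ->];
    rewrite ?m1 ?m2 ?p1 ?p2 ?a1 ?a2 ?eqxx.
have [tM hE] := match_halfP hA; exists (match_half h).2.
have [p1 p2] := partner_rot al tM.
have tE : (e, (match_half h).2) =
  match_half h by rewrite -me -surjective_pairing.
have uE : (e, ~~ (match_half h).2) = flip (match_half h) by rewrite -me.
rewrite /= tE uE -{1}me.
move: (match_half h) hE p1 p2 {tE uE me tM} => t [] -> p1 p2;
  rewrite ?p1 ?p2 !eqxx;
  by case: (t.1 \in al); rewrite /= !eqxx ?orbT.
Qed.

(** Circles become the orbits of two involutions without fixed points on [arcs], [flip] and
    [partner]; symmetry of the relation and the later parity count rest on this form. *)
Lemma state_relE al h k :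
  state_rel al h k = (h \in arcs) && ((k == flip h) || (k == partner al h)).
Proof.
rewrite /state_rel inE; have [hM|hM] /= := boolP (h.1 \in M).
  by apply/exists_inP => -[e eM]; rewrite smoothingE // inE hM.
congr (_ || _); apply/exists_inP/idP => [[e eM]|kp].
  by rewrite smoothingE // => /and3P[].
have hA : h \in arcs by rewrite inE.
by have [tM _] := match_halfP hA; exists (match_half h).1;
  rewrite // smoothingE // hA eqxx.
Qed.

Lemma partnerP al h : h \in arcs -> 
  [/\ partner al h \in arcs, partner al (partner al h) = h,
      partner al h != h & (match_half (partner al h)).1 = (match_half h).1].
Proof.
move=> hA; have [tM hE] := match_halfP hA;
  move: (match_half h) tM hE => t tM hE.
have [p1 p2] := partner_rot al tM; have [q1 q2] := @partner_rot al (flip t) tM.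
have [a1 a2 m1 m2] := arc_rot tM; have [b1 b2 n1 n2] := @arc_rot (flip t) tM.
rewrite flipK -[(flip t).1]/(t.1) in q1 q2.
have ne (k : H) : match_half k = t -> match_half (s (flip t)) = flip t ->
  s (flip t) != k.
  by move=> mk n1'; apply/eqP => e; have := flip_neq t; rewrite -n1' e mk eqxx.
have ne2 (k : H) : match_half k = t -> s (s (flip t)) != k.
  by move=> mk; apply/eqP => e; have := flip_neq t; rewrite -n2 e mk eqxx.
by case: hE => ->; rewrite ?p1 ?p2; case: ifP p1 p2 q1 q2 => _ p1 p2 q1 q2;
  rewrite ?q1 ?q2 ?b1 ?b2 ?n1 ?n2 ?m1 ?m2 ?ne ?ne2.
Qed.

Lemma connect_state_sym al : connect_sym (state_rel (P := P) al).
Proof.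
apply: sym_connect_sym => h k; rewrite !state_relE; apply/andP/andP => -[hA].
  case/orP => /eqP ->; first by rewrite flip_arcs hA flipK eqxx.
  by have [-> -> _ _] := partnerP al hA; rewrite eqxx orbT.
case/orP => /eqP ->; first by rewrite flip_arcs hA flipK eqxx.
by have [-> -> _ _] := partnerP al hA; rewrite eqxx orbT.
Qed.

Lemma circle_id al (h : H) : h \in circle al h.
Proof. by rewrite inE connect0. Qed.

Lemma mem_circle al (h k : H) : (k \in circle al h) = (circle al h ==
  circle al k).
Proof.
rewrite inE; apply/idP/eqP => [hk|/setP/(_ k)]; last by rewrite !inE connect0.
by apply/setP => l; rewrite !inE; apply: (same_connect (connect_state_sym al)).
Qed.

Lemma circle_closed al (h k : H) : k \in arcs ->
  (flip k \in circle al h) = (k \in circle al h) /\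
  (partner al k \in circle al h) = (k \in circle al h).
Proof.
move=> kA; have c1 : connect (state_rel al) k (flip k).
  by apply: connect1; rewrite state_relE kA eqxx.
have c2 : connect (state_rel al) k (partner al k).
  by apply: connect1; rewrite state_relE kA eqxx orbT.
by split; rewrite !inE; apply/esym;
  [apply: (same_connect_r (connect_state_sym al) c1)
  |apply: (same_connect_r (connect_state_sym al) c2)].
Qed.

Lemma sub_circle al (h : H) (C : {set H}) : h \in C ->
  (forall k, k \in C -> k \in arcs -> flip k \in C /\ partner al k \in C) ->
  circle al h \subset C.
Proof.
move=> hC closed; apply/subsetP => k; rewrite inE => /connectP[p pP ->].
elim: p h hC pP => //= l p IHp h hC /andP[]; rewrite state_relE => /andP[hA hl].
by have [c1 c2] := closed h hC hA; apply: IHp; case/orP: hl => /eqP ->.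
Qed.

Lemma circle_arcs al (h : H) : h \in arcs -> circle al h \subset arcs.
Proof.
move=> hA; apply: sub_circle => // k kA _; rewrite flip_arcs kA.
by have [] := partnerP al kA.
Qed.

Lemma circle_in al (h : H) : h \in arcs -> circle al h \in circles al.
Proof. by rewrite inE => hA; apply: imset_f; rewrite inE. Qed.

Lemma circlesP al (C : {set H}) :
  reflect (exists2 h, h \in arcs & C = circle al h) (C \in circles al).
Proof.
by apply: (iffP imsetP) => -[h hA ->]; exists h => //; move: hA; rewrite !inE.
Qed.

Lemma circle_of al (C : {set H}) (h : H) : C \in circles al -> h \in C -> 
  C = circle al h /\ h \in arcs.
Proof.
case/circlesP => k kA -> hk; split; last exact: (subsetP (circle_arcs al kA)).
by apply/eqP; rewrite -mem_circle.
Qed.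

(** A circle depends only on the smoothings it meets. The inclusion proved first carries the
    agreement over to the other circle, which yields the reverse inclusion. *)
Lemma circle_agree (al al' : {set E}) (h : H) : h \in arcs ->
  (forall k, k \in circle al h -> ((match_half k).1 \in al) =
    ((match_half k).1 \in al')) ->
  circle al' h = circle al h.
Proof.
have sub (al1 al2 : {set E}) k : k \in arcs ->
    (forall l, l \in circle al1 k -> ((match_half l).1 \in al1) =
      ((match_half l).1 \in al2)) ->
    circle al2 k \subset circle al1 k.
  move=> kA agree; apply: sub_circle => [|l lk lA]; first exact: circle_id.
  have [-> e] := circle_closed al1 k lA; rewrite lk; split=> //.
  have <- : partner al1 l = partner al2 l by rewrite /partner /= agree.
  by rewrite e.
move=> hA agree; apply/eqP; rewrite eqEsubset sub //=; apply: (sub) => // k k'.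
by rewrite agree //; apply: (subsetP (sub _ _ _ hA agree)).
Qed.

Definition earcs (e : E) : {set H} := [set h in arcs | (match_half h).1 == e].

Definition through (S : {set H}) (X : {set {set H}}) : {set {set H}} :=
  [set C in X | ~~ [disjoint C & S]].

Lemma circles_off (al al' : {set E}) (F : {set E}) :
  (forall e, e \notin F -> (e \in al) = (e \in al')) ->
  let S := [set h in arcs | (match_half h).1 \in F] in
  circles al :\: through S (circles al) =
    circles al' :\: through S (circles al').
Proof.
move=> agree S.
suff sub (al1 al2 : {set E}) : (forall e, e \notin F -> (e \in al1) =
  (e \in al2)) ->
  circles al1 :\: through S (circles al1)
    \subset circles al2 :\: through S (circles al2).
  by apply/eqP; rewrite eqEsubset !sub // => e /agree.
move=> agree12; apply/subsetP => C; rewrite !inE => /andP[] /[swap].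
case/circlesP => h hA ->; rewrite circle_in //= negbK => dis.
have e12 : circle al1 h = circle al2 h.
  apply/esym/circle_agree => // k kh; apply: agree12.
  apply/negP => kF; have kA := subsetP (circle_arcs al1 hA) k kh.
  by move/pred0P/(_ k): dis; rewrite /= kh inE kA kF.
by rewrite e12 in dis *; rewrite circle_in //= dis.
Qed.

Section Edge.
Variable e : E.
Hypothesis eM : e \in M.
Let a : H := s (e, false).
Let c : H := s a.

Lemma edge_arcs : [/\ a \in earcs e, c \in earcs e & a != c].
Proof.
have [a1 a2 m1 m2] := @arc_rot (e, false) eM.
by move: a1 a2; rewrite !inE m1 m2 [a == c]eq_sym rot_neq !eqxx => -> ->.
Qed.

Lemma earcsP al k : k \in earcs e ->
  [\/ k = a, k = partner al a, k = c | k = partner al c].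
Proof.
move=> /[!inE] /andP[kA /eqP me]; have {}kA : k \in arcs by rewrite inE.
have [tM hE] := match_halfP kA; have [p1 p2] := @partner_rot al (e, false) eM.
have tE : match_half k = (e,
  (match_half k).2) by rewrite -me -surjective_pairing.
rewrite /a /c p1 p2 /flip /=; move: hE; rewrite tE;
  case: (match_half k).2 => /= -[->|->];
  by case: ifP => _; (do 4?[by constructor]).
Qed.

(** The four half-edges next to e form two pairs of partners, one containing a and one containing c,
    so every circle passing e contains a or c. *)
Lemma through_earcs al :
  through (earcs e) (circles al) = [set circle al a; circle al c].
Proof.
have [aS cS _] := edge_arcs.
have [aA cA] : a \in arcs /\ c \in arcs by move: aS cS;
  rewrite inE => /andP[? _]; rewrite inE => /andP[].
apply/setP => C; rewrite inE;
  apply/andP/set2P => [[CX /pred0Pn[k /andP[/= kC kS]]]|[->|->]].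
- have [-> _] := circle_of CX kC.
  have [->|->|->|->] := earcsP al kS; [by left| |by right|].
    by left; apply/esym/eqP; rewrite -mem_circle (circle_closed al a aA).2
      circle_id.
  by right; apply/esym/eqP; rewrite -mem_circle (circle_closed al c cA).2
    circle_id.
- by split; [apply: circle_in | apply/pred0Pn; exists a; rewrite /= circle_id].
- by split; [apply: circle_in | apply/pred0Pn; exists c; rewrite /= circle_id].
Qed.

Lemma partner_switch (al : {set E}) : e \notin al ->
  partner (e |: al) (partner al a) = c.
Proof.
move=> eal; have [-> _] := @partner_rot al (e, false) eM;
  rewrite /= (negPf eal).
have [_ ->] := @partner_rot (e |: al) (flip (e, false)) eM.
by rewrite /= setU11 flipK.
Qed.

(* Cut the links at e: the piece through a meets the four loose ends an even
   number of times, because flip and the remaining smoothings pair off its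
   half-edges. *)
Lemma merge_or_split (al : {set E}) : e \notin al ->
  circle al a != circle al c -> circle (e |: al) a = circle (e |: al) c.
Proof.
move=> eal ne; have [aS cS _] := edge_arcs.
have [aA cA] : a \in arcs /\ c \in arcs by move: aS cS;
  rewrite inE => /andP[? _]; rewrite inE => /andP[].
pose ro : rel H := fun h k => (h \in arcs) && ((k == flip h) ||
  (h \notin earcs e) && (k == partner al h)).
pose K := [set k | connect ro a k].
have subK (be : {set E}) : (forall e', e' != e -> (e' \in be) = (e' \in al)) ->
  K \subset circle be a.
  move=> agree; apply/subsetP => k; rewrite !inE; apply: connect_sub => {k} h k.
  case/andP=> hA hk; apply: connect1; rewrite state_relE hA /=.
  case/orP: hk => [->//|/andP[hS /eqP ->]]; apply/orP; right; apply/eqP.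
  by rewrite /partner /= agree //; move: hS; rewrite inE hA.
have KA : K \subset arcs by apply: subset_trans (circle_arcs al aA);
  apply: subK.
have KAP k : k \in K -> k \in arcs by apply: (subsetP KA).
have Kflip k : k \in K -> flip k \in K.
  move=> kK; rewrite inE; apply: (connect_trans (y := k));
    first by rewrite inE in kK.
  by apply: connect1; rewrite /ro KAP // eqxx.
have Kpart k : k \in K -> k \notin earcs e -> partner al k \in K.
  move=> kK kS; rewrite inE; apply: (connect_trans (y := k));
    first by rewrite inE in kK.
  by apply: connect1; rewrite /ro KAP // kS eqxx orbT.
have evK : ~~ odd #|K|.
  by apply: (@even_card_involution _ (@flip P)) => k kK;
    rewrite Kflip // flipK flip_neq.
have evKS : ~~ odd #|K :\: earcs e|.
  apply: (@even_card_involution _ (partner al)) => k /setDP[kK kS].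
  have [pA pp pk me] := partnerP al (KAP k kK);
    rewrite pp pk inE Kpart // andbT.
  by split=> //; move: kS; rewrite !inE me; move: (pA) (KAP k kK);
    rewrite !inE => -> ->.
have : ~~ odd #|K :&: earcs e| by move: evK;
  rewrite -(cardsID (earcs e) K) oddD (negPf evKS) addbF.
(* The other two loose ends lie on the circle of c, which differs from that of a. *)
have KS : K :&: earcs e \subset [set a; partner al a].
  apply/subsetP => k /setIP[/(subsetP (subK al (fun _ _ => erefl))) kK kS].
  rewrite !inE; have [->|->|kc|kc] := earcsP al kS; rewrite ?eqxx ?orbT //.
    by case/eqP: ne; apply/eqP; rewrite -mem_circle -kc.
  by case/eqP: ne; apply/eqP;
    rewrite -mem_circle -(circle_closed al a cA).2 -kc.
have aK : a \in K by rewrite inE connect0.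
(* K survives the switch, after which [partner al a] is joined to c: the two circles have merged. *)
have [pK _|pK] := boolP (partner al a \in K).
  apply/eqP; rewrite -mem_circle -(partner_switch eal).
  have [pA _ _ _] := partnerP al aA.
  rewrite (circle_closed _ a pA).2; apply: (subsetP (subK _ _) _ pK) => e' ne'.
  by rewrite !inE (negPf ne').
(* Otherwise a is the only loose end in K, against the parity just found. *)
suff -> : K :&: earcs e = [set a] by rewrite cards1.
have aKS : a \in K :&: earcs e by apply/setIP.
apply/eqP; rewrite eqEsubset sub1set aKS andbT.
apply/subsetP => k kKS; have /set2P[->|kp] := subsetP KS k kKS;
  first by rewrite inE.
by rewrite -kp (subsetP (subsetIl _ _) _ kKS) in pK.
Qed.

End Edge.

End States.

(** * The square of the differential *)

Section Gluing.
Variables (R V : comNzRingType) (tr : {additive V -> R}) (L T : finType).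
Variables (dual mon : L -> V) (h2 : V).
Hypothesis complete : forall u v, \sum_l tr (u * dual l) * tr (mon l * v) =
  tr (u * v).
Hypothesis handle : \sum_l dual l * mon l = h2.
Implicit Types (Y A B : {set T}) (g : {ffun T -> option L}).

Definition labelled Y g := [forall C, isSome (g C) == (C \in Y)].

Definition label_factor (F : L -> V) g (C : T) : V :=
  if g C is Some l then F l else 1.

Lemma sum_labelled (W : nmodType) (F : {ffun T -> option L} ->
  W) Y C : C \in Y ->
  \sum_(g | labelled Y g) F g = \sum_l \sum_(g | labelled (Y :\ C) g)
     F [ffun D => if D == C then Some l else g D].
Proof.
(* The inverse bijection needs a default label; if there are no labels, both sums vanish. *)
move=> CY; have [l0 _|L0] := pickP (mem L); last first.
  rewrite !big1 // => [l _|g /forallP/(_ C)]; first by have := L0 l.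
  by case: (g C) => [l|]; [have := L0 l | rewrite CY].
rewrite pair_big_dep /=.
rewrite (reindex_onto
  (fun p : L * {ffun T -> option L} => [ffun D => if D ==
    C then Some p.1 else p.2 D])
  (fun g => (odflt l0 (g C), [ffun D => if D == C then None else g D]))) /=.
  apply: eq_bigl => -[l g] /=; rewrite !ffunE eqxx xpair_eqE eqxx /=.
  apply/andP/forallP => [[/forallP lab /eqP e] D|lab].
    have := lab D; rewrite -{2}e !ffunE !inE; by case: (D == C).
  split; first by apply/forallP => D; have := lab D; rewrite !ffunE !inE;
    have [->|] := eqVneq D C; rewrite ?CY.
  apply/eqP/ffunP => D; rewrite !ffunE; case: eqP => // ->.
  by have := lab C; rewrite !inE eqxx /=; case: (g C).
move=> g /forallP lab; apply/ffunP => D; rewrite !ffunE /=; case: eqP => // ->.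
by have := lab C; rewrite CY; case: (g C).
Qed.

Lemma prod_label_upd (W : comNzRingType) F g C l A (G : V -> T -> W) :
  \prod_(D in A) G (label_factor F [ffun D => if D ==
    C then Some l else g D] D) D
  = (if C \in A then G (F l) C else 1)
    * \prod_(D in A :\ C) G (label_factor F g D) D.
Proof.
have E : \prod_(D in A :\ C)
    G (label_factor F [ffun D => if D == C then Some l else g D] D) D
  = \prod_(D in A :\ C) G (label_factor F g D) D.
  by apply: eq_bigr => D; rewrite !inE /label_factor ffunE => /andP[/negPf ->].
case: ifP => CA; first by rewrite (big_setD1 C) //= E /label_factor ffunE eqxx.
by rewrite -E mul1r; apply: eq_bigl => D; rewrite !inE; case: eqP => // ->.
Qed.

(* Summing over the labels of Y glues the two traces along the circles in A and B:
   the first circle they share joins them, each further one adds a handle. *)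
Lemma gluing Y A B U W (f w : T -> V) : A \subset Y -> B \subset Y ->
  \sum_(g | labelled Y g)
    (tr (U * \prod_(C in A) label_factor dual g C)
       * \prod_(C in Y :\: A) tr (f C * label_factor dual g C))
    * (tr (W * \prod_(C in B) label_factor mon g C)
       * \prod_(C in Y :\: B) tr (label_factor mon g C * w C))
  = (if [disjoint A & B]
     then tr (U * \prod_(C in A) w C) * tr (W * \prod_(C in B) f C)
     else tr (U * W * h2 ^+ (#|A :&: B|.-1)
       * (\prod_(C in A :\: B) w C * \prod_(C in B :\: A) f C)))
    * \prod_(C in Y :\: (A :|: B)) tr (f C * w C).
Proof.
have [k] := ubnP #|Y|; elim: k Y A B U W =>
  // k IHk Y A B U W /ltnSE le_k AY BY.
have [Y0|/set0Pn[C CY]] := eqVneq Y set0.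
  move: AY BY; rewrite Y0 !subset0 => /eqP -> /eqP ->.
  rewrite (big_pred1 [ffun => None]) => [|g].
    by rewrite -setI_eq0 set0I eqxx !set0D !big_set0 !mulr1.
  apply/forallP/eqP => [lab|-> D]; last by rewrite ffunE inE.
  by apply/ffunP => D; have := lab D; rewrite ffunE inE; case: (g D).
rewrite (sum_labelled _ CY).
have sD (A' : {set T}) : A' \subset Y -> A' :\ C \subset Y :\ C by move=> ?;
  apply: setSD.
have ltk : (#|Y :\ C| < k)%N by rewrite (cardsD1 C) CY in le_k.
have IH U' W' := IHk (Y :\ C) (A :\ C) (B :\ C) U' W' ltk (sD A AY) (sD B BY).
pose a g := \prod_(D in A :\ C) label_factor dual g D.
pose b g := \prod_(D in B :\ C) label_factor mon g D.
pose a' g := \prod_(D in (Y :\: A) :\ C) tr (f D * label_factor dual g D).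
pose b' g := \prod_(D in (Y :\: B) :\ C) tr (label_factor mon g D * w D).
transitivity (\sum_l \sum_(g | labelled (Y :\ C) g)
    (tr (U * ((if C \in A then dual l else 1) * a g))
       * ((if C \notin A then tr (f C * dual l) else 1) * a' g))
    * (tr (W * ((if C \in B then mon l else 1) * b g))
       * ((if C \notin B then tr (mon l * w C) else 1) * b' g))).
  apply: eq_bigr => l _; apply: eq_bigr => g _.
  rewrite (prod_label_upd dual g C l A (fun v _ => v)).
  rewrite (prod_label_upd mon g C l B (fun v _ => v)).
  rewrite (prod_label_upd dual g C l (Y :\: A) (fun v D => tr (f D * v))).
  rewrite (prod_label_upd mon g C l (Y :\: B) (fun v D => tr (v * w D))).
  by rewrite !inE CY !andbT.
have DA (A' B' : {set T}) : A' :\ C :\: (B' :\ C) = (A' :\: B') :\ C.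
  by apply/setP => D; rewrite !inE; case: eqP => // _; rewrite andbF.
have DI : (A :\ C) :&: (B :\ C) = (A :&: B) :\ C.
  by apply/setP => D; rewrite !inE; case: eqP.
have DU : (A :\ C) :|: (B :\ C) = (A :|: B) :\ C.
  by apply/setP => D; rewrite !inE; case: eqP.
have D1 (A' : {set T}) : C \notin A' -> A' :\ C = A'.
  by move=> CA'; apply/setP => D; rewrite !inE; case: eqP => // ->;
    rewrite (negPf CA').
have big1C (W' : comNzRingType) (G : T -> W') A' : \prod_(D in A') G D =
  (if C \in A' then G C else 1) * \prod_(D in A' :\ C) G D.
  by case: ifP => [CA'|/negbT CA'];
    [rewrite (big_setD1 C) | rewrite D1 // mul1r].
rewrite !DI !DU !DA in IH; rewrite -!setI_eq0 !DI in IH *.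
rewrite !(big1C _ _ A) !(big1C _ _ B) !(big1C _ _ (A :\: B)) !(big1C _ _ (B :\:
  A)) (big1C _ _ (_ :\: (A :|: B))).
rewrite !inE CY andbT !negb_or.
have [CA|CA] := boolP (C \in A); have [CB|CB] := boolP (C \in B) => /=.
- have CAB : C \in A :&: B by rewrite inE CA.
  have -> : (A :&: B == set0) = false by apply/negbTE/set0Pn; exists C.
  transitivity (\sum_l (if (A :&: B) :\ C == set0
    then tr (U * dual l * \prod_(D in A :\ C) w D) * tr (W * mon l *
      \prod_(D in B :\ C) f D)
    else tr (U * dual l * (W * mon l) * h2 ^+ (#|(A :&: B) :\ C|.-1)
      * (\prod_(D in (A :\: B) :\ C) w D * \prod_(D in (B :\: A) :\ C) f D)))
    * \prod_(D in (Y :\: (A :|: B)) :\ C) tr (f D * w D)).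
    apply: eq_bigr => l _; rewrite -(IH (U * dual l) (W * mon l));
      apply: eq_bigr => g _.
    by rewrite !mul1r !mulrA.
  rewrite -mulr_suml !mul1r; congr (_ * _).
  rewrite (cardsD1 C (A :&: B)) CAB /=.
  (* If C is the only shared circle, [complete] joins the two traces; otherwise another circle has
     already joined them and [handle] supplies one more factor [h2]. *)
  have [AB0|ABn0] := eqVneq (A :&: B :\ C) set0.
    rewrite AB0 cards0 expr0 mulr1.
    have eAB : A :\ C = (A :\: B) :\ C.
      apply/setP => D; move/setP/(_ D): AB0; rewrite !inE.
      by case: (D == C); case: (D \in A); case: (D \in B).
    have eBA : B :\ C = (B :\: A) :\ C.
      apply/setP => D; move/setP/(_ D): AB0; rewrite !inE.
      by case: (D == C); case: (D \in A); case: (D \in B).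
    rewrite -eAB -eBA; set p := \prod_(i in _) _; set q := \prod_(i in _) _.
    rewrite (_ : U * W * (p * q) = (U * p) * (W * q)); last by ring.
    rewrite -complete; apply: eq_bigr => l _.
    by congr (tr _ * tr _); ring.
  rewrite -raddf_sum /=; congr (tr _).
  have -> : #|A :&: B :\ C| = (#|A :&: B :\ C|.-1).+1.
    by rewrite prednK // card_gt0.
  rewrite exprS -handle /= mulr_suml mulr_sumr mulr_suml; apply: eq_bigr => l _;
    ring.
(* C lies on the first piece only: its second factor is a cylinder, through which w C passes into
   the first trace. *)
- have nAB : C \notin A :&: B by rewrite inE (negPf CB) andbF.
  transitivity (\sum_l ((if A :&: B == set0
    then tr (U * dual l * \prod_(D in A :\ C) w D) * tr (W *
      \prod_(D in B :\ C) f D)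
    else tr (U * dual l * W * h2 ^+ (#|A :&: B|.-1)
      * (\prod_(D in (A :\: B) :\ C) w D * \prod_(D in (B :\: A) :\ C) f D)))) *
        tr (mon l * w C)
    * \prod_(D in (Y :\: (A :|: B)) :\ C) tr (f D * w D)).
    apply: eq_bigr => l _; rewrite mulrAC -{1 2}(D1 _ nAB) -(IH (U *
      dual l) W) mulr_suml; apply: eq_bigr => g _.
    rewrite !mul1r !mulrA -/(a' g) -/(b' g) -/(a g) -/(b g); ring.
  rewrite !mul1r -mulr_suml; congr (_ * _).
  case: ifP => _.
    set p := \prod_(i in _ :\ _) w i; set q := \prod_(i in _ :\ _) f i.
    rewrite (_ : U * (w C * p) = (U * p) * w C); last by ring.
    rewrite -(complete (U * p)) mulr_suml; apply: eq_bigr => l _.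
    rewrite mulrAC; congr (tr _ * _ * _); ring.
  set p := \prod_(i in _ :\ _) w i; set q := \prod_(i in _ :\ _) f i;
    set h := h2 ^+ _.
  rewrite (_ : U * W * h * (w C * p * q) = (U * W * h * (p * q)) * w C);
    last by ring.
  rewrite -complete; apply: eq_bigr => l _.
  congr (tr _ * _); ring.
(* The mirror case: f C passes through a cylinder into the second trace. *)
- have nAB : C \notin A :&: B by rewrite inE (negPf CA).
  transitivity (\sum_l ((if A :&: B == set0
    then tr (U * \prod_(D in A :\ C) w D) * tr (W * mon l *
      \prod_(D in B :\ C) f D)
    else tr (U * (W * mon l) * h2 ^+ (#|A :&: B|.-1)
      * (\prod_(D in (A :\: B) :\ C) w D * \prod_(D in (B :\: A) :\ C) f D)))) *
        tr (f C * dual l)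
    * \prod_(D in (Y :\: (A :|: B)) :\ C) tr (f D * w D)).
    apply: eq_bigr => l _; rewrite mulrAC -{1 2}(D1 _ nAB) -(IH U (W *
      mon l)) mulr_suml; apply: eq_bigr => g _.
    rewrite !mul1r !mulrA -/(a' g) -/(b' g) -/(a g) -/(b g); ring.
  rewrite !mul1r -mulr_suml; congr (_ * _).
  case: ifP => _.
    set p := \prod_(i in _ :\ _) w i; set q := \prod_(i in _ :\ _) f i.
    rewrite (_ : W * (f C * q) = f C * (W * q)); last by ring.
    rewrite -(complete _ (W * q)) mulr_sumr; apply: eq_bigr => l _.
    rewrite -mulrA; congr (_ * _); rewrite mulrC; congr (_ * tr _); ring.
  set p := \prod_(i in _ :\ _) w i; set q := \prod_(i in _ :\ _) f i;
    set h := h2 ^+ _.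
  rewrite (_ : U * W * h * (p * (f C * q)) = f C * (U * W * h * (p * q)));
    last by ring.
  rewrite -complete; apply: eq_bigr => l _.
  rewrite mulrC; congr (_ * tr _); ring.
(* C lies on neither piece, and two cylinders compose to one. *)
- have nAB : C \notin A :&: B by rewrite inE (negPf CA).
  transitivity (\sum_l (if A :&: B == set0
    then tr (U * \prod_(D in A :\ C) w D) * tr (W * \prod_(D in B :\ C) f D)
    else tr (U * W * h2 ^+ (#|A :&: B|.-1)
      * (\prod_(D in (A :\: B) :\ C) w D * \prod_(D in (B :\: A) :\ C) f D)))
    * \prod_(D in (Y :\: (A :|: B)) :\ C) tr (f D * w D) * (tr (f C * dual l) *
      tr (mon l * w C))).
    apply: eq_bigr => l _; rewrite -{1 2}(D1 _ nAB) -(IH U W) mulr_suml;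
      apply: eq_bigr => g _.
    rewrite !mul1r !mulrA -/(a' g) -/(b' g) -/(a g) -/(b g); ring.
  by rewrite -mulr_sumr complete !mul1r -mulrA; congr (_ * _); apply: mulrC.
Qed.

End Gluing.

Lemma setD_union (T : finType) (X Y X1 X2 Y1 Y2 : {set T}) :
  X :\: X1 = Y :\: Y1 -> X2 :\: X1 = Y2 :\: Y1 ->
  X :\: (X1 :|: X2) = Y :\: (Y1 :|: Y2).
Proof.
move=> e1 e2; apply/setP => C; move/setP/(_ C): e1; move/setP/(_ C): e2.
rewrite !in_setD !in_setU.
by do 2!case: (C \in X1); case: (C \in Y1); case: (C \in X2); case: (C \in Y2).
Qed.

Lemma merge_exponents (V : comNzRingType) (a b p q t : V) k1 k2 m k :
  (k1 + k2 + 2 * m)%N = k ->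
  a * t ^+ k1 * (b * t ^+ k2) * (t ^+ 2) ^+ m * (p * q) = (a * q) * (b * p) *
    t ^+ k.
Proof. by move=> <-; rewrite -exprM !exprD; ring. Qed.

(** The crosscap count of a glued piece: of the m shared circles the first joins the two pieces, and
    each of the other m - 1 adds a handle, that is, two crosscaps. The bounds by 3 make the
    truncated subtractions exact. *)
Lemma exponent_arith a b z x m p q :
  (a + x <= 3)%N -> (b + z <= 3)%N -> (m + p = x)%N -> (m + q = b)%N ->
    (0 < m)%N ->
  (3 - a - x + (3 - b - z) + 2 * m.-1 = 4 - (a + q) - (z + p))%N.
Proof. lia. Qed.

Lemma prod_setU (V : comNzRingType) (T : finType) (A B : {set T}) (F : T -> V) :
  \prod_(i in A :|: B) F i = \prod_(i in A) F i * \prod_(i in B :\: A) F i.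
Proof. by rewrite (big_setID A) setUK setDUl setDv set0U. Qed.

Lemma cards_setU (T : finType) (A B : {set T}) : #|A :|: B| = (#|A| +
  #|B :\: A|)%N.
Proof. by rewrite -(cardsID A) setUK setDUl setDv set0U. Qed.

(** * Composition of two edge maps *)

Section Composition.
Variable P : pmgraph.
Local Notation E := (edge P).
Local Notation H := (half P).
Local Notation s := (rotn P).
Local Notation M := (matching P).

Definition thru (e : E) (al : {set E}) := through (earcs e) (circles al).

Lemma thru_sub e al : thru e al \subset circles al.
Proof. by apply/subsetP => C; rewrite inE => /andP[]. Qed.

Lemma thru_off e (al : {set E}) : e \in M ->
  circles al :\: thru e al = circles (e |: al) :\: thru e (e |: al).
Proof.
move=> eM; have := @circles_off P al (e |: al) [set e].
rewrite (_ : [set h in arcs P | _] = earcs e); last first.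
  by apply/setP => h; rewrite !inE.
by apply=> e'; rewrite !inE => /negPf ->.
Qed.

(** Each side has one or two circles, and [merge_or_split] rules out two on both. Hence the exponent
    3 - p - r loses nothing to truncation. *)
Lemma card_thru e (al : {set E}) : e \in M -> e \notin al ->
  (#|thru e al| + #|thru e (e |: al)| <= 3)%N.
Proof.
move=> eM eal; rewrite /thru !through_earcs // !cards2.
have [_|ne] := eqVneq (circle al (s (e, false))) (circle al (s (s (e, false)))).
  by case: (_ != _).
by rewrite (merge_or_split eM eal ne) eqxx.
Qed.

Lemma thru_diff e f (al be : {set E}) :
  circles al :\: thru e al = circles be :\: thru e be ->
  thru f al :\: thru e al = thru f be :\: thru e be.
Proof.
move=> eqD; have eqT X : (thru f X :\: thru e X) =
  through (earcs f) (circles X :\: thru e X).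
  by apply/setP => C; rewrite !inE !andbA.
by rewrite !eqT eqD.
Qed.

Lemma thru_disjoint e f (al be : {set E}) :
  circles al :\: thru e al = circles be :\: thru e be ->
  thru e al :&: thru f al = set0 -> thru e be :&: thru f be = set0.
Proof.
move=> eqD dis; apply/eqP/set0Pn => -[C /setIP[Ce]].
rewrite inE => /andP[CX /pred0Pn[k /andP[/= kC kf]]].
have kA : k \in arcs P by move: kf; rewrite inE => /andP[].
have ck : circle al k \in circles al by apply: circle_in.
have ckf : circle al k \in thru f al.
  by rewrite inE ck; apply/pred0Pn; exists k; rewrite /= circle_id.
have cke : circle al k \notin thru e al.
  by apply/negP => cke; move/setP/(_ (circle al k)): dis;
    rewrite inE cke ckf inE.
have : circle al k \in circles be :\: thru e be by rewrite -eqD inE cke.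
case/setDP => cbe; have [E1 _] := circle_of cbe (circle_id al k).
have [E2 _] := circle_of CX kC.
by rewrite E1 -E2 Ce.
Qed.

Variables (R V : comNzRingType) (tr : {additive V -> R}) (L : finType).
Variables (dual mon : L -> V) (th : V).
Hypothesis complete : forall u v, \sum_l tr (u * dual l) * tr (mon l * v) =
  tr (u * v).
Hypothesis handle : \sum_l dual l * mon l = th ^+ 2.
Implicit Types (al be ga : {set E}) (f d : {set H} -> V).

Definition local_trace f d (A B : {set {set H}}) k : R :=
  tr (\prod_(C in A) f C * \prod_(C in B) d C * th ^+ k).

Definition edge_trace e f d al be : R :=
  local_trace f d (thru e al) (thru e be) (3 - #|thru e al| - #|thru e be|)
  * \prod_(C in circles be :\: thru e be) tr (f C * d C).

(** The composite cobordism: two pieces if no circle of al passes both edges, else one piece of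
    Euler characteristic -2. The intermediate state does not occur in it, so the order of e1 and e2
    is immaterial. *)
Definition two_trace e1 e2 f d al ga : R :=
  (if thru e1 al :&: thru e2 al == set0
   then local_trace f d (thru e1 al) (thru e1 ga) (3 - #|thru e1 al|
     - #|thru e1 ga|)
     * local_trace f d (thru e2 al) (thru e2 ga) (3 - #|thru e2 al|
       - #|thru e2 ga|)
   else local_trace f d (thru e1 al :|: thru e2 al) (thru e1 ga :|: thru e2 ga)
     (4 - #|thru e1 al :|: thru e2 al| - #|thru e1 ga :|: thru e2 ga|))
  * \prod_(C in circles al :\: (thru e1 al :|: thru e2 al)) tr (f C * d C).

Lemma two_traceC e1 e2 f d al ga : two_trace e1 e2 f d al ga =
  two_trace e2 e1 f d al ga.
Proof.
rewrite /two_trace setIC [thru e1 al :|: _]setUC [thru e1 ga :|: _]setUC.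
by rewrite [local_trace _ _ (thru e1 _) _ _ * _]mulrC.
Qed.

Lemma edge_trace_comp e1 e2 f d al : e1 \in M -> e2 \in M -> e1 != e2 ->
  e1 \notin al -> e2 \notin al ->
  \sum_(g | labelled (circles (e1 |: al)) g)
    edge_trace e1 f (label_factor dual g) al (e1 |: al)
    * edge_trace e2 (label_factor mon g) d (e1 |: al) (e2 |: (e1 |: al))
  = two_trace e1 e2 f d al (e2 |: (e1 |: al)).
Proof.
move=> e1M e2M ne e1al e2al; set be := e1 |: al; set ga := e2 |: be.
have e2be : e2 \notin be by rewrite !inE negb_or eq_sym ne.
set A := thru e1 be; set B := thru e2 be; set Y := circles be.
pose U := \prod_(C in thru e1 al) f C * th ^+ (3 - #|thru e1 al| - #|A|).
pose W := \prod_(C in thru e2 ga) d C * th ^+ (3 - #|B| - #|thru e2 ga|).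
have off2 : Y :\: B = circles ga :\: thru e2 ga := thru_off be e2M.
have off1 : circles al :\: thru e1 al = Y :\: A := thru_off al e1M.
rewrite (eq_bigr (fun g =>
    (tr (U * \prod_(C in A) label_factor dual g C)
       * \prod_(C in Y :\: A) tr (f C * label_factor dual g C))
    * (tr (W * \prod_(C in B) label_factor mon g C)
       * \prod_(C in Y :\: B) tr (label_factor mon g C * d C)))); last first.
  move=> g _; rewrite /edge_trace off2 /local_trace [_ * _ * th ^+ _]mulrAC.
  by rewrite -[_ * _ * th ^+ _]mulrA [\prod_(C in thru e2 be) _ * (_ * _)]mulrC.
apply: etrans (gluing complete handle U W f d (thru_sub e1 be) (thru_sub e2 be))
  _.
have dX : B :\: A = thru e2 al :\: thru e1 al by rewrite -(thru_diff e2 off1).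
have dZ : A :\: B = thru e1 ga :\: thru e2 ga by rewrite -(thru_diff e1 off2).
have offU : Y :\: (A :|: B) = circles al :\: (thru e1 al :|: thru e2 al).
  exact: setD_union (esym off1) dX.
rewrite -setI_eq0 offU /two_trace; congr (_ * _).
have disE : (thru e1 al :&: thru e2 al == set0) = (A :&: B == set0).
  by apply/eqP/eqP; apply: thru_disjoint; rewrite off1.
rewrite disE; case: ifP => [/eqP AB0|/set0Pn[C0 CAB]].
  have Z0 : thru e2 ga :&: thru e1 ga = set0.
    by apply: (thru_disjoint off2); rewrite setIC.
  have X0 : thru e1 al :&: thru e2 al = set0 by apply/eqP; rewrite disE AB0.
  (* Without a common circle, the change at either edge leaves the circles at the other one as they
     are. *)
  have EA : A = thru e1 ga.
    have /setDidPl <- : [disjoint A & B] by rewrite -setI_eq0 AB0.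
    by rewrite dZ; apply/setDidPl; rewrite -setI_eq0 setIC Z0.
  have EB : B = thru e2 al.
    have /setDidPl <- : [disjoint B & A] by rewrite -setI_eq0 setIC AB0.
    by rewrite dX; apply/setDidPl; rewrite -setI_eq0 setIC X0.
  rewrite /U /W -/A -/B EA EB /local_trace (mulrAC (\prod_(C in thru e1 al) f
    C)).
  by rewrite (mulrC (\prod_(C in thru e2 ga) d C *
    _)) (mulrA (\prod_(C in thru e2 al) f C)).
have cX := card_thru e1M e1al; have cZ := card_thru e2M e2be.
rewrite -/be -/ga -/A -/B in cX cZ.
have cA := cardsID B A; have cB := cardsID A B.
have m0 : (0 < #|A :&: B|)%N by apply/card_gt0P; exists C0.
rewrite setIC in cB; rewrite /local_trace; congr (tr _).
rewrite [thru e1 ga :|: _]setUC !prod_setU !cards_setU -dX -dZ.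
apply: merge_exponents; rewrite -/A -/B.
exact: exponent_arith cX cZ cA cB m0.
Qed.

End Composition.

Section Differential.
Variables (P : pmgraph) (n : nat).
Hypotheses (n_gt0 : (0 < n)%N) (n_even : ~~ odd n).
Local Notation E := (edge P).
Local Notation H := (half P).
Local Notation s := (rotn P).
Local Notation R := (coefR n).
Local Notation V := (algV n).
Local Notation M := (matching P).
Local Notation state := (estate P n).
Local Notation tr := (traceV n_gt0).
Local Notation th := (mobElt n).
Implicit Types x y z : state.

Definition dfac x : {set H} -> V := label_factor (@dualV n) x.2.
Definition mfac x : {set H} -> V := label_factor (@monV n) x.2.

Lemma validP x : reflect (x.1 \subset M /\ labelled (circles x.1) x.2) (valid
  x).
Proof. exact: andP. Qed.

Lemma pureE (v : {set H} -> V) y : valid y ->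
  pure v y = \prod_(C in circles y.1) tr (v C * dfac y C).
Proof.
case/validP => _ /forallP lab; apply: eq_bigr => C Cy.
have := lab C; rewrite Cy /dfac /label_factor; case: (y.2 C) => // l _.
exact: coordV_trace.
Qed.

(** Coordinates are traces against the dual basis. Merging and splitting have p + r = 3 and no
    [mobElt], the latter by [comulV_trace]; a circle that stays single has p + r = 2 and one factor
    [mobElt], from [mobV]. *)
Lemma edge_mapE e x y : valid y -> e \in M -> e \notin x.1 -> y.1 = e |: x.1 ->
  edge_map e x y = edge_trace tr th e (mfac x) (dfac y) x.1 y.1.
Proof.
move=> vy eM ex yE; rewrite /edge_map /edge_trace /local_trace.
rewrite /thru !through_earcs //.
set a := s (e, false); set c := s a.
have aA : a \in arcs P by have [] := @arc_rot P (e, false) eM.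
have cA : c \in arcs P by have [] := @arc_rot P (e, false) eM.
set A := circle x.1 a; set B := circle x.1 c.
set A' := circle y.1 a; set B' := circle y.1 c.
have A'y : A' \in circles y.1 by apply: circle_in.
have B'y : B' \in circles y.1 by apply: circle_in.
have AB : A != B -> A' = B'.
  by move=> ne; rewrite /A' /B' yE; apply: merge_or_split.
have split1 (F : {set H} -> R) (S : {set {set H}}) : S \subset circles y.1 ->
   \prod_(C in circles y.1) F C = \prod_(C in S) F C *
     \prod_(C in circles y.1 :\: S) F C.
  by move=> Sy; rewrite (big_setID S) (setIidPr Sy).
have sub2 : [set A'; B'] \subset circles y.1 by apply/subsetP => C /set2P[] ->.
case: ifPn => [neAB|/negPn/eqP eqAB].
  rewrite -(AB neAB) setUid cards1 !big_set1 (pureE _ vy) (split1 _ [set A'])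
    ?sub1set //.
  rewrite big_set1 eqxx cards2 neAB expr0 mulr1.
  rewrite big_setU1 ?inE // big_set1; congr (_ * _).
  by apply: eq_bigr => C; rewrite !inE => /andP[/negPf ->].
case: ifPn => [neAB'|/negPn/eqP eqAB'].
  rewrite (@eq_comulV _ _ (fun p q => tr (p * dfac y A') * tr (q * dfac y B')
     * \prod_(C in circles y.1 :\: [set A'; B']) tr (mfac x C * dfac y C))).
    rewrite comulV_trace -eqAB setUid cards1 big_set1 cards2 neAB' expr0 mulr1.
    by rewrite big_setU1 ?inE // big_set1 mulrA.
  move=> p q; rewrite (pureE _ vy) (split1 _ [set A';
    B']) // big_setU1 ?inE // big_set1.
  rewrite eqxx [B' == A']eq_sym (negPf neAB') eqxx /=; congr (tr _ * tr _ * _).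
  by apply: eq_bigr => C; rewrite !inE negb_or => /andP[/andP[/negPf ->
    /negPf ->]].
rewrite -eqAB -eqAB' !setUid !cards1 !big_set1 (pureE _ vy) (split1 _ [set A'])
  ?sub1set //.
rewrite big_set1 eqxx expr1 mobV_E [_ * th * _]mulrAC; congr (tr _ * _).
by apply: eq_bigr => C; rewrite !inE => /andP[/negPf ->].
Qed.

Lemma sum_valid (W : nmodType) (be : {set E}) (F : state -> W) : be \subset M ->
  \sum_(y | valid y && (y.1 == be)) F y
  = \sum_(g | labelled (circles be) g) F (be, g).
Proof.
move=> beM; rewrite (reindex_onto (fun g => (be, g)) snd) /=; last first.
  by case=> b g /= /andP[_ /eqP ->].
apply: eq_bigl => g; rewrite !eqxx !andbT.
by apply/validP/idP => [[]|].
Qed.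

Lemma edge_map_comp e f x z : valid x -> valid z -> e \in M -> f \in M -> e !=
  f ->
  e \notin x.1 -> f \notin x.1 -> z.1 = f |: (e |: x.1) ->
  \sum_(y | valid y && (y.1 == e |: x.1)) edge_map e x y * edge_map f y z
  = two_trace tr th e f (mfac x) (dfac z) x.1 z.1.
Proof.
move=> /validP[xM _] vz eM fM nef ex fx zE.
have fbe : f \notin e |: x.1 by rewrite !inE negb_or eq_sym nef.
have beM : e |: x.1 \subset M by rewrite subUset sub1set eM.
rewrite sum_valid // zE.
rewrite -(edge_trace_comp (sum_trace_dual n_gt0) (sum_dual_mon n_gt0 n_even))
  //.
apply: eq_bigr => g lab.
have vy : valid (e |: x.1, g) by apply/andP.
by rewrite (edge_mapE vy eM ex erefl) (@edge_mapE f (e |: x.1,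
  g) z vz fM fbe zE) zE.
Qed.

End Differential.

Lemma zinv_double_eq0 N (r : zinv N) : r + r = 0 -> r = 0.
Proof.
move=> rr; apply: val_inj; apply/eqP; move/(congr1 val): rr.
by rewrite rmorphD rmorph0 /= => /eqP; rewrite -mulr2n mulrn_eq0.
Qed.

Section DifferentialSquare.
Variables (P : pmgraph) (n : nat).
Hypotheses (n_gt0 : (0 < n)%N) (n_even : ~~ odd n).
Local Notation E := (edge P).
Local Notation M := (matching P).
Local Notation R := (coefR n).
Local Notation state := (estate P n).
Implicit Types (x y z : state) (al : {set E}).

Lemma edge_sign_setU1 e f al : e \notin al ->
  edge_sign n f (e |: al) = edge_sign n f al * (-1) ^+
    (enum_rank e < enum_rank f)%N.
Proof.
move=> eal; rewrite /edge_sign -exprD; congr (_ ^+ _).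
set p := fun e' : E => (enum_rank e' < enum_rank f)%N.
have [ef|ef] := boolP (p e).
  have -> : [set e' in e |: al | p e'] = e |: [set e' in al | p e'].
    by apply/setP => e'; rewrite !inE; case: eqP => // ->.
  by rewrite cardsU1 inE (negPf eal) -/(p e) ef addnC.
rewrite -/(p e) (negPf ef) addn0; apply: eq_card => e'; rewrite !inE.
by have [->|//] := eqVneq e' e; rewrite -[(_ < _)%N]/(p e) (negPf ef) !andbF.
Qed.

Lemma edge_sign_anti e f al : e != f -> e \notin al -> f \notin al ->
  edge_sign n e al * edge_sign n f (e |: al)
  = - (edge_sign n f al * edge_sign n e (f |: al)) :> R.
Proof.
move=> nef eal fal; rewrite !edge_sign_setU1 //.
have : enum_rank e != enum_rank f :> nat.
  by rewrite (inj_eq val_inj) (inj_eq enum_rank_inj).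
case: ltngtP => // _ _; rewrite expr0 expr1 mulr1 mulrN1 mulrN ?opprK;
  by rewrite mulrC.
Qed.

Lemma diff_coef_comp x z : valid x -> valid z ->
  \sum_(y | valid y) diff_coef x y * diff_coef y z = 0.
Proof.
move=> vx vz; pose Q e f := [&& e \in M :\: x.1, f \in M :\: (e |: x.1) & z.1 ==
  f |: (e |: x.1)].
pose A e f := edge_sign n e x.1 * edge_sign n f (e |: x.1)
  * two_trace (traceV n_gt0) (mobElt n) e f (mfac x) (dfac z) x.1 z.1.
have -> : \sum_(y | valid y) diff_coef x y * diff_coef y z = \sum_(p : E * E |
  Q p.1 p.2) A p.1 p.2.
  rewrite -(pair_big_dep (fun e => e \in M :\: x.1)
    (fun e f => (f \in M :\: (e |: x.1)) && (z.1 == f |: (e |: x.1))) A) /=.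
  under eq_bigr => y vy do rewrite /diff_coef mulr_suml.
  rewrite (exchange_big_dep (fun e => e \in M :\: x.1)) /=;
    last by move=> y e _ /andP[].
  apply: eq_bigr => e eMx.
  transitivity (\sum_(y | valid y && (y.1 == e |: x.1))
    \sum_(f | (f \in M :\: (e |: x.1)) && (z.1 == f |: (e |: x.1)))
      edge_sign n e x.1 * edge_sign n f (e |: x.1) * (edge_map e x y *
        edge_map f y z)).
    apply: eq_big => [y|y /andP[_ /andP[_ /eqP yE]]]; first by rewrite eMx.
    by rewrite mulr_sumr yE; apply: eq_bigr => f _; rewrite mulrACA.
  rewrite exchange_big /=; apply: eq_bigr => f /andP[fM /eqP zE].
  rewrite -mulr_sumr /A -edge_map_comp //.
  - by move: eMx; rewrite inE => /andP[].
  - by move: fM; rewrite inE => /andP[].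
  - by move: fM; rewrite !inE negb_or eq_sym => /andP[/andP[]].
  - by move: eMx; rewrite inE => /andP[].
  - by move: fM; rewrite !inE negb_or => /andP[/andP[]].
have Qsym e f : Q e f -> Q f e.
  rewrite /Q !inE !negb_or => /and3P[/andP[-> ->] /andP[/andP[fe ->] ->] zE].
  by rewrite eq_sym fe setUCA zE.
(* Exchanging e and f fixes the two-edge trace and reverses the sign, so the sum is its own
   negative; R has no 2-torsion. *)
apply: zinv_double_eq0; rewrite [X in X + _](reindex_inj (h := fun p => (p.2,
  p.1))) /=; last first.
  by move=> [a b] [c d] /= [-> ->].
rewrite (eq_bigl (fun p => Q p.1 p.2)) => [|[e f]]; last by apply/idP/idP;
  apply: Qsym.
rewrite -big_split big1 //= => -[e f] /=; rewrite /Q !inE !negb_or.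
move=> /and3P[/andP[ex _] /andP[/andP[fe fx] _] _].
by rewrite /A edge_sign_anti // two_traceC mulNr addNr.
Qed.

End DifferentialSquare.

Lemma mod_arith n a b c m k : (a + b + k * n = 2 * n)%N -> (b + c = m * (2 *
  n))%N ->
  a = c %[mod n].
Proof.
move=> e1 e2; have e3 : ((m * 2 + k) * n + a = 2 * n + c)%N by nia.
by rewrite -(modnMDl (m * 2 + k) a) e3 modnMDl.
Qed.

(** * Compatibility of the differential with the grading *)

Section Grading.
Variables (P : pmgraph) (n : nat).
Hypotheses (n_gt0 : (0 < n)%N) (n_even : ~~ odd n).
Local Notation E := (edge P).
Local Notation M := (matching P).
Local Notation H := (half P).
Local Notation state := (estate P n).
Implicit Types (x y z : state).

Definition weight x (C : {set H}) : nat := if x.2 C is Some l then 2 * l.1 +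
  l.2 else 0.

Lemma qdegE x : qdeg x = (\sum_(C in circles x.1) weight x C)%N.
Proof. by []. Qed.

(** Since 2i + j and j have the same parity, for even n the Z/2-degree is determined by the
    Z/n-degree and is preserved along with it. *)
Lemma odd_bdeg x : odd (bdeg x) = odd (qdeg x).
Proof.
rewrite /bdeg /qdeg; elim/big_ind2: _ => // [a b c d ac bd|C _];
  first by rewrite !oddD ac bd.
by case: (x.2 C) => // l; rewrite oddD mul2n odd_double.
Qed.

Lemma homV_mfac x C : homV (weight x C) (mfac x C).
Proof.
rewrite /weight /mfac /label_factor; case: (x.2 C) => [l|];
  first exact: homV_monV.
by have := homV_mon n 0 0; rewrite !expr0 mulr1.
Qed.

Lemma homV_dfac x C : valid x -> C \in circles x.1 -> homV (2 *
  n - weight x C) (dfac x C).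
Proof.
case/validP => _ /forallP/(_ C) lab Cx; move: lab;
  rewrite Cx /weight /dfac /label_factor.
by case: (x.2 C) => // l _; apply: homV_dual.
Qed.

Lemma weight_le x C : (weight x C <= 2 * n)%N.
Proof.
by rewrite /weight; case: (x.2 C) => // -[[i lti] [j ltj]] /=; clear - lti ltj;
  lia.
Qed.

(** Every trace in the entry is nonzero, so its argument has weight 2n. On an untouched circle this
    forces equal weights in x and y; on the piece at e the k factors [mobElt] shift the balance by
    kn. *)
Lemma edge_map_qdeg e x y : valid y -> e \in M -> e \notin x.1 -> y.1 =
  e |: x.1 ->
  edge_map e x y != 0 -> qdeg x = qdeg y %[mod n].
Proof.
move=> vy eM ex yE; rewrite (edge_mapE n_gt0 vy eM ex yE) /edge_trace.
have off := thru_off x.1 eM; rewrite -yE in off.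
set k := (3 - _ - _)%N; have [->|nz1] :=
  eqVneq (local_trace (traceV n_gt0) (mobElt n) (mfac x) (dfac y)
  (thru e x.1) (thru e y.1) k) 0.
  by rewrite mul0r eqxx.
have [->|nz2 _] := eqVneq (\prod_(C in circles y.1 :\: thru e y.1) traceV n_gt0
  (mfac x C * dfac y C)) 0; first by rewrite mulr0 eqxx.
have yin C : C \in thru e y.1 ->
  C \in circles y.1 by apply: subsetP (thru_sub e y.1) C.
have n_gt1 : (1 < n)%N by clear - n_gt0 n_even; lia.
have hom1 : homV (\sum_(C in thru e x.1) weight x C +
  \sum_(C in thru e y.1) (2 * n - weight y C) + k * n)
  (\prod_(C in thru e x.1) mfac x C * \prod_(C in thru e y.1) dfac y C *
    mobElt n ^+ k).
  apply: homV_M; last by apply: homV_exp; apply: homV_mobElt.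
  apply: homV_M; first by apply: homV_prod => C _; apply: homV_mfac.
  by apply: homV_prod => C Cy; apply: homV_dfac => //; apply: yin.
have {hom1 nz1} e1 := homV_trace hom1 nz1.
have e2 C : C \in circles y.1 :\: thru e y.1 -> weight x C = weight y C.
  move=> CY; have Cy : C \in circles y.1 by move: CY; rewrite inE => /andP[].
  have nz : traceV n_gt0 (mfac x C * dfac y C) != 0.
    by apply: contraNneq nz2 => z0; rewrite (big_setD1 C) //= z0 mul0r.
  have := homV_trace (homV_M (homV_mfac x C) (homV_dfac vy Cy)) nz.
  have := weight_le y C; clear; lia.
have e3 : (\sum_(C in thru e y.1) (2 * n - weight y C) +
  \sum_(C in thru e y.1) weight y C
  = #|thru e y.1| * (2 * n))%N.
  rewrite -big_split -sum_nat_const /=; apply: eq_bigr => C _.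
  by rewrite subnK // weight_le.
rewrite !qdegE (big_setID (thru e x.1)) [in RHS](big_setID (thru e y.1)) /=.
rewrite (setIidPr (thru_sub _ _)) (setIidPr (thru_sub _ _)) off (eq_bigr _ e2).
apply/eqP; rewrite eqn_modDr; apply/eqP.
exact: mod_arith e1 e3.
Qed.

Lemma diff_coef_qdeg x y : valid y -> diff_coef x y != 0 ->
  qdeg x = qdeg y %[mod n] /\ #|y.1| = #|x.1|.+1.
Proof.
move=> vy; rewrite /diff_coef => nz.
have [e /andP[/andP[+ /eqP yE] ne0]] : exists e, ((e \in M :\: x.1) && (y.1 ==
  e |: x.1))
    && (edge_sign n e x.1 * edge_map e x y != 0).
  apply/existsP; apply: contraNT nz; rewrite negb_exists => /forallP z0.
  by apply/eqP; apply: big1 => e cond; move: (z0 e);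
    rewrite cond /= negbK => /eqP.
rewrite inE => /andP[ex eM]; split; last by rewrite yE cardsU1 ex.
apply: (edge_map_qdeg vy eM ex yE).
by apply: contraNneq ne0 => ->; rewrite mulr0.
Qed.

End Grading.

(** * Ranks and the Euler characteristic *)

Lemma common_denominator (I : finType) (r : I -> rat) :
  exists2 q : nat, (0 < q)%N & forall i, exists m : int, r i * q%:R = m%:~R.
Proof.
exists (\prod_i `|denq (r i)|)%N.
  by rewrite prodn_gt0 // => i; rewrite absz_gt0 denq_neq0.
move=> i; rewrite (bigD1 i) //=; set d := (\prod_(j | _) _)%N.
exists (numq (r i) * d%:Z); rewrite natrM mulrA intrM; congr (_ * _).
by rewrite -[X in X * _]divq_num_den pmulrn absz_denq divfK // intr_eq0
  denq_neq0.
Qed.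

Section HomologyRank.
Variables (R : comNzRingType) (iota : {rmorphism R -> rat}) (X : finType).
Hypothesis iota_inj : injective iota.
Variables (D : X -> X -> R) (S0 S1 : {set X}).
Hypothesis DD0 : forall x z, \sum_y D x y * D y z = 0.
Hypothesis D_grade : forall x y, x \in S0 -> D x y != 0 -> y \in S1.
Local Notation N := #|X|.

Implicit Types (S : {set X}) (z : X -> R).

Definition supported (S : {set X}) (z : X -> R) := forall x, z x != 0 ->
  x \in S.

Definition independent_classes k := exists z : 'I_k -> X -> R,
  (forall j, supported S1 (z j) /\ forall y, \sum_x z j x * D x y = 0) /\
  forall c : 'I_k -> R,
    (exists2 w, supported S0 w & forall y, \sum_j c j * z j y = \sum_x w x *
      D x y) ->
    forall j, c j = 0.

Definition rat_diff : 'M[rat]_N := \matrix_(i,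
  j) iota (D (enum_val i) (enum_val j)).
Definition rat_incl (S : {set X}) : 'M[rat]_(#|S|, N) :=
  \matrix_(i, j) (enum_val i == enum_val j :> X)%:R.
Definition rat_row (z : X -> R) : 'rV[rat]_N := \row_j iota (z (enum_val j)).

Lemma sum_enum_val (W : nmodType) (F : X -> W) :
  \sum_x F x = \sum_(i < N) F (enum_val i).
Proof.
rewrite (reindex (@enum_val X (mem X))) //; apply: onW_bij.
exact: enum_val_bij.
Qed.

Lemma rat_inclP m (A : 'M[rat]_(m, N)) S :
  reflect (forall i j, A i j != 0 -> enum_val j \in S) (A <= rat_incl S)%MS.
Proof.
apply: (iffP submxP) => [[u ->] i j|AS].
  rewrite mxE; apply: contraR => jS; apply/eqP/big1 => l _; rewrite mxE.
  case: eqP => [e|_]; last by rewrite mulr0.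
  by rewrite -e enum_valP in jS.
exists (\matrix_(i, l) A i (enum_rank (enum_val l))); apply/matrixP => i j;
  rewrite !mxE.
have [jS|jS] := boolP (enum_val j \in S).
  rewrite (bigD1 (enum_rank_in jS (enum_val j))) //=
    !mxE enum_rankK_in // eqxx mulr1.
  rewrite enum_valK big1 ?addr0 // => l ne; rewrite !mxE; case: eqP => [e|_];
    last by rewrite mulr0.
  by case/eqP: ne; apply: enum_val_inj; rewrite enum_rankK_in.
have A0 : A i j = 0 by apply: contraNeq jS; apply: AS.
rewrite A0 big1 // => l _; rewrite !mxE; case: eqP => [e|_];
  last by rewrite mulr0.
by rewrite -e enum_valP in jS.
Qed.

Lemma rank_rat_incl S : \rank (rat_incl S) = #|S|.
Proof.
apply/eqP; apply/row_freeP; exists (rat_incl S)^T; apply/matrixP => i j;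
  rewrite !mxE.
rewrite (bigD1 (enum_rank (enum_val i))) //= !mxE enum_rankK eqxx mul1r.
rewrite (inj_eq enum_val_inj) eq_sym big1 ?addr0 // => l ne; rewrite !mxE.
case: eqP => [e|_]; last by rewrite mul0r.
by move: ne; rewrite e enum_valK eqxx.
Qed.

Lemma rat_row_diff z : rat_row z *m rat_diff = rat_row (fun y => \sum_x z x *
  D x y).
Proof.
apply/rowP => j; rewrite !mxE sum_enum_val rmorph_sum; apply: eq_bigr => i _.
by rewrite !mxE rmorphM.
Qed.

Lemma rat_row_sub S z : supported S z <-> (rat_row z <= rat_incl S)%MS.
Proof.
split=> [zS|/rat_inclP zS x nz]; first apply/rat_inclP => i j.
  by rewrite mxE -(rmorph0 iota) (inj_eq iota_inj); apply: zS.
have := zS 0 (enum_rank x); rewrite mxE enum_rankK; apply.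
by rewrite -(rmorph0 iota) (inj_eq iota_inj).
Qed.

Lemma rat_row_inj z z' : rat_row z = rat_row z' -> z =1 z'.
Proof.
by move=> /rowP e x; have := e (enum_rank x);
  rewrite !mxE enum_rankK => /iota_inj.
Qed.

Lemma clear_rows m (A : 'M[rat]_(m, N)) :
  exists2 q : nat, (0 < q)%N & exists z : 'I_m -> X -> R, forall i,
    rat_row (z i) = q%:R *: row i A.
Proof.
have [q q0 qA] := common_denominator (fun p : 'I_m * X =>
  A p.1 (enum_rank p.2)).
have [F FA] := choice qA; exists q => //;
  exists (fun i x => (F (i, x))%:~R) => i.
by apply/rowP => j; rewrite !mxE rmorph_int -FA /= enum_valK mulrC.
Qed.

Lemma rat_diff2 : rat_diff *m rat_diff = 0.
Proof.
apply/matrixP => i j; rewrite !mxE -[RHS](rmorph0 iota) -(DD0 (enum_val i)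
  (enum_val j)).
by rewrite sum_enum_val rmorph_sum; apply: eq_bigr => l _; rewrite !mxE rmorphM.
Qed.

Definition rat_cycles := (rat_incl S1 :&: kermx rat_diff)%MS.
Definition rat_bounds := (rat_incl S0 *m rat_diff)%MS.

Lemma rat_bounds_sub : (rat_bounds <= rat_cycles)%MS.
Proof.
rewrite sub_capmx; apply/andP; split; last by apply/sub_kermxP;
  rewrite -mulmxA rat_diff2 mulmx0.
apply/rat_inclP => i j; rewrite mxE (bigD1 (enum_rank (enum_val i))) //=
  !mxE enum_rankK eqxx mul1r.
rewrite big1 ?addr0 => [|l ne].
  by rewrite -(rmorph0 iota) (inj_eq iota_inj); apply: D_grade;
    apply: enum_valP.
rewrite !mxE; case: eqP => [e|_]; last by rewrite mul0r.
by move: ne; rewrite e enum_valK eqxx.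
Qed.

Lemma rank_rat_cycles : \rank rat_cycles = (#|S1|
  - \rank (rat_incl S1 *m rat_diff))%N.
Proof.
have := mxrank_mul_ker (rat_incl S1) rat_diff; rewrite rank_rat_incl => e.
by apply/esym/eqP; rewrite -[X in (X - _)%N]e addKn.
Qed.

Definition hrank :=
  (#|S1| - \rank (rat_incl S1 *m rat_diff) - \rank (rat_incl S0 *m rat_diff))%N.

Lemma hrankE : hrank = (\rank rat_cycles - \rank rat_bounds)%N.
Proof. by rewrite rank_rat_cycles. Qed.

(** A rational relation modulo boundaries becomes a relation over R after multiplication by a common
    denominator, so independence passes to Q. *)
Lemma independent_leq k : independent_classes k -> (k <= hrank)%N.
Proof.
case=> z [zc free]; pose Z : 'M[rat]_(k, N) := \matrix_(i, j) rat_row (z i) 0 j.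
have rowZ i : row i Z = rat_row (z i) by apply/rowP => j; rewrite !mxE.
have Zc : (Z <= rat_cycles)%MS.
  apply/row_subP => i; rewrite rowZ sub_capmx;
    have [/rat_row_sub -> z0] := zc i.
  by apply/sub_kermxP; rewrite rat_row_diff; apply/rowP => j;
    rewrite !mxE z0 rmorph0.
have uZ (u : 'rV[rat]_k) : (u *m Z <= rat_bounds)%MS -> u = 0.
  case/submxP => w uw.
  (* One denominator serves both the coefficients of the relation and the chain it bounds. *)
  have [q q0 qE] := common_denominator (fun p : 'I_k + X =>
    match p with inl i => u 0 i | inr x =>
      (w *m rat_incl S0) 0 (enum_rank x) end).
  have [F FE] := choice qE.
  have qn0 : q%:R != 0 :> rat by rewrite pnatr_eq0 -lt0n.
  pose c i : R := (F (inl i))%:~R; pose wf x : R := (F (inr x))%:~R.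
  have wfE : rat_row wf = q%:R *: (w *m rat_incl S0).
    by apply/rowP => j; rewrite !mxE rmorph_int -FE enum_valK mulrC mxE.
  suff c0 i : c i = 0.
    apply/rowP => i; rewrite !mxE; apply: (mulIf qn0).
    by rewrite mul0r (FE (inl i)) -(rmorph_int iota) -[X in iota X]/(c i) c0
      rmorph0.
  apply: free; exists wf.
    by apply/rat_row_sub; rewrite wfE scalemx_sub // submxMl.
  apply: rat_row_inj; rewrite -rat_row_diff wfE -scalemxAl -mulmxA -uw.
  apply/rowP => j; rewrite !mxE rmorph_sum mulr_sumr; apply: eq_bigr => l _.
  by rewrite !mxE rmorphM rmorph_int -(FE (inl l)) mulrCA mulrA.
rewrite hrankE leq_subRL; last exact: mxrankS rat_bounds_sub.
have rZ : \rank Z = k.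
  apply/eqP; rewrite -[_ == _]/(row_free Z) -kermx_eq0; apply/rowV0P => v.
  by rewrite sub_kermx => /eqP vZ; apply: uZ; rewrite vZ sub0mx.
have cap0 : (rat_bounds :&: Z = 0)%MS.
  apply/eqP/rowV0P => v; rewrite sub_capmx => /andP[vB /submxP[u vE]].
  by rewrite vE (uZ u) ?mul0mx // -vE.
rewrite -{1}rZ -mxrank_sum_cap cap0 mxrank0 addn0.
by apply: mxrankS; rewrite addsmx_sub rat_bounds_sub.
Qed.

(** Rows of a rational basis of a complement of the boundaries in the cycles, scaled to integer
    entries, are cocycles over R. *)
Lemma independent_hrank k : (k <= hrank)%N -> independent_classes k.
Proof.
rewrite hrankE => kh; pose C := (rat_cycles :\: rat_bounds)%MS.
have rC : \rank C = (\rank rat_cycles - \rank rat_bounds)%N.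
  have := mxrank_cap_compl rat_cycles rat_bounds; rewrite -/C.
  by rewrite (capmx_idPr rat_bounds_sub) => <-; rewrite addKn.
rewrite -rC in kh; pose Z := rowsub (widen_ord kh) (row_base C).
have ZC : (Z <= C)%MS by rewrite -(eq_row_base C) rowsub_sub.
have freeZ (u : 'rV[rat]_k) : u *m Z = 0 -> u = 0.
  have /row_freeP[B CB] := row_base_free C.
  move=> /(congr1 (mulmx^~ B));
    rewrite mul0mx -mulmxA mul_rowsub_mx CB => /rowP u0.
  apply/rowP => i; have := u0 (widen_ord kh i);
    rewrite !mxE (bigD1 i) //= !mxE eqxx mulr1.
  rewrite big1 ?addr0 // => l ne; rewrite !mxE; case: eqP => [e|_];
    last by rewrite mulr0.
  by case/eqP: ne; apply/val_inj; have /= := congr1 val e.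
have [q q0 [z zE]] := clear_rows Z.
have qn0 : q%:R != 0 :> rat by rewrite pnatr_eq0 -lt0n.
exists z; split=> [j|c [w wS wE] j].
  have : (row j Z <= rat_cycles)%MS.
    by apply: submx_trans (row_sub j Z) (submx_trans ZC (diffmxSl _ _)).
  rewrite -(eqmx_scale _ qn0) -zE sub_capmx =>
    /andP[/rat_row_sub zS /sub_kermxP].
  rewrite rat_row_diff => /rowP z0; split=> // y.
  by have := z0 (enum_rank y);
    rewrite !mxE enum_rankK -(rmorph0 iota) => /iota_inj.
pose u : 'rV[rat]_k := \row_i iota (c i).
suff /rowP/(_ j) : u = 0 by rewrite !mxE -(rmorph0 iota) => /iota_inj.
apply: freeZ; apply/eqP; rewrite -submx0 -(capmx_diff rat_cycles rat_bounds).
rewrite sub_capmx (submx_trans (submxMl _ _) ZC) /=.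
rewrite -(eqmx_scale _ qn0).
have -> : q%:R *: (u *m Z) = rat_row w *m rat_diff.
  rewrite rat_row_diff; apply/rowP => l;
    rewrite [RHS]mxE -wE !mxE rmorph_sum mulr_sumr.
  apply: eq_bigr => i _; have /rowP/(_ l) := zE i; rewrite !mxE rmorphM => ->.
  by rewrite mulrCA.
by apply: submxMr; apply/rat_row_sub.
Qed.

Lemma independent_classesP k : independent_classes k <-> (k <= hrank)%N.
Proof. by split; [apply: independent_leq | apply: independent_hrank]. Qed.

End HomologyRank.

Lemma alternating_telescope (h N r : nat -> int) m :
  (forall i, h i = N i - r i - (if i is i'.+1 then r i' else 0)) ->
  \sum_(i < m.+1) (-1) ^+ i * h i = \sum_(i < m.+1) (-1) ^+ i * N i - (-1) ^+
    m * r m.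
Proof.
move=> hE; elim: m => [|m IHm].
  by rewrite !big_ord_recl !big_ord0 hE; ring.
by rewrite big_ord_recr /= IHm [in RHS]big_ord_recr /= hE exprS; ring.
Qed.

(** * The Euler characteristic as a sum over states *)

Section EulerCharacteristic.
Variables (P : pmgraph) (n : nat).
Hypotheses (n_gt0 : (0 < n)%N) (n_even : ~~ odd n).
Local Notation E := (edge P).
Local Notation M := (matching P).
Local Notation H := (half P).
Local Notation state := (estate P n).
Local Notation R := (coefR n).
Implicit Types (x y z : state) (i : nat) (a : 'I_n) (eps : bool).

(** Extension by zero makes the differential a square matrix on the whole type of labelled states,
    as the rank computation requires. *)
Definition valid_coef x y : R := if valid x &&
  valid y then diff_coef x y else 0.

Lemma diffE (z : {ffun state -> R}) y : diff z y = \sum_x z x * valid_coef x y.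
Proof.
rewrite ffunE /valid_coef; case: ifP => vy; last by rewrite big1 // => x _;
  rewrite andbF mulr0.
by rewrite big_mkcond; apply: eq_bigr => x _; rewrite andbT; case: ifP;
  rewrite ?mulr0.
Qed.

Lemma valid_coef_comp x z : \sum_y valid_coef x y * valid_coef y z = 0.
Proof.
rewrite /valid_coef; have [vx|_] /= := boolP (valid x);
  last by rewrite big1 // => y _; rewrite mul0r.
have [vz|_] := boolP (valid z); last by rewrite big1 // => y _;
  rewrite andbF mulr0.
rewrite -[RHS](diff_coef_comp n_gt0 n_even vx vz) [RHS]big_mkcond /=.
by apply: eq_bigr => y _; case: (valid y); rewrite ?mul0r.
Qed.

Definition deg_set i a eps : {set state} :=
  [set x | [&& valid x, #|x.1| == i, qdeg x == a %[mod n] & odd (bdeg x) ==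
    eps]].

Definition pred_deg_set i a eps : {set state} :=
  if i is i'.+1 then deg_set i' a eps else set0.

Lemma valid_coef_grade i a eps x y :
  x \in deg_set i a eps -> valid_coef x y != 0 -> y \in deg_set i.+1 a eps.
Proof.
rewrite !inE => /and4P[vx /eqP xi /eqP xa /eqP <-].
rewrite /valid_coef vx /=; case: ifP => [vy|]; last by rewrite eqxx.
move=> nz; have [qd cd] := diff_coef_qdeg n_gt0 n_even vy nz.
rewrite cd xi eqxx -qd xa eqxx /= !odd_bdeg.
by rewrite -(odd_mod _ (negPf n_even)) -qd odd_mod // (negPf n_even).
Qed.

Lemma pred_deg_grade i a eps x y :
  x \in pred_deg_set i a eps -> valid_coef x y != 0 -> y \in deg_set i a eps.
Proof. by case: i => [|i]; [rewrite inE | apply: valid_coef_grade]. Qed.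

Lemma in_degreeP i a eps (z : {ffun state -> R}) :
  in_degree i a eps z <-> supported (deg_set i a eps) z.
Proof.
split=> zS x nz; have := zS x nz; rewrite inE.
  by case=> -> -> -> ->; rewrite !eqxx.
by case/and4P => -> /eqP -> /eqP -> /eqP.
Qed.

Lemma coboundaryP i a eps (z : {ffun state -> R}) : coboundary i a eps z <->
  exists2 w, supported (pred_deg_set i a eps) w & forall y, z y = \sum_x w x *
    valid_coef x y.
Proof.
case: i => [|i] /=; split.
- move=> ->; exists (fun=> 0) => [x|y]; first by rewrite eqxx.
  by rewrite ffunE big1 // => x _; rewrite mul0r.
- case=> w w0 zE; apply/ffunP => y; rewrite zE ffunE big1 // => x _.
  have [->|/w0] := eqVneq (w x) 0; first by rewrite mul0r.
  by rewrite inE.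
- by case=> w /in_degreeP wS ->; exists w => // y; rewrite diffE.
case=> w wS zE; exists [ffun x => w x].
  by apply/in_degreeP => x; rewrite ffunE; apply: wS.
by apply/ffunP => y; rewrite diffE zE; apply: eq_bigr => x _; rewrite ffunE.
Qed.

Lemma free_classesP i a eps k : @free_classes P n i a eps k <->
  independent_classes valid_coef (pred_deg_set i a eps) (deg_set i a eps) k.
Proof.
split=> -[z [zc free]].
  exists z; split=> [j|c [w wS wE] j].
    have [/in_degreeP zS z0] := zc j; split=> // y.
    by rewrite -diffE z0 ffunE.
  apply: free; apply/coboundaryP; exists w => // y; rewrite ffunE; exact: wE.
exists (fun j => [ffun x => z j x]); split=> [j|c /coboundaryP[w wS wE] j].
  have [zS z0] := zc j; split; first by apply/in_degreeP => x; rewrite ffunE;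
    apply: zS.
  by apply/ffunP => y; rewrite diffE [RHS]ffunE -[RHS](z0 y);
    apply: eq_bigr => x _; rewrite ffunE.
apply: free; exists w => // y; rewrite -wE ffunE.
by apply: eq_bigr => l _; rewrite ffunE.
Qed.

Definition coef_rat : {rmorphism coefR n -> rat} := (\val : zinv (3 * n) ->
  rat).
Local Notation iota := coef_rat.

Definition drank i a eps : nat :=
  \rank (rat_incl (deg_set i a eps) *m rat_diff iota valid_coef).
Definition pred_drank i a eps : nat := if i is i'.+1 then drank i' a eps else 0.

Lemma zinv_val_inj : injective iota.
Proof. exact: val_inj. Qed.

Lemma hrank_deg i a eps :
  hrank iota valid_coef (pred_deg_set i a eps) (deg_set i a eps)
  = (#|deg_set i a eps| - drank i a eps - pred_drank i a eps)%N.
Proof.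
rewrite /hrank; case: i => [|i] //=; congr (_ - _)%N; apply/eqP.
by rewrite -leqn0 (leq_trans (mxrankM_maxl _ _)) // rank_rat_incl cards0.
Qed.

Lemma MH_rankE i a eps :
  @MH_rank P n i a eps = (#|deg_set i a eps|
    - drank i a eps - pred_drank i a eps)%N.
Proof.
rewrite -hrank_deg.
have fP k : @free_classes P n i a eps k
    <-> (k <= hrank iota valid_coef (pred_deg_set i a eps) (deg_set i a eps))%N.
  rewrite -(independent_classesP zinv_val_inj valid_coef_comp);
    first exact: free_classesP.
  exact: pred_deg_grade.
have hN : (hrank iota valid_coef (pred_deg_set i a eps) (deg_set i a eps) < #|{:
  state}|.+1)%N.
  by rewrite ltnS hrank_deg -subnDA (leq_trans (leq_subr _ _)) // max_card.
apply/eqP; rewrite eqn_leq; apply/andP; split.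
  by apply/bigmax_leqP => k /asboolP /fP.
by apply: (@leq_bigmax_cond _ _ (fun k : 'I__ => k : nat) (Ordinal hN));
  apply/asboolP/fP.
Qed.

Lemma rank_bound i a eps :
  (drank i a eps + pred_drank i a eps <= #|deg_set i a eps|)%N.
Proof.
have rk := rank_rat_cycles iota valid_coef (deg_set i a eps).
have := mxrankS (rat_bounds_sub zinv_val_inj valid_coef_comp (@pred_deg_grade i
  a eps)).
have := mxrankM_maxl (rat_incl (deg_set i a eps)) (rat_diff iota valid_coef).
rewrite rank_rat_incl -/(drank i a eps) => le1.
have -> : \rank (rat_bounds iota valid_coef (pred_deg_set i a eps)) =
  pred_drank i a eps.
  case: i {rk le1} => [|i] //=; apply/eqP.
  by rewrite -leqn0 (leq_trans (mxrankM_maxl _ _)) // rank_rat_incl cards0.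
rewrite rk -/(drank i a eps) leq_subRL //.
Qed.

Lemma card_state_le x : valid x -> (#|x.1| <= #|M|)%N.
Proof. by case/validP => /subset_leq_card. Qed.

(** The bound is applied one degree above the top, where there are no states. *)
Lemma drank_top a eps : drank #|M| a eps = 0%N.
Proof.
have := rank_bound #|M|.+1 a eps; rewrite /= => le.
have s0 : deg_set #|M|.+1 a eps = set0.
  apply/setP => x; rewrite !inE; apply/and4P => -[/card_state_le + /eqP e].
  by rewrite e ltnn.
by apply/eqP; rewrite -leqn0; move: le;
  rewrite s0 cards0 leqn0 addn_eq0 => /andP[_ /eqP ->].
Qed.

Lemma Q_part1 sgn : (Q_part P n sgn).[1] = \sum_(a < n) \sum_(i < #|M|.+1)
   \sum_(eps : bool | odd i (+) eps == sgn) (@MH_rank P n i a eps)%:R.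
Proof.
rewrite horner_sum; apply: eq_bigr => a _; rewrite horner_sum;
  apply: eq_bigr => i _.
rewrite horner_sum; apply: eq_bigr => eps _.
by rewrite hornerZ hornerXn expr1n mulr1.
Qed.

Lemma Q_diff_MH : (Q_plus n P - Q_minus n P).[1] =
  \sum_(a < n) \sum_(eps : bool)
   (-1) ^+ eps * \sum_(i < #|M|.+1) (-1) ^+ i * (@MH_rank P n i a eps)%:R.
Proof.
rewrite hornerD hornerN !Q_part1 -sumrB; apply: eq_bigr => a _.
rewrite -sumrB; under [RHS]eq_bigr => eps _ do rewrite mulr_sumr.
rewrite exchange_big; apply: eq_bigr => i _ /=.
rewrite !(big_mkcond (fun eps => _ == _)) /= -sumrB; apply: eq_bigr => eps _.
rewrite mulrA -[(-1) ^+ (i : nat)]signr_odd; move: (_%:R) => m.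
by case: (odd i); case: eps; rewrite /= ?expr0 ?expr1; ring.
Qed.

Lemma euler_MH a eps : \sum_(i < #|M|.+1) (-1) ^+ i * (@MH_rank P n i a eps)%:R
  = \sum_(i < #|M|.+1) (-1) ^+ i * #|deg_set i a eps|%:R :> int.
Proof.
pose h i : int := (@MH_rank P n i a eps)%:R.
pose N i : int := #|deg_set i a eps|%:R.
pose r i : int := (drank i a eps)%:R.
have hE i : h i = N i - r i - (if i is i'.+1 then r i' else 0).
  rewrite /h MH_rankE /N /r; have := rank_bound i a eps.
  case: i => [|i] /=; rewrite ?addn0 => le;
    first by rewrite subn0 natrB // subr0.
  by rewrite -subnDA natrB // natrD opprD addrA.
have := alternating_telescope #|M| hE.
by rewrite [r #|M|]/r drank_top mulr0 subr0.
Qed.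

Lemma euler_states : (Q_plus n P - Q_minus n P).[1] = \sum_(x : state |
  valid x) (-1) ^+ (#|x.1| + bdeg x).
Proof.
rewrite Q_diff_MH; under eq_bigr => a _ do under eq_bigr =>
  eps _ do rewrite euler_MH.
transitivity (\sum_(a < n) \sum_(eps : bool) \sum_(i < #|M|.+1) \sum_(x in
  deg_set i a eps)
    (-1) ^+ (#|x.1| + bdeg x) : int).
  apply: eq_bigr => a _; apply: eq_bigr => eps _; rewrite mulr_sumr;
    apply: eq_bigr => i _.
  rewrite (eq_bigr (fun=> (-1) ^+ eps * (-1) ^+ i)) => [|x].
    by rewrite sumr_const -[RHS]mulr_natr mulrA.
  rewrite inE => /and4P[_ /eqP xi _ /eqP xe].
  by rewrite xi exprD mulrC -[in RHS]xe signr_odd.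
have degx x : (qdeg x %% n < n)%N by rewrite ltn_mod.
transitivity (\sum_(x : state | valid x) \sum_(a < n | a == Ordinal (degx x))
   \sum_(eps | eps == odd (bdeg x)) \sum_(i < #|M|.+1 | #|x.1| == i)
   (-1) ^+ (#|x.1| + bdeg x) : int); last first.
  apply: eq_bigr => x vx; rewrite big_pred1_eq big_pred1_eq.
  have lti : (#|x.1| < #|M|.+1)%N by rewrite ltnS card_state_le.
  by rewrite (big_pred1 (Ordinal lti)) // => i; rewrite eq_sym -val_eqE.
apply/esym; rewrite (exchange_big_dep xpredT) //=; apply: eq_bigr => a _.
rewrite (exchange_big_dep xpredT) //=; apply: eq_bigr => eps _.
rewrite (exchange_big_dep xpredT) //=; apply: eq_bigr => i _.
apply: eq_bigl => x; rewrite inE -val_eqE /= (modn_small (ltn_ord a)) [eps ==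
  _]eq_sym [a == _ :> nat]eq_sym.
by rewrite -!andbA; do !bool_congr.
Qed.

Lemma sum_labelled_prod (L T : finType) (G : option L -> int) (Y : {set T}) :
  \sum_(g | labelled Y g) \prod_(C in Y) G (g C) = (\sum_(l : L) G (Some l)) ^+
    #|Y|.
Proof.
pose Q (C : T) (o : option L) := isSome o == (C \in Y).
pose F (C : T) (o : option L) : int := if C \in Y then G o else 1.
transitivity (\sum_(g in family Q) \prod_C F C (g C)).
  apply: eq_big => [g|g _]; first by apply/forallP/familyP => gQ C; apply: gQ.
  by rewrite big_mkcond; apply: eq_bigr => C _.
rewrite -bigA_distr_big_dep -prodr_const [RHS]big_mkcond; apply: eq_bigr => C _.
rewrite /Q /F; case: (C \in Y).
  rewrite (reindex_omap Some id) => [|[]] //=.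
  by apply: eq_bigl => l; rewrite !eqxx.
by rewrite (big_pred1 None) // => -[].
Qed.

Lemma euler_circles : (Q_plus n P - Q_minus n P).[1]
  = \sum_(al : {set E} | al \subset M) (-1) ^+ #|al| * n%:R ^+ #|circles al|.
Proof.
rewrite euler_states (partition_big (fun x => x.1) (fun al => al \subset M)) =>
  [|x /validP[]] //=.
apply: eq_bigr => al alM; rewrite sum_valid //=.
under eq_bigr => g _ do rewrite exprD.
rewrite -mulr_sumr; congr (_ * _).
(* Each power of x carries 1, y and y^2, which count 1 - 1 + 1 = 1. *)
have -> : n%:R = \sum_(l : lab n) (-1) ^+ (l.2 : nat) :> int.
  rewrite (eq_bigr (fun l : lab n => (fun k m => (-1) ^+
    (m : 'I_3)) l.1 l.2)) //.
  rewrite -(pair_bigA _ (fun k (m : 'I_3) => (-1) ^+ m)) /= .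
  rewrite (eq_bigr (fun=> 1)) ?sumr_const ?card_ord // => k _.
  by rewrite !big_ord_recl big_ord0.
rewrite -(sum_labelled_prod (fun o : option (lab n) =>
  if o is Some l then (-1) ^+ (l.2 : nat) else 1)).
apply: eq_bigr => g _; rewrite /bdeg /=.
rewrite (big_morph _ (exprD (-1 : int)) (expr0 _)); apply: eq_bigr => C _.
by case: (g C).
Qed.

End EulerCharacteristic.

(** * Brackets as signed colorings *)

Lemma skein_sum (P : pmgraph) (R : comNzRingType) (c : R) (es : seq (edge P))
  (al : {set edge P}) :
  uniq es -> {in es, forall e, e \notin al} ->
  skein c es al = \sum_(B : {set edge P} | B \subset es) (-1) ^+ #|B| * c ^+
    #|circles (B :|: al)|.
Proof.
elim: es al => [|e es IHes] al /= => [_ _|/andP[ees ues] notal].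
  rewrite (big_pred1 set0) => [|B]; first by rewrite cards0 expr0 mul1r set0U.
  by rewrite /= -subset0; apply: eq_subset_r => x; rewrite inE.
have esal : {in es, forall e', e' \notin al} by move=> e' e'es; apply: notal;
  rewrite inE e'es orbT.
rewrite (IHes al ues esal) (IHes (e |: al) ues); last first.
  by move=> e' e'es; rewrite !inE negb_or esal // andbT;
    apply: contraNneq ees => <-.
rewrite [RHS](bigID (fun B : {set edge P} => e \in B)) /= addrC; congr (_ + _).
  apply: eq_bigl => B; apply/subsetP/andP => [sub|[/subsetP sub eB] x xB].
    split; first by apply/subsetP => x /sub xes; rewrite inE xes orbT.
    by apply: contra ees; apply: sub.
  by move: (sub x xB); rewrite inE => /orP[/eqP xe|//]; rewrite -xe xB in eB.
rewrite -sumrN [RHS](reindex_onto (fun B => e |: B) (fun B => B :\ e)) /=;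
  last first.
  by move=> B /andP[_ eB]; rewrite setD1K.
apply: eq_big => [B|B sub].
  apply/subsetP/andP => [sub|[/andP[/subsetP sub _] /eqP eB] x xB].
    have eB : e \notin B by apply: contra ees; apply: sub.
    rewrite setU11 andbT setU1K //; split=> //.
    by apply/subsetP => x; rewrite !inE => /orP[->//|/sub ->]; rewrite orbT.
  have := sub x; rewrite !inE xB orbT => /(_ isT) /orP[/eqP xe|//].
  by move: xB; rewrite -eB xe !inE eqxx.
have eB : e \notin B by apply: contra ees; apply: (subsetP sub).
by rewrite cardsU1 eB exprS mulN1r mulNr setUCA setUA.
Qed.

Lemma skein_matching (P : pmgraph) (R : comNzRingType) (c : R) :
  skein c (enum (matching P)) set0
  = \sum_(al : {set edge P} | al \subset matching P) (-1) ^+ #|al| * c ^+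
    #|circles al|.
Proof.
rewrite skein_sum ?enum_uniq // => [|e _]; last by rewrite inE.
apply: eq_big => [B|B _]; last by rewrite setU0.
by apply: eq_subset_r => e; rewrite mem_enum.
Qed.

Section BlowupColorings.
Variables (Gamma : ribbon) (N : nat).
Local Notation E := (edge Gamma).
Local Notation H := (half Gamma).
Local Notation s := (Defs.rot (rotn Gamma)).
Local Notation P := (blowup Gamma).
Implicit Types (col : {ffun H -> 'I_N}) (al : {set edge P}) (B : {set E}).

(* The arc of the blowup from h to the next half-edge carries the color col h;
   the arc arriving at h carries in_col col h. *)
Definition in_col col (h : H) : 'I_N := col (s^-1%g h).

(** The 0-smoothing joins the outgoing arc at one end of e to the incoming arc at the other, which
    lie on the same side of e; the 1-smoothing joins outgoing to outgoing and incoming to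
    incoming. *)
Definition uncrossed col (e : E) : bool :=
  (col (e, false) == in_col col (e, true)) && (in_col col (e, false) == col (e,
    true)).
Definition crossed col (e : E) : bool :=
  (col (e, false) == col (e, true)) && (in_col col (e, false) == in_col col (e,
    true)).

Definition state_coloring al col : bool :=
  [forall e, if inl e \in al then crossed col e else uncrossed col e].

Definition arc_at (h : H) : half P := (inr h, false).

Lemma arc_at_arcs h : arc_at h \in arcs P.
Proof. by rewrite inE; apply/imsetP => -[]. Qed.

Definition half_col col (k : half P) : option 'I_N :=
  if k.1 is inr h then Some (col h) else None.

Lemma rot_blowup (k : half P) : rotn P k = blowup_next k.
Proof. by rewrite permE. Qed.

Lemma state_coloringP al col (h k : half P) : state_coloring al col ->
  state_rel al h k -> half_col col h = half_col col k.
Proof.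
move=> /forallP colP /orP[/andP[_ /eqP ->] //|].
case/exists_inP => e /imsetP[e' _ ->] /existsP[b].
have := colP e'; rewrite /= !rot_blowup /=.
case: ifP => _ /andP[/eqP c1 /eqP c2] /orP[] /andP[/eqP -> /eqP ->] /=;
  case: b => /=; rewrite /half_col /=; congr Some; by rewrite ?c1 -?c2.
Qed.

Lemma connect_half_col al col (h k : half P) : state_coloring al col ->
  connect (state_rel al) h k -> half_col col h = half_col col k.
Proof.
move=> sc /connectP[p pP ->]; elim: p h pP => //= l p IHp h /andP[hl /IHp <-].
exact: state_coloringP hl.
Qed.

Lemma circle_join al h k : state_rel al h k -> circle al h = circle al k.
Proof. by move=> hk; apply/eqP; rewrite -mem_circle inE connect1. Qed.

(** The conditions at the edges say that the color is constant along each circle, and every circle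
    contains some [arc_at h]; so these colorings are the functions on the circles. *)
Lemma card_state_coloring al :
  #|[set col | state_coloring al col]| = (N ^ #|circles al|)%N.
Proof.
pose T : finType := {C : {set half P} | C \in circles al}.
pose ci h : T := exist _ (circle al (arc_at h)) (circle_in al (arc_at_arcs h)).
pose ext (g : {ffun T -> 'I_N}) : {ffun H -> 'I_N} := [ffun h => g (ci h)].
have ciP (C : T) : exists h, ci h == C.
  case: C => C CX; have /circlesP[[[e|h] b] kA E] := CX.
    by move: kA; rewrite inE => /negP[]; apply: imset_f.
  exists h; apply/eqP/val_inj => /=; rewrite E.
  case: b {E kA} => //; apply: circle_join; apply/orP; left;
    rewrite /= eqxx andbT.
  by have := arc_at_arcs h; rewrite inE.
have ext_inj : injective ext.
  move=> g1 g2 /ffunP e; apply/ffunP => C; have [h /eqP <-] := ciP C.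
  by have := e h; rewrite !ffunE.
have ciE h k : circle al (arc_at h) = circle al (arc_at k) -> ci h =
  ci k by move=> e; apply: val_inj.
suff -> : [set col | state_coloring al col] = ext @: setT.
  by rewrite card_imset // cardsT card_ffun card_ord card_sig; congr (_ ^ _)%N;
    apply: eq_card.
apply/setP => col; rewrite !inE; apply/idP/imsetP => [sc|[g _ ->]].
  exists [ffun C : T => col (xchoose (ciP C))]; first by rewrite inE.
  apply/ffunP => h; rewrite !ffunE.
  have /eqP := xchooseP (ciP (ci h)); set h' := xchoose _ => ch.
  have : circle al (arc_at h') == circle al (arc_at h) by apply/eqP;
    apply: (congr1 val ch).
  rewrite -mem_circle inE => /(connect_half_col sc) /eqP.
  by rewrite eqE /= => /eqP.
apply/forallP => e.
have cr k l a b : circle al (arc_at k) = circle al a -> circle al (arc_at l) =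
  circle al b ->
    smoothing al (inl e) a b -> ext g k == ext g l.
  move=> ka lb ab; rewrite !ffunE; apply/eqP; congr (g _); apply: ciE;
    rewrite ka lb.
  apply: circle_join; apply/orP; right; apply/exists_inP; exists (inl e) => //.
  exact: imset_f.
have flipped k : circle al (arc_at k) = circle al (inr k, true).
  apply: circle_join; apply/orP; left; rewrite /= eqxx andbT.
  by have := arc_at_arcs k; rewrite inE.
by case: ifP => eal; apply/andP; split; rewrite /in_col;
  [ apply: (cr _ _ (inr (e, false), false) (inr (e, true), false))
  | apply: (cr _ _ (inr (s^-1%g (e, false)), true) (inr (s^-1%g (e, true)),
    true))
  | apply: (cr _ _ (inr (e, false), false) (inr (s^-1%g (e, true)), true))
  | apply: (cr _ _ (inr (s^-1%g (e, false)), true) (inr (e, true), false)) ] =>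
    //;
  apply/existsP; exists false; rewrite /= eal !rot_blowup /= !eqxx ?orbT.
Qed.

End BlowupColorings.

Section SignedColorings.
Variables (Gamma : ribbon) (N : nat).
Local Notation E := (edge Gamma).
Local Notation H := (half Gamma).
Local Notation s := (Defs.rot (rotn Gamma)).
Local Notation P := (blowup Gamma).
Implicit Types (col : {ffun H -> 'I_N}) (al : {set edge P}) (B : {set E}).

Definition admissible col : bool := [forall e,
  uncrossed col e (+) crossed col e].
Definition crossings col : {set E} := [set e | crossed col e].

(** For a fixed coloring the alternating sum over states is a product over edges of [uncrossed]
    minus [crossed], which vanishes as soon as some edge satisfies both conditions or neither. *)
Lemma skein_colorings : skein (N%:R : int) (enum (matching P)) set0
  = \sum_(col | admissible col) (-1) ^+ #|crossings col|.
Proof.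
rewrite skein_matching.
rewrite (reindex_onto (fun B => [set inl e | e in B]) (fun al => [set e |
  inl e \in al])) /=; last first.
  move=> al /subsetP alM; apply/setP => e; apply/imsetP/idP => [[e' + ->]|eal];
    first by rewrite inE.
  by have /imsetP[e' _ ee] := alM e eal; exists e'; rewrite // inE -ee.
have inlK B : [set e | inl e \in [set (inl e : E + H) | e in B]] = B.
  by apply/setP => e; rewrite inE mem_imset //; move=> ? ? [].
transitivity (\sum_(B : {set E}) (-1) ^+ #|B| * \sum_(col : {ffun H -> 'I_N})
   (state_coloring [set inl e | e in B] col)%:R : int).
  apply: eq_big => [B|B _].
    rewrite inlK eqxx andbT; apply/subsetP => _ /imsetP[e _ ->]; exact: imset_f.
  rewrite card_imset; last by move=> ? ? [].
  rewrite -natrX -card_state_coloring -natr_sum; congr (_ * _%:R).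
  rewrite -sum1_card big_mkcond; apply: eq_bigr => col _; rewrite inE.
  by case: (state_coloring _ _).
transitivity (\sum_(B : {set E}) \sum_(col : {ffun H -> 'I_N}) (-1) ^+ #|B| *
   (state_coloring [set inl e | e in B] col)%:R : int).
  by apply: eq_bigr => B _; rewrite big_distrr.
rewrite exchange_big [RHS]big_mkcond; apply: eq_bigr => col _ /=.
transitivity (\prod_e (- (crossed col e)%:R + (uncrossed col e)%:R : int)).
  rewrite bigA_distr; apply: eq_bigr => B _;
    rewrite -prodr_const [X in X * _]big_mkcond /=.
  have -> : (state_coloring [set inl e | e in B] col)%:R =
      \prod_e (if e \in B then crossed col e else uncrossed col e)%:R :> int.
    have inB e : (inl e \in [set (inl e : E + H) | e in B]) = (e \in B).
      by rewrite mem_imset //; move=> ? ? [].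
    rewrite /state_coloring; case: forallP => [sc|/forallP].
      by rewrite big1 // => e _; have := sc e; rewrite inB => ->.
    rewrite negb_forall => /existsP[e ne];
      rewrite (bigD1 e) //= -inB (negPf ne).
    by rewrite mul0r.
  by rewrite -big_split; apply: eq_bigr => e _ /=; case: ifP;
    rewrite ?mul1r ?mulN1r.
rewrite /admissible; case: forallP => [ad|/forallP].
  rewrite -prodr_const [RHS]big_mkcond; apply: eq_bigr => e _ /=; rewrite inE.
  by have := ad e; case: (crossed col e); case: (uncrossed col e) => //= _;
    rewrite ?addr0 ?add0r.
rewrite negb_forall => /existsP[e ne]; rewrite (bigD1 e) //=.
by move: ne; case: (crossed col e); case: (uncrossed col e) => //= _;
  rewrite ?addNr ?addr0 ?oppr0 ?mul0r.
Qed.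

(** With equal colors at one end, crossed and uncrossed would be the same condition. *)
Lemma admissible_neq col h : admissible col -> col h != in_col col h.
Proof.
move=> /forallP/(_ h.1); case: h => e b /=; rewrite /uncrossed /crossed => ad.
apply/eqP => ce; move: ad; case: b ce => ->; first by rewrite addbb.
by rewrite andbC addbb.
Qed.

Lemma admissibleP col h : admissible col ->
  if h.1 \in crossings col then col h = col (flip h) /\ in_col col h =
    in_col col (flip h)
  else col h = in_col col (flip h) /\ in_col col h = col (flip h).
Proof.
move=> /forallP/(_ h.1); case: h => e b /=; rewrite inE /uncrossed.
case: ifP => [/andP[/eqP c1 /eqP c2] _|_]; first by case: b.
by rewrite addbF => /andP[/eqP c1 /eqP c2]; case: b.
Qed.

End SignedColorings.

(** * Planarity *)

Section Incidence.
Variable G : graph.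

Definition incidence : 'M['F_2]_(#|{: edge G}|, #|{: vertex G}|) :=
  \matrix_(i, j) \sum_(b : bool) (endpt (enum_val i, b) == enum_val j)%:R.

Lemma addF2 (u : 'F_2) : u + u = 0.
Proof. by apply: val_inj; case: u => [[|[|]]]. Qed.

Lemma natrF2_eq0 m : (m%:R == 0 :> 'F_2) = ~~ odd m.
Proof. by rewrite -val_eqE /= val_Fp_nat //= modn2 eqb0. Qed.

Lemma sum_half (W : nmodType) (F : half G -> W) :
  \sum_h F h = \sum_e (F (e, true) + F (e, false)).
Proof.
rewrite (eq_bigr (fun h : half G => F (h.1, h.2))); last by case.
rewrite -(pair_bigA _ (fun e b => F (e, b))) /=; apply: eq_bigr => e _.
by rewrite big_bool.
Qed.

Lemma sum_delta (W : pzSemiRingType) (T : finType) (F : T -> W) (a : T) :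
  \sum_t (a == t)%:R * F t = F a.
Proof.
rewrite (bigD1 a) //= eqxx mul1r big1 ?addr0 // => t /negPf.
by rewrite eq_sym => ->; rewrite mul0r.
Qed.

(** A vector killed by the transposed matrix takes equal values at the two ends of every edge, so
    connectedness makes it constant. *)
Lemma incidence_rank : connected_graph G -> (#|{: vertex G}| <=
  (\rank incidence).+1)%N.
Proof.
move=> conn; have [e0 _] : exists e0 : edge G, true.
  by have /card_gt0P[e0] := edge_gt0 G; exists e0.
pose v0 := endpt (e0, false).
rewrite -addn1 -leq_subLR -mxrank_tr -mxrank_ker.
suff : (kermx incidence^T <= (const_mx 1 : 'rV['F_2]_#|{: vertex G}|))%MS.
  by move/mxrankS/leq_trans; apply; apply: rank_leq_row.
apply/row_subP => i; set u := row _ _.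
have u0 : u *m incidence^T = 0 by apply/sub_kermxP; apply: row_sub.
have ue e : u 0 (enum_rank (endpt (e, true))) = u 0 (enum_rank (endpt (e,
  false))).
  have /rowP/(_ (enum_rank e)) := u0; rewrite [LHS]mxE [RHS]mxE.
  rewrite (eq_bigr (fun j => (endpt (e, true) == enum_val j)%:R * u 0 j
      + (endpt (e, false) == enum_val j)%:R * u 0 j)); last first.
    by move=> j _; rewrite [incidence^T _ _]mxE [incidence _ _]mxE enum_rankK
      big_bool mulrDr !(mulrC (u 0 j)).
  pose f v := u 0 (enum_rank v).
  have sumE v : \sum_j (v == enum_val j)%:R * u 0 j = f v.
    rewrite -(sum_delta f v) [RHS]sum_enum_val; apply: eq_bigr => j _.
    by rewrite /f enum_valK.
  rewrite big_split /= !sumE => e2; apply: (addIr (f (endpt (e, false)))).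
  by rewrite e2 addF2.
have uv v w : connect (adj_off set0) v w -> u 0 (enum_rank v) =
  u 0 (enum_rank w).
  case/connectP => p pP ->; elim: p v pP => //= w' p IHp v /andP[+ /IHp <-].
  case/existsP => -[e b] /and3P[_ /eqP <- /eqP <-]; rewrite /flip /=.
  by case: b => /=; rewrite ue.
have -> : u = u 0 (enum_rank v0) *: const_mx 1.
  by apply/rowP => j; rewrite [RHS]mxE [const_mx _ _ _]mxE mulr1 -(enum_valK j);
    apply: uv; apply: conn.
exact: scalemx_sub.
Qed.

End Incidence.

Section Duality.
Variable Gamma : ribbon.
Local Notation E := (edge Gamma).
Local Notation H := (half Gamma).
Local Notation s := (Defs.rot (rotn Gamma)).
Local Notation dface := (@endpt (dual Gamma)).

Lemma face_next_inj : injective (@face_next Gamma).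
Proof. by move=> h k /perm_inj /(can_inj (@flipK _)). Qed.

Lemma dface_next (h : H) : dface (face_next h) = dface h.
Proof.
apply: val_inj; apply/setP => k; rewrite /= !inE.
have sym := fconnect_sym face_next_inj.
by apply: esym; apply: (same_connect sym); apply: fconnect1.
Qed.

Lemma dface_rot (h : H) : dface (s h) = dface (flip h).
Proof. by rewrite -(dface_next (flip h)) /face_next flipK. Qed.

Lemma dface_adj (h : H) : adj_off set0 (dface h) (dface (flip h)).
Proof. by apply/existsP; exists h; rewrite inE !eqxx. Qed.

(** Turning around a vertex crosses one edge at a time, and an edge joins the faces met at its two
    ends; so paths of the graph lift to paths of faces. *)
Lemma dual_connected : connected_graph Gamma -> connected_graph (dual Gamma).
Proof.
move=> conn; pose cn := connect (@adj_off (dual Gamma) set0).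
have flipc (h : H) : cn (dface h) (dface (flip h)) by apply/connect1/dface_adj.
have porb (h : H) i : cn (dface h) (dface ((s ^+ i)%g h)).
  elim: i => [|i IHi]; first by rewrite perm1; apply: connect0.
  by rewrite expgSr permM dface_rot; apply: connect_trans IHi (flipc _).
have vert (h k : H) : endpt h = endpt k -> cn (dface h) (dface k).
  by move/eqP; rewrite (rotP (rotn Gamma)) => /porbitP[i ->]; apply: porb.
have path_c (h k : H) v w : connect (@adj_off Gamma set0) v w -> endpt h = v ->
  endpt k = w -> cn (dface h) (dface k).
  case/connectP => p pP ->; elim: p v h pP => /= [|w' p IHp] v h.
    by move=> _ hv kv; apply: vert; rewrite hv.
  case/andP => /existsP[l /and3P[_ /eqP lv /eqP fl]] pP hv kw.
  apply: connect_trans (IHp _ (flip l) pP fl kw).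
  by apply: connect_trans (flipc l); apply: vert; rewrite hv.
move=> [F FP] [F' FP']; case/imsetP: (FP) => h _ hE;
  case/imsetP: (FP') => k _ kE.
have -> : exist _ F FP = dface h by apply: val_inj.
have -> : exist _ F' FP' = dface k by apply: val_inj.
exact: path_c (conn _ _) erefl erefl.
Qed.

Lemma card_dual : #|{: vertex (dual Gamma)}| = #|faces Gamma|.
Proof. by rewrite card_sig; apply: eq_card. Qed.

(** Along the boundary of a face the far end of each half-edge is the near end of the next, so every
    visit to a vertex is counted twice. *)
Lemma boundary_cycle : (incidence (dual Gamma))^T *m incidence Gamma = 0.
Proof.
apply/matrixP => i j; rewrite !mxE.
pose F := enum_val i; pose v := enum_val j.
transitivity (\sum_(h : H) (dface h == F)%:R * ((endpt h == v)%:R +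
  (endpt (flip h) == v)%:R) : 'F_2).
  rewrite (sum_half (G := Gamma)) [RHS]sum_enum_val; apply: eq_bigr => e _.
  by rewrite !mxE !big_bool /flip /= -!/F -!/v; ring.
under eq_bigr => h _ do rewrite mulrDr.
rewrite big_split [X in _ X _ =
  _](reindex_inj face_next_inj) -big_split big1 // => h _.
rewrite dface_next endpt_rot; exact: addF2.
Qed.

(* By Euler's formula the cycle space and the span of the face boundaries have the
   same dimension. *)
Lemma cycle_boundary (x : E -> 'F_2) : connected_graph Gamma ->
  planar_ribbon Gamma ->
  (forall v, \sum_(h : H | endpt h == v) x h.1 = 0) ->
  exists phi : vertex (dual Gamma) -> 'F_2, forall h : H, x h.1 =
    phi (dface h) + phi (dface (flip h)).
Proof.
move=> conn planar cyc.
have rk1 := incidence_rank conn.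
have rk2 := leq_trans (eq_leq (esym card_dual)) (incidence_rank (dual_connected
  conn)).
have sub1 : ((incidence (dual Gamma))^T <= kermx (incidence Gamma))%MS.
  by apply/sub_kermxP/boundary_cycle.
have sub2 : (kermx (incidence Gamma) <= (incidence (dual Gamma))^T)%MS.
  rewrite -(geq_leqif (mxrank_leqif_sup sub1)) mxrank_ker mxrank_tr.
  by move: planar rk1 rk2; rewrite /planar_ribbon /=; clear; lia.
pose X : 'rV['F_2]_#|{: E}| := \row_i x (enum_val i).
have : (X <= kermx (incidence Gamma))%MS.
  apply/sub_kermxP/rowP => j;
    rewrite [LHS]mxE [RHS]mxE -[RHS](cyc (enum_val j)).
  rewrite [RHS]big_mkcond sum_half [RHS]sum_enum_val; apply: eq_bigr => i _.
  rewrite !mxE big_bool /= mulrDr.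
  by congr (_ + _); case: (_ == _); rewrite ?mulr1 ?mulr0.
move=> /submx_trans /(_ sub2) /submxP[u uE].
exists (fun F => u 0 (enum_rank F)) => h.
have /rowP/(_ (enum_rank h.1)) := uE;
  rewrite [LHS]mxE enum_rankK [RHS]mxE => ->.
pose f F := u 0 (enum_rank F).
rewrite (eq_bigr (fun j => (dface (h.1, true) == enum_val j)%:R * f (enum_val j)
      + (dface (h.1, false) == enum_val j)%:R * f (enum_val j))); last first.
  move=> j _; rewrite [_^T _ _]mxE [incidence (dual Gamma) _ _]mxE enum_rankK
    big_bool /f enum_valK.
  by rewrite mulrDr !(mulrC (u 0 j)).
rewrite -(sum_enum_val (fun F => (dface (h.1, true) == F)%:R * f F +
  (dface (h.1, false) == F)%:R * f F)).
rewrite big_split /= !sum_delta /f; case: h => e [] /=; rewrite /flip //=.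
exact: addrC.
Qed.

End Duality.

(** * Parity of the number of crossings *)

Section PlanarColorings.
Variables (Gamma : ribbon) (N : nat).
Local Notation E := (edge Gamma).
Local Notation H := (half Gamma).
Local Notation s := (Defs.rot (rotn Gamma)).
Local Notation dface := (@endpt (dual Gamma)).
Implicit Types (col : {ffun H -> 'I_N}) (h : H).

Lemma sum_rot (W : nmodType) (F : H -> W) (v : vertex Gamma) :
  \sum_(h : H | endpt h == v) F (s^-1%g h) = \sum_(h : H | endpt h == v) F h.
Proof.
rewrite [LHS](reindex_inj (@perm_inj _ s)) /=.
by apply: eq_big => [h|h _]; rewrite ?permK // endpt_rot.
Qed.

(** The number mod 2 of strands along e with color in S: the image in the graph of the curves of
    these colors. *)
Definition color_chain (S : pred 'I_N) col (e : E) : 'F_2 :=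
  (S (col (e, false)))%:R + (S (in_col col (e, false)))%:R.

Lemma color_chainE S col h : admissible col ->
  color_chain S col h.1 = (S (col h))%:R + (S (in_col col h))%:R.
Proof.
case: h => e [] //= ad; have := admissibleP (e, false) ad;
  rewrite /color_chain /flip /=.
by case: ifP => _ [-> ->] //; rewrite addrC.
Qed.

Lemma color_chain_cycle S col v : admissible col ->
  \sum_(h : H | endpt h == v) color_chain S col h.1 = 0.
Proof.
move=> ad; rewrite (eq_bigr _ (fun h _ => color_chainE S h ad)) big_split /=.
by rewrite (sum_rot (fun h => (S (col h))%:R)) addF2.
Qed.

(* Push the curves of the colors in T off the blown-up vertices into the faces:
   a T-arc changes its side of the curves of the colors in S exactly when it
   passes a crossing. *)
Lemma crossing_pairing S T col : connected_graph Gamma -> planar_ribbon Gamma ->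
  admissible col ->
  \sum_(e in crossings col) color_chain T col e * color_chain S col e = 0.
Proof.
move=> conn planar ad.
have [phi phiE] := cycle_boundary conn planar (fun v =>
  color_chain_cycle S v ad).
(* Every arc is counted from both of its ends with the potential of one and the same face. *)
have : \sum_h ((T (col h))%:R * phi (dface (flip h)) + (T (in_col col h))%:R *
  phi (dface h)) = 0.
  rewrite big_split [X in _ _ X =
    _](reindex_inj (@perm_inj _ s)) -big_split big1 // => h _.
  by rewrite /in_col permK dface_rot; apply: addF2.
rewrite sum_half => sum0; rewrite -[RHS]sum0 [LHS]big_mkcond;
  apply: eq_bigr => e _.
have := admissibleP (e, false) ad;
  rewrite (phiE (e, false)) /color_chain /flip /=.
case: ifP => _ [-> ->]; first by ring.
set a := _%:R; set b := _%:R; set p := phi _; set q := phi _.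
have -> : a * p + b * q + (b * q + a * p) = (a * p + b * q) + (a * p + b *
  q) by ring.
by rewrite addF2.
Qed.

(** Pairing each color c with the colors above it counts every crossing once, namely when c is the
    smaller of its two colors. *)
Lemma crossings_even col : connected_graph Gamma -> planar_ribbon Gamma ->
  admissible col -> ~~ odd #|crossings col|.
Proof.
move=> conn planar ad; rewrite -natrF2_eq0.
have -> : #|crossings col|%:R = \sum_(c : 'I_N) \sum_(e in crossings col)
    color_chain (fun d => c < d)%N col e * color_chain (pred1 c) col e :> 'F_2.
  rewrite exchange_big -sumr_const; apply: eq_bigr => e _ /=.
  rewrite (eq_bigr (fun c => (col (e, false) == c)%:R * color_chain (fun d =>
    c < d)%N col e
     + (in_col col (e, false) == c)%:R * color_chain (fun d => c < d)%N col e));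
         last first.
    by move=> c _; rewrite -mulrDl mulrC.
  rewrite big_split /= !sum_delta /color_chain !ltnn.
  have := admissible_neq (e, false) ad; rewrite -val_eqE /=.
  by case: ltngtP => // _ _; rewrite ?addr0 ?add0r.
by rewrite big1 // => c _; apply: crossing_pairing.
Qed.

Lemma skein_planar : connected_graph Gamma -> planar_ribbon Gamma ->
  skein (P := blowup Gamma) (N%:R : int) (enum (matching (blowup Gamma))) set0
  = #|[set col : {ffun H -> 'I_N} | admissible col]|%:R.
Proof.
move=> conn planar; rewrite skein_colorings -sum1dep_card natr_sum;
  apply: eq_bigr => col ad.
by rewrite -signr_odd (negPf (crossings_even conn planar ad)).
Qed.

End PlanarColorings.

(** * Face colorings as uncrossed colorings *)

Section FaceColorings.
Variables (Gamma : ribbon) (N : nat).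
Local Notation E := (edge Gamma).
Local Notation H := (half Gamma).
Local Notation s := (Defs.rot (rotn Gamma)).
Local Notation dface := (@endpt (dual Gamma)).
Implicit Types (col : {ffun H -> 'I_N}) (h : H).

(** The arc from h to [s h] bounds a corner of the face of [s h], which by [dface_rot] is the face
    of [flip h]. *)
Definition corner_coloring (c : {ffun vertex (dual Gamma) -> 'I_N}) : {ffun H ->
  'I_N} :=
  [ffun h : H => c (dface (flip h))].

Lemma corner_in_col c h : in_col (corner_coloring c) h = c (dface h).
Proof. by rewrite /in_col ffunE -dface_rot permKV. Qed.

Lemma corner_admissible c : vertex_coloring c -> admissible (corner_coloring c).
Proof.
move=> /forallP cP; apply/forallP => e;
  rewrite /uncrossed /crossed !corner_in_col !ffunE /flip /=.
by rewrite !eqxx /= (negPf (cP (e, true))).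
Qed.

Lemma vertex_colorings_le : (vertex_colorings (dual Gamma) N <=
  #|[set col : {ffun H -> 'I_N} | admissible col]|)%N.
Proof.
rewrite /vertex_colorings -(card_imset (f := corner_coloring)).
  apply/subset_leq_card/subsetP => _ /imsetP[c + ->]; rewrite !inE;
    exact: corner_admissible.
move=> c c' /ffunP e; apply/ffunP => -[F FP]; case/imsetP: (FP) => h _ hE.
have -> : exist _ F FP = dface (flip (flip h)) by apply: val_inj;
  rewrite /= flipK.
by have := e (flip h); rewrite !ffunE.
Qed.

Lemma face_colorableP : face_colorable Gamma N <->
  exists c : {ffun vertex (dual Gamma) -> 'I_N}, vertex_coloring c.
Proof.
have [e0 _] : exists e0 : E, true by have /card_gt0P[e0] := edge_gt0 Gamma;
  exists e0.
split=> [[c cP]|[c /forallP cP]].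
  by exists [ffun F => c (val F)]; apply/forallP => h; rewrite !ffunE;
    apply: cP.
exists (fun F => c (insubd (dface (e0, true)) F)) => h.
have fE k : insubd (dface (e0, true)) (face k) = dface k.
  by apply: val_inj; rewrite /= insubdK //; apply: face_in.
by rewrite !fE; apply: cP.
Qed.

End FaceColorings.

Lemma admissible4_face_colorable (Gamma : ribbon) (col : {ffun half Gamma ->
  'I_4}) :
  connected_graph Gamma -> planar_ribbon Gamma -> admissible col ->
    face_colorable Gamma 4.
Proof.
move=> conn planar ad; apply/face_colorableP.
(* The two binary digits of a color each give a potential on the faces; the two colors at a
   half-edge differ in some digit. *)
have [phi1 e1] := cycle_boundary conn planar
  (fun v => color_chain_cycle (fun c : 'I_4 => odd c) v ad).
have [phi2 e2] := cycle_boundary conn planar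
  (fun v => color_chain_cycle (fun c : 'I_4 => 1 < c)%N v ad).
have c4 : #|{: 'F_2 * 'F_2}| = 4 by rewrite card_prod !card_ord.
exists [ffun F => cast_ord c4 (enum_rank (phi1 F, phi2 F))].
apply/forallP => h; rewrite !ffunE (inj_eq (@cast_ord_inj _ _ _)) (inj_eq
  enum_rank_inj).
apply/eqP => -[f1 f2]; have ne := admissible_neq h ad.
have := e1 h; have := e2 h;
  rewrite !color_chainE // f1 f2 !addF2 => {e1 e2 f1 f2}.
move: (col h) (in_col col h) ne => a b.
by case: a => [[|[|[|[|]]]] ?]; case: b => [[|[|[|[|]]]] ?].
Qed.

Lemma bracket_even_planar (Gamma : ribbon) n (q b : int) m : connected_graph
  Gamma -> planar_ribbon Gamma ->
  (0 < n)%N -> circle_even n q b = m%:R ->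
  bracket_even (blowup Gamma) n q b = #|[set col : {ffun half Gamma -> 'I_m} |
    admissible col]|%:R.
Proof.
move=> conn planar n0 cE; rewrite /bracket_even -[n == 0%N]/(n ==
  0)%N eqn0Ngt n0 /= cE.
exact: skein_planar.
Qed.

Lemma circle_even1 n : ~~ odd n -> circle_even n 1 1 = (3 * n)%:R :> int.
Proof.
move=> ne; rewrite /circle_even (eq_bigr (fun=> 3%:R)) => [|j _];
  last by rewrite !expr1n.
rewrite sumr_const card_ord mulr_natl -!mulrnA; congr (_ *+ _); lia.
Qed.

Lemma circle_evenN1 n : ~~ odd n -> circle_even n 1 (-1) = n%:R :> int.
Proof.
move=> ne; rewrite /circle_even (eq_bigr (fun=> 1)) => [|j _];
  last by rewrite !expr1n.
rewrite sumr_const card_ord mulr_natl -!mulrnA; congr (_ *+ _); lia.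
Qed.

Lemma circle_odd1 n : circle_odd n 1 = (3 * n)%:R :> int.
Proof.
rewrite /circle_odd (eq_bigr (fun=> 1)) => [|j _]; last by rewrite !expr1n.
by rewrite sumr_const card_ord -natrM.
Qed.

Lemma face_colorable_euler (Gamma : ribbon) : connected_graph Gamma ->
  planar_ribbon Gamma ->
  face_colorable Gamma 4 <->
    0 < (Q_plus 4 (blowup Gamma) - Q_minus 4 (blowup Gamma)).[1].
Proof.
move=> conn planar; rewrite (@euler_circles (blowup Gamma) 4) //.
rewrite -skein_matching skein_planar // ltr0n; split.
  move/face_colorableP => [c cP]; apply/card_gt0P; exists (corner_coloring c).
  by rewrite inE corner_admissible.
by case/card_gt0P => col; rewrite inE; apply: admissible4_face_colorable.
Qed.

Lemma cw_gt_pos (P : pmgraph) : cw_gt 4 (Q_plus 4 P) (Q_minus 4 P) ->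
  0 < (Q_plus 4 P - Q_minus 4 P).[1].
Proof.
case=> ge0 [i gt0]; set p := _ - _ in ge0 gt0 *.
have sQ sgn : (size (Q_part P 4 sgn) <= 4)%N.
  apply: (leq_trans (size_sum _ _ _)); apply/bigmax_leqP => a _.
  apply: (leq_trans (size_sum _ _ _)); apply/bigmax_leqP => j _.
  apply: (leq_trans (size_sum _ _ _)); apply/bigmax_leqP => eps _.
  by rewrite (leq_trans (size_scale_leq _ _)) // size_polyXn.
have sp : (size p <= 4)%N.
  by rewrite (leq_trans (size_polyD _ _)) // size_polyN geq_max !sQ.
rewrite (horner_coef_wide _ sp) (bigD1 i) //= expr1n mulr1 ltr_wpDr //.
by apply: sumr_ge0 => j _; rewrite expr1n mulr1.
Qed.

(** * The dual ribbon graph *)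

Lemma vertex_half (G : graph) (v : vertex G) : connected_graph G ->
  exists h : half G, endpt h = v.
Proof.
move=> conn; have /card_gt0P[e0 _] := edge_gt0 G.
have /connectP[[|w p] /=] := conn v (endpt (e0, false)).
  by move=> _ e; exists (e0, false).
by case/andP => /existsP[h /and3P[_ /eqP hv _]] _ _; exists h.
Qed.

Lemma porbit_fconnect (T : finType) (p : {perm T}) x y : (y \in porbit p x) =
  fconnect p x y.
Proof.
apply/porbitP/idP => [[i ->]|/iter_findex <-];
  first by rewrite permX fconnect_iter.
by exists (findex p x y); rewrite permX.
Qed.

Section DualRibbon.
Variable Gamma : ribbon.
Local Notation H := (half Gamma).
Local Notation s := (Defs.rot (rotn Gamma)).
Local Notation dface := (@endpt (dual Gamma)).

Definition face_perm : {perm H} := perm (@face_next_inj Gamma).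

Lemma face_permP (h k : half (dual Gamma)) : (endpt h == endpt k) =
  (k \in porbit face_perm h).
Proof.
rewrite porbit_fconnect (eq_fconnect (permE (@face_next_inj Gamma))) -val_eqE
  /=.
have sym := fconnect_sym (@face_next_inj Gamma).
apply/eqP/idP => [/setP/(_ k)|hk]; first by rewrite !inE connect0.
by apply/setP => l; rewrite !inE; apply: (same_connect sym).
Qed.

Definition dual_ribbon : ribbon :=
  Ribbon (@Rotation (dual Gamma) face_perm face_permP).

(** The face permutation of the dual is s after two flips, that is, s itself. *)
Lemma dual_face (h : H) : @face dual_ribbon h = [set k | endpt k == endpt h].
Proof.
apply/setP => k; rewrite inE [RHS]inE eq_sym (rotP (rotn Gamma))
  porbit_fconnect.
apply: eq_fconnect => l; rewrite /face_next /= permE.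
by rewrite -[RHS](congr1 s (flipK l)).
Qed.

Lemma card_dual_faces : connected_graph Gamma -> #|faces dual_ribbon| =
  #|{: vertex Gamma}|.
Proof.
move=> conn; rewrite -[RHS](card_imset (f := fun v => [set k : H | endpt k ==
  v])).
  apply: eq_card => F; apply/imsetP/imsetP => [[h _ ->]|[v _ ->]].
    by exists (@endpt Gamma h) => //; apply: dual_face.
  by have [h <-] := vertex_half v conn; exists h => //; rewrite dual_face.
move=> v w /setP e; have [h hv] := vertex_half v conn.
by have := e h; rewrite !inE hv eqxx => /esym/eqP.
Qed.

Lemma dual_planar : connected_graph Gamma -> planar_ribbon Gamma ->
  planar_ribbon dual_ribbon.
Proof.
move=> conn; rewrite /planar_ribbon (card_dual_faces conn) => <-.
by rewrite addnC -card_dual.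
Qed.

(* The faces met when turning around the end of h join its two sides. *)
Lemma dual_bridgeless : loopless Gamma -> bridgeless dual_ribbon.
Proof.
move=> noloop.
suff key (h : H) : connect (@adj_off (dual Gamma) [set h.1]) (dface h) (dface
  (flip h)).
  by move=> h; apply: key.
pose cn := connect (@adj_off (dual Gamma) [set h.1]).
have cs : connect_sym (@adj_off (dual Gamma) [set h.1]).
  apply: sym_connect_sym => v w; apply/existsP/existsP => -[k /and3P[hA hv hw]];
  by exists (flip k); rewrite flipK; apply/and3P.
suff claim i : (i <= (#|porbit s h|).-1)%N -> cn (dface (s h)) (dface ((s ^+
  i.+1)%g h)).
  have := claim _ (leqnn _); rewrite prednK; last by rewrite card_gt0;
    apply/set0Pn; exists h; apply: porbit_id.
  by rewrite permX iter_porbit dface_rot /cn cs.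
elim: i => [|i IHi] lei; first by rewrite expg1 /cn connect0.
apply: connect_trans (IHi (ltnW lei)) _;
  rewrite [(s ^+ i.+2)%g]expgSr permM dface_rot.
set k := (s ^+ i.+1)%g h; apply: connect1; apply/existsP; exists k.
rewrite !eqxx !andbT inE; apply/eqP => kh.
have kv : endpt k = endpt h by apply/esym/eqP;
  rewrite (rotP (rotn Gamma)) mem_porbit.
(* Meeting the edge of h before the turn is complete means either returning to h too early or a
   loop. *)
have [kE|kE] : k = h \/ k = flip h.
  by move: kh; case: (k) (h) => e b [e' b'] /= ->; case: b; case: b';
    [left|right|right|left].
- have n0 : (0 < #|porbit s h|)%N by rewrite lt0n card_porbit_neq0.
  have ltn : (i.+1 < #|porbit s h|)%N by rewrite -(prednK n0) ltnS.
  have := nth_uniq h _ _ (uniq_traject_porbit s h) (i := 0%N) (j := i.+1).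
  rewrite size_traject => /(_ n0 ltn);
    rewrite !nth_traject //= -iterS -permX -/k kE.
  by rewrite eqxx.
by move: (noloop h); rewrite -kE kv eqxx.
Qed.

Lemma dual_face_coloring k : face_colorable dual_ribbon k ->
  exists c : {ffun vertex Gamma -> 'I_k}, vertex_coloring c.
Proof.
case=> c cP; exists [ffun v => c [set h : H | endpt h == v]];
  apply/forallP => h.
by rewrite !ffunE -!dual_face; apply: cP.
Qed.

End DualRibbon.

(** The condition is applied to the dual of a planar embedding, whose faces are the vertices of G. A
    bridge has the same face on both sides and so excludes face colorings, hence also the condition;
    duals of loopless graphs have none. *)
Lemma four_color_of_cw_gt :
  (forall Delta : ribbon, connected_graph Delta -> planar_ribbon Delta ->
    bridgeless Delta ->
     cw_gt 4 (Q_plus 4 (blowup Delta)) (Q_minus 4 (blowup Delta))) ->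
       four_color_theorem.
Proof.
move=> cw G conn [r planar] noloop; pose Gamma := Ribbon r.
have dconn : connected_graph (dual_ribbon Gamma) by apply: (@dual_connected
  Gamma).
have dplanar := @dual_planar Gamma conn planar.
apply: (@dual_face_coloring Gamma); apply/face_colorable_euler => //.
by apply: cw_gt_pos; apply: cw => //; apply: dual_bridgeless.
Qed.

(** * Edge colorings *)

Section EdgeColorings.
Variable Gamma : ribbon.
Local Notation E := (edge Gamma).
Local Notation H := (half Gamma).
Local Notation s := (Defs.rot (rotn Gamma)).
Hypothesis tri : trivalent Gamma.
Implicit Types (c : {ffun E -> 'I_3}) (col : {ffun H -> 'I_3}) (h : H).

Let rotVV h : s^-1%g (s^-1%g h) = s h.
Proof. by rewrite -[in LHS](trivalent_rot3 tri h) !permK. Qed.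

(* At a trivalent vertex an arc gets the color of the edge opposite to it. *)
Definition opposite_coloring c : {ffun H -> 'I_3} := [ffun h : H =>
  c (s^-1%g h).1].

Lemma opposite_inj : injective opposite_coloring.
Proof.
move=> c c' /ffunP e; apply/ffunP => x; have := e (s (x, false)).
by rewrite !ffunE permK.
Qed.

Lemma edge_coloring_vertex c h : edge_coloring c ->
  [/\ c h.1 != c (s h).1, c h.1 != c (s^-1%g h).1 & c (s h).1 !=
    c (s^-1%g h).1].
Proof.
move=> /forallP cP; have ec (k l : H) : k != l -> endpt k = endpt l -> c k.1 !=
  c l.1.
  by move=> ne kl; have /forallP/(_ l)/implyP := cP k; apply;
    rewrite ne kl eqxx.
have := trivalent_uniq tri h;
  rewrite /= !inE negb_or => /and3P[/andP[n1 n2] n3 _].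
have -> : s^-1%g h = s (s h) by rewrite -[in LHS](trivalent_rot3 tri h) permK.
by split; apply: ec; rewrite ?endpt_rot.
Qed.

Lemma ord3_third (x a b a' b' : 'I_3) : x != a -> x != b -> a != b -> x != a' ->
  x != b' -> a' != b' ->
  ((a == b') && (b == a')) (+) ((a == a') && (b == b')).
Proof.
by case: x => [[|[|[|]]] ?] //; case: a => [[|[|[|]]] ?] //;
  case: b => [[|[|[|]]] ?] //;
  case: a' => [[|[|[|]]] ?] //; case: b' => [[|[|[|]]] ?].
Qed.

Lemma opposite_admissible c : edge_coloring c ->
  admissible (opposite_coloring c).
Proof.
move=> ec; apply/forallP => e;
  rewrite /uncrossed /crossed /in_col !ffunE !rotVV.
have [n1 n2 n3] := edge_coloring_vertex (e, false) ec.
have [m1 m2 m3] := edge_coloring_vertex (e, true) ec.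
by apply: (@ord3_third (c e)) => //; rewrite eq_sym.
Qed.

Lemma ord3_unique (a b x y : 'I_3) : x != a -> x != b -> a != b -> y != a ->
  y != b -> x = y.
Proof.
move=> xa xb ab ya yb; apply/eqP; move: xa xb ab ya yb.
by case: x => [[|[|[|]]] ?] //; case: a => [[|[|[|]]] ?] //;
  case: b => [[|[|[|]]] ?] //;
  case: y => [[|[|[|]]] ?].
Qed.

Lemma admissible_vertex col h : admissible col ->
  [/\ col (s h) != col h, col (s h) != in_col col h & col h != in_col col h].
Proof.
move=> ad; have := admissible_neq (s h) ad;
  have := admissible_neq (s^-1%g h) ad.
by rewrite /in_col permK rotVV eq_sym => -> ->; split=> //;
  apply: admissible_neq.
Qed.

(** The three arcs at a vertex have three different colors. Both ends of an edge see the same two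
    colors, so the third color, that of the opposite arc, also agrees at the two ends and colors the
    edge. *)
Lemma admissible_opposite col : admissible col ->
  exists2 c, edge_coloring c & col = opposite_coloring c.
Proof.
move=> ad; pose c : {ffun E -> 'I_3} := [ffun e => col (s (e, false))].
have cE h : c h.1 = col (s h).
  case: h => e b /=; rewrite ffunE; case: b => //.
  have [n1 n2 n3] := admissible_vertex (e, false) ad.
  have [m1 m2 m3] := admissible_vertex (e, true) ad.
  have := admissibleP (e, false) ad; rewrite /flip /= => ce.
  apply/esym/(ord3_unique m1 m2 m3); case: ifP ce n1 n2 => _ [-> ->] //.
exists c; last by apply/ffunP => h; rewrite ffunE cE permKV.
apply/forallP => h; apply/forallP => k; apply/implyP => /andP[ne].
rewrite eq_sym (trivalent_fiber tri) eq_sym (negPf ne) /= !cE.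
have [n1 n2 n3] := admissible_vertex (s h) ad.
rewrite /in_col permK in n1 n2 n3.
case/orP => /eqP ->; first by rewrite eq_sym.
by rewrite trivalent_rot3.
Qed.

Lemma card_edge_colorings :
  edge_colorings Gamma 3 = #|[set col : {ffun H -> 'I_3} | admissible col]|.
Proof.
rewrite /edge_colorings -(card_imset _ opposite_inj); apply: eq_card => col;
  rewrite inE.
apply/imsetP/idP => [[c + ->]|/admissible_opposite[c ec ->]].
  by rewrite inE; apply: opposite_admissible.
by exists c; rewrite ?inE.
Qed.

End EdgeColorings.

(** * Alternating colorings *)

Section AlternatingColorings.
Variable Gamma : ribbon.
Local Notation E := (edge Gamma).
Local Notation H := (half Gamma).
Local Notation s := (Defs.rot (rotn Gamma)).
Implicit Types (col : {ffun H -> 'I_2}) (h : H).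

Lemma sign_sum_even (T : finType) (S : {set T}) (f : T -> bool) :
  \sum_(t in S) (-1) ^+ f t = 0 :> int -> ~~ odd #|S|.
Proof.
rewrite (eq_bigr (fun t => 1 - 2%:R * (f t)%:R)) => [|t _]; last by case: (f t).
rewrite sumrB sumr_const -mulr_sumr -natr_sum -natrM => /eqP;
  rewrite subr_eq0 => /eqP e.
have -> : #|S| = (2 * \sum_(t in S) f t)%N by apply/eqP;
  rewrite -(eqr_nat int) e.
by rewrite mul2n odd_double.
Qed.

(** With two colors, an end with two different arcs sees both of them, so any two such ends match in
    exactly one way. *)
Lemma admissible2P col : reflect (forall h, odd (col h) =
  ~~ odd (in_col col h)) (admissible col).
Proof.
have odd_eq (a b : 'I_2) : (a == b) = (odd a == odd b).
  by case: a => [[|[|]] ?] //; case: b => [[|[|]] ?].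
apply: (iffP idP) => [ad h|alt].
  by have := admissible_neq h ad; rewrite odd_eq; do 2!case: (odd _).
apply/forallP => e; rewrite /uncrossed /crossed !odd_eq (alt (e,
  false)) (alt (e, true)).
by do 2!case: (odd _).
Qed.

Definition arc_sign col h : int := (-1) ^+ odd (col h).

Lemma vertex_sign_sum col v : admissible col -> \sum_(h | endpt h ==
  v) arc_sign col h = 0.
Proof.
move=> /admissible2P alt; apply/eqP;
  rewrite -[_ == 0]orFb -(mulrn_eq0 _ 2) mulr2n; apply/eqP.
rewrite -[X in X + _]sum_rot -big_split big1 // => h _ /=.
by rewrite /arc_sign (alt h) /in_col; case: (odd _).
Qed.

(* Orient every half-edge by the color of its outgoing arc: crossed edges are the
   inconsistently oriented ones. *)
Lemma crossings2_even col : admissible col -> ~~ odd #|crossings col|.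
Proof.
move=> ad; apply: (@sign_sum_even _ _ (fun e => odd (col (e, false)))).
apply/eqP; rewrite -[_ == 0]orFb -(mulrn_eq0 _ 2); apply/eqP.
have sum0 : \sum_h arc_sign col h = 0.
  rewrite (partition_big (@endpt Gamma) xpredT) //= big1 // => v _.
  exact: vertex_sign_sum.
rewrite -[RHS]sum0 sum_half -sumrMnl [LHS]big_mkcond; apply: eq_bigr => e _.
have /admissible2P alt := ad; have := admissibleP (e, false) ad;
  rewrite /flip /=.
rewrite /arc_sign; case: ifP => _ [c1 c2]; first by rewrite c1 mulr2n.
by rewrite c1 [odd (col (e, true))]alt; case: (odd _).
Qed.

Lemma bracket2_alternating :
  bracket_even (blowup Gamma) 2 1 (-1) = #|[set col : {ffun H -> 'I_2} |
    admissible col]|%:R :> int.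
Proof.
rewrite /bracket_even /= (@circle_evenN1 2) // (skein_colorings Gamma 2)
  -sum1dep_card natr_sum.
by apply: eq_bigr => col ad; rewrite -signr_odd (negPf (crossings2_even ad)).
Qed.

Lemma admissible2_eulerian col : admissible col -> eulerian Gamma.
Proof.
move=> ad v; apply: (@sign_sum_even _ _ (fun h => odd (col h))).
rewrite -[RHS](vertex_sign_sum v ad); apply: eq_bigl => h; exact: in_set.
Qed.

Lemma not_eulerian_bracket : ~ eulerian Gamma ->
  bracket_even (blowup Gamma) 2 1 (-1) = 0 :> int.
Proof.
move=> ne; rewrite bracket2_alternating (_ : [set _ | _] = set0) ?cards0 //.
by apply/setP => col; rewrite !inE; apply/negP => /admissible2_eulerian.
Qed.

Hypothesis eul : eulerian Gamma.

Definition parity h : bool := odd (findex s (froot s h) h).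

(** Positions in a cycle alternate in parity, also where it closes up, because its length is the
    even degree. *)
Lemma parity_rot h : parity (s h) = ~~ parity h.
Proof.
have sym := fconnect_sym (@perm_inj _ s).
rewrite /parity; have -> : froot s (s h) = froot s h.
  by apply/esym/(fingraph.rootP sym)/fconnect1.
set r := froot s h; have rh : fconnect s r h by rewrite sym connect_root.
have ord_even : ~~ odd (fingraph.order s r).
  have := eul (endpt r); rewrite /degree /fingraph.order; congr (~~ odd _);
    apply: eq_card => k.
  by rewrite inE eq_sym (rotP (rotn Gamma)) porbit_fconnect.
(* The remaining case is the last position of the cycle, an odd number, after which s returns to the
   root at position 0. *)
have := findex_max rh; rewrite leq_eqVlt => /orP[/eqP last|lt]; last first.
  by rewrite -[in s h](iter_findex rh) -iterS findex_iter.
have -> : s h = r by rewrite -[in s h](iter_findex rh) -iterS last iter_order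
  //; apply: perm_inj.
by rewrite findex0; move: ord_even; rewrite -last /= negbK => ->.
Qed.

Definition alternating (f : {ffun vertex Gamma -> bool}) : {ffun H -> 'I_2} :=
  [ffun h : H => inord (f (endpt h) (+) parity h)].

Lemma odd_inord2 (b : bool) : odd (inord b : 'I_2) = b.
Proof. by rewrite inordK; case: b. Qed.

(** Around a vertex an alternating coloring differs from [parity] by a constant, so it amounts to
    one free bit per vertex. *)
Lemma eulerian_bracket : connected_graph Gamma ->
  bracket_even (blowup Gamma) 2 1 (-1) = 2 ^+ #|{: vertex Gamma}| :> int.
Proof.
move=> conn; rewrite bracket2_alternating -natrX; congr _%:R.
rewrite -[in RHS]card_bool -card_ffun -cardsT -(card_imset (f := alternating));
  last first.
  move=> f g /ffunP e; apply/ffunP => v; have [h <-] := vertex_half v conn.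
  have := congr1 (fun i : 'I_2 => odd i) (e h); rewrite !ffunE !odd_inord2.
  by move/(congr1 (addb (parity h)));
    rewrite !addbA ![parity h (+) _]addbC -!addbA addbb !addbF.
apply: eq_card => col; rewrite inE;
  apply/admissible2P/imsetP => [alt|[f _ ->] h].
  have eqv h k : endpt h = endpt k -> odd (col h) (+) parity h =
    odd (col k) (+) parity k.
    move/eqP; rewrite (rotP (rotn Gamma)) => /porbitP[i ->].
    elim: i => [|i ->]; first by rewrite perm1.
    rewrite expgSr permM parity_rot [odd (col (s _))]alt /in_col permK.
    by rewrite addNb addbN negbK.
  have [g gE] := choice (fun v => vertex_half v conn).
  exists [ffun v => odd (col (g v)) (+) parity (g v)] => //.
  apply/ffunP => h; rewrite !ffunE (eqv (g (endpt h)) h) // -addbA addbb addbF.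
  by apply: val_inj; rewrite /= inordK; case: (col h) => [[|[|]]].
rewrite /in_col !ffunE !odd_inord2 -[in LHS](permKV s h) parity_rot addbN.
by rewrite -(endpt_rot (s^-1%g h)).
Qed.

End AlternatingColorings.

Theorem theorem5p2p5 (Gamma : ribbon)
    (conn : connected_graph Gamma) (planar : planar_graph Gamma) :
  (* (a) *)
  ((eulerian Gamma ->
      bracket_even (blowup Gamma) 2 1 (-1) = 2 ^+ #|{: vertex Gamma}| :> int) /\
   (~ eulerian Gamma ->
      bracket_even (blowup Gamma) 2 1 (-1) = 0 :> int)) /\
  (planar_ribbon Gamma ->
  (* (b) *)
  (trivalent Gamma ->
     bracket_odd (blowup Gamma) 1 1 = (edge_colorings Gamma 3)%:R :> int) /\
  (* (c) *)
  ((face_colorable Gamma 4 <->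
      0 < (Q_plus 4 (blowup Gamma) - Q_minus 4 (blowup Gamma)).[1]) /\
   (cw_gt 4 (Q_plus 4 (blowup Gamma)) (Q_minus 4 (blowup Gamma)) ->
      face_colorable Gamma 4) /\
   ((forall Delta : ribbon, connected_graph Delta -> planar_ribbon Delta ->
       cw_gt 4 (Q_plus 4 (blowup Delta)) (Q_minus 4 (blowup Delta))) ->
      four_color_theorem) /\
   ((forall Delta : ribbon, connected_graph Delta -> planar_ribbon Delta ->
       bridgeless Delta ->
       cw_gt 4 (Q_plus 4 (blowup Delta)) (Q_minus 4 (blowup Delta))) ->
      four_color_theorem)) /\
  (* (d) *)
  (forall n : nat, (2 %| n)%N || (3 %| n)%N ->
     ((0 < n)%N -> ~~ odd n ->
        bracket_even (blowup Gamma) n 1 1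
          >= (chromatic_poly (dual Gamma)).[(3 * n)%:R] /\
        bracket_even (blowup Gamma) n 1 (-1)
          >= (chromatic_poly (dual Gamma)).[n%:R]) /\
     (odd n ->
        bracket_odd (blowup Gamma) n 1
          >= (chromatic_poly (dual Gamma)).[(3 * n)%:R]) /\
     (n = 0%N ->
        bracket_even (blowup Gamma) n 1 (-1)
          >= (chromatic_poly (dual Gamma)).[0]))).
Proof.
split; first by split; [move=> eul;
  apply: eulerian_bracket | apply: not_eulerian_bracket].
move=> planar_rib; split; [|split].
- move=> tri; rewrite /bracket_odd circle_odd1 skein_planar //.
  by rewrite (card_edge_colorings tri).
- have cE := face_colorable_euler conn planar_rib; split; [exact: cE | split;
    [|split]].
  + by move/cw_gt_pos/cE.
  + by move=> cw; apply: four_color_of_cw_gt => Delta ? ? _; apply: cw.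
  + exact: four_color_of_cw_gt.
move=> n _; split; [|split] => [n_gt0 n_even|_|->].
- rewrite !(bracket_even_planar conn planar_rib n_gt0 (circle_even1 n_even)).
  rewrite (bracket_even_planar conn planar_rib n_gt0 (circle_evenN1 n_even)).
  by rewrite !chromatic_polyE !ler_nat !vertex_colorings_le.
- by rewrite /bracket_odd circle_odd1 skein_planar // chromatic_polyE ler_nat
    vertex_colorings_le.
(* For n = 0 the bracket is 0 by convention, and the dual has a vertex, which no coloring with 0
   colors can serve. *)
rewrite -[X in _.[X]]/(0%:R) chromatic_polyE lern0 -leqn0 /vertex_colorings.
have [e0 _] : exists e0 : edge Gamma, true by have /card_gt0P[e0] :=
  edge_gt0 Gamma; exists e0.
rewrite leqn0 cards_eq0; apply/eqP/setP => c.
by case: (c (@endpt (dual Gamma) (e0, true))).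
Qed.
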